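(* Let $(U,\mathrm{dist})$ be a metric space of doubling dimension $D$, let $S\subseteq U$ be a set of $n$ points with aspect ratio $\Delta$, let $k<n$ be a positive integer and $\epsilon>0$. There is an algorithm that, given an augmented cover tree $T$ for $S$ (in explicit representation), $k$ and $\epsilon$, returns a set $C\subseteq S$ with $|C|\le k$ and $r_C(S)\le(2+O(\epsilon))\,r^*_k(S)$, in time $O\big((k/\epsilon)(768/\epsilon)^D\log\Delta\big)$.
   Context: The doubling dimension of $(U,\mathrm{dist})$ is the minimum $D\ge0$ such that every ball $B(p,r)=\{q\in U:\mathrm{dist}(p,q)\le r\}$ is contained in the union of at most $2^D$ balls of radius $r/2$ centered at points of $U$. The aspect ratio of $S$ is $\Delta=d_{\max}/d_{\min}$, the ratio of the maximum and minimum distances between two distinct points of $S$. For $C\subseteq S$, $r_C(S)=\max_{p\in S}\min_{q\in C}\mathrm{dist}(p,q)$; the $k$-center problem asks for $C\subseteq S$, $|C|\le k$, minimizing $r_C(S)$, and $r^*_k(S)$ denotes the optimal value. A cover tree $T$ for $S$ is a rooted tree with levels indexed by integers decreasing from the root; $T_\ell$ is the set of nodes at level $\ell$, each node $u$ is associated with a point $u.\mathrm{point}\in S$, the points of the nodes of $T_\ell$ are distinct, and every non-root node of $T_\ell$ has a parent in $T_{\ell+1}$. Writing $\mathrm{dist}(u,v)=\mathrm{dist}(u.\mathrm{point},v.\mathrm{point})$, for every level $\ell$: (1) the points of $T_\ell$ are contained in the points of $T_{\ell-1}$; (2) $\mathrm{dist}(u,u.\mathrm{parent})\le 2^{\ell+1}$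 for $u\in T_\ell$; (3) $\mathrm{dist}(u,v)>2^\ell$ for distinct $u,v\in T_\ell$. In the explicit representation, maximal chains of same-point nodes each having only the same-point child are coalesced into a single node. An augmented cover tree additionally stores at each node $u$ the number $u.\mathrm{weight}$ of points of $S$ associated with nodes in the subtree rooted at $u$ (and, if a matroid is given, a maximal independent set of those points; otherwise this field is empty).
   Formalization: In the time bound ε is replaced by min(ε, 768) and log Δ by max(1, ln Δ), since the literal bound vanishes when Δ = 1 and tends to 0 as ε grows, while at least one point must always be output. *)

(* Defs.v *)
From HB Require Import structures.
From mathcomp Require Import all_boot all_order all_algebra finmap.
From mathcomp Require Import boolp classical_sets functions reals.
From mathcomp Require Import topology normedtype sequences exp.

Set Implicit Arguments.
Unset Strict Implicit.
Unset Printing Implicit Defensive.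

Import Order.TTheory GRing.Theory Num.Theory.

Local Open Scope classical_set_scope.
Local Open Scope fset_scope.
Local Open Scope ring_scope.

Section Metric.
Context {R : realType} {U : metricType R}.
Implicit Types (p q : U) (S C : {fset U}).

Definition cball p (r : R) : set U := [set q | mdist p q <= r].

Definition doubling (D : R) : Prop :=
  forall p (r : R), exists C : {fset U},
    #|` C|%:R <= 2 `^ D :> R /\
    (cball p r `<=` \bigcup_(c in [set` C]) cball c (r / 2))%classic.

Definition doubling_dimension (D : R) : Prop :=
  [/\ 0 <= D, doubling D & forall D' : R, 0 <= D' -> doubling D' -> D <= D'].

(* Below, sup and inf range over finite nonempty sets of reals, where they are
   a maximum and a minimum. On the empty set both are 0, hence the explicit
   C != fset0 in kcenter_opt. *)

Definition pair_dists S : set R :=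
  [set d | exists p q, [/\ p \in S, q \in S, p != q & d = mdist p q]].

Definition aspect_ratio S : R := sup (pair_dists S) / inf (pair_dists S).

Definition center_radius C S : R :=
  sup [set inf [set mdist p q | q in [set` C]] | p in [set` S]].

Definition kcenter_opt (k : nat) S : R :=
  inf [set center_radius C S |
    C in [set C : {fset U} | [/\ C `<=` S, C != fset0 & (#|` C| <= k)%N]]].

End Metric.

Arguments doubling {R} U D.
Arguments doubling_dimension {R} U D.

(* The points of the nodes of a level are distinct, so a node is a pair (l, p)
   with p in [level T l]; its parent is the node (l + 1, parent T l p). Levels
   extend downwards without end: by nesting, every point eventually has a node
   at each level. *)
Record tree (U : choiceType) := Tree {
  top_level : int;
  level : int -> {fset U};
  parent : int -> U -> U
}.

Section CoverTree.
Context {R : realType} {U : metricType R}.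
Implicit Types (T : tree U) (S : {fset U}) (p q : U) (l : int).

Record cover_tree T S : Prop := CoverTree {
  ct_root : exists p, level T (top_level T) = [fset p];
  ct_above : forall l, top_level T < l -> level T l = fset0;
  ct_sub : forall l, level T l `<=` S;
  ct_onto : forall p, p \in S -> exists l, p \in level T l;
  ct_parent : forall l p, l < top_level T -> p \in level T l ->
    parent T l p \in level T (l + 1);
  ct_nesting : forall l, level T l `<=` level T (l - 1);
  ct_covering : forall l p, l < top_level T -> p \in level T l ->
    mdist p (parent T l p) <= (2 : R) ^ (l + 1);
  ct_separation : forall l p q, p \in level T l -> q \in level T l -> p != q ->
    (2 : R) ^ l < mdist p q
}.

(* Point of the ancestor, j levels above, of the node (l, q). *)
Fixpoint ancestor T (j : nat) l q : U :=
  if j is j'.+1 then ancestor T j' (l + 1) (parent T l q) else q.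

Definition subtree_point T l p q : Prop :=
  exists j : nat, q \in level T (l - j%:Z) /\ ancestor T j (l - j%:Z) q = p.

Definition subtree_weight T S l p : nat :=
  #|` [fset q in S | `[< subtree_point T l p q >]]|.

(* Every node (l, p) of a cover tree has the same-point child (l - 1, p), by
   nesting, covering and separation. *)
Definition only_self_child T l p : Prop :=
  forall q, q \in level T (l - 1) -> parent T (l - 1) q = p -> q = p.

End CoverTree.

(* The level stored at a coalesced node is that of the highest node of its
   chain. The independent-set field is absent, as there is no matroid. *)
Record etree (U : Type) := ETree {
  enode : finType;
  eroot : enode;
  epoint : enode -> U;
  elevel : enode -> int;
  eweight : enode -> nat;
  eparent : enode -> option enode;
  echildren : enode -> seq enode
}.

Section Explicit.
Context {R : realType} {U : metricType R}.
Implicit Types (T : tree U) (S : {fset U}) (X : etree U) (l : int) (p : U).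

(* [coal l p] is the explicit node into which the node (l, p) is coalesced.
   A node and its same-point child lie in one explicit node whenever both have
   only the same-point child, and never when the upper one has another child.
   When the upper one has only the same-point child and the lower one has more,
   both conventions (the chain absorbs its branching end, or stops above it)
   are allowed. *)
Record coalescing T S X (coal : int -> U -> enode X) : Prop := Coalescing {
  co_root : forall p, p \in level T (top_level T) ->
    coal (top_level T) p = eroot X;
  co_point : forall l p, p \in level T l -> epoint (coal l p) = p;
  co_top : forall v : enode X, epoint v \in level T (elevel v) /\
    coal (elevel v) (epoint v) = v;
  co_highest : forall l p, p \in level T l -> l <= elevel (coal l p);
  co_convex : forall l1 l l2 p, l1 <= l -> l <= l2 -> p \in level T l2 ->
    coal l1 p = coal l2 p -> coal l p = coal l2 p;
  co_apart : forall l p, l < top_level T -> p \in level T l ->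
    ~ only_self_child T (l + 1) (parent T l p) ->
    coal l p <> coal (l + 1) (parent T l p);
  co_merge : forall l p, l < top_level T -> p \in level T l ->
    only_self_child T (l + 1) (parent T l p) -> only_self_child T l p ->
    coal l p = coal (l + 1) (parent T l p);
  co_parent_root : eparent (eroot X) = None;
  co_parent : forall l p, l < top_level T -> p \in level T l ->
    coal l p <> coal (l + 1) (parent T l p) ->
    eparent (coal l p) = Some (coal (l + 1) (parent T l p));
  co_children : forall u v : enode X, (u \in echildren v) = (eparent u == Some v);
  co_uniq : forall v : enode X, uniq (echildren v);
  co_weight : forall v : enode X, eweight v = subtree_weight T S (elevel v) (epoint v)
}.

Definition augmented_cover_tree X S : Prop :=
  exists T : tree U, cover_tree T S /\ exists coal, @coalescing T S X coal.

End Explicit.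

(* Unit-cost real RAM with a distance oracle. Points and tree nodes are opaque
   handles. There is no multiplication or division on integers, and no rounding
   of reals, so that numbers cannot be used to pack data. *)

Inductive instr :=
| IConst (d : nat) (z : int)
| IMove (d s : nat)
| ILoad (d s : nat)
| IStore (d s : nat)
| IAdd (d a b : nat)
| ISub (d a b : nat)
| IMul (d a b : nat)
| IDiv (d a b : nat)
| IReal (d s : nat)
| IDist (d a b : nat)
| IPoint (d s : nat)
| ILevel (d s : nat)
| IWeight (d s : nat)
| IParent (d s : nat)
| IChildren (d s : nat)
| IHead (d s : nat)
| ITail (d s : nat)
| IJump (i : nat)
| IJumpLe (a b i : nat)
| IJumpNil (a i : nat)
| IOutput (s : nat).

Definition program := seq instr.

Section Machine.
Context {R : realType} {U : metricType R} (X : etree U).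

Inductive value :=
| VNil
| VInt of int
| VReal of R
| VPoint of U
| VNode of enode X
| VList of seq (enode X).

Record state := State {
  pc : nat;
  mem : nat -> value;
  out : seq U
}.

Definition write (M : nat -> value) (d : nat) (v : value) : nat -> value :=
  fun i => if i == d then v else M i.

(* Ill-typed operations produce VNil; an ill-typed store or output is void and
   an ill-typed comparison does not jump. *)

Definition vload (M : nat -> value) (a : value) : value :=
  if a is VInt (Posz i) then M i else VNil.

Definition vstore (M : nat -> value) (a v : value) : nat -> value :=
  if a is VInt (Posz i) then write M i v else M.

Definition vadd (x y : value) : value :=
  match x, y with
  | VInt a, VInt b => VInt (a + b)
  | VReal a, VReal b => VReal (a + b)
  | _, _ => VNil
  end.

Definition vsub (x y : value) : value :=
  match x, y with
  | VInt a, VInt b => VInt (a - b)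
  | VReal a, VReal b => VReal (a - b)
  | _, _ => VNil
  end.

Definition vmul (x y : value) : value :=
  match x, y with VReal a, VReal b => VReal (a * b) | _, _ => VNil end.

Definition vdiv (x y : value) : value :=
  match x, y with VReal a, VReal b => VReal (a / b) | _, _ => VNil end.

Definition vreal (x : value) : value :=
  if x is VInt a then VReal a%:~R else VNil.

Definition vdist (x y : value) : value :=
  match x, y with VPoint p, VPoint q => VReal (mdist p q) | _, _ => VNil end.

Definition vnode (f : enode X -> value) (x : value) : value :=
  if x is VNode u then f u else VNil.

Definition vhead (x : value) : value :=
  if x is VList (u :: _) then VNode u else VNil.

Definition vtail (x : value) : value :=
  if x is VList (_ :: s) then VList s else VNil.

Definition vle (x y : value) : bool :=
  match x, y with
  | VInt a, VInt b => a <= b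
  | VReal a, VReal b => a <= b
  | _, _ => false
  end.

Definition vnil (x : value) : bool := if x is VNil then true else false.

Definition exec (c : instr) (s : state) : state :=
  let M := mem s in
  let set d v := State (pc s).+1 (write M d v) (out s) in
  let branch (b : bool) i := State (if b then i else (pc s).+1) M (out s) in
  match c with
  | IConst d z => set d (VInt z)
  | IMove d a => set d (M a)
  | ILoad d a => set d (vload M (M a))
  | IStore d a => State (pc s).+1 (vstore M (M d) (M a)) (out s)
  | IAdd d a b => set d (vadd (M a) (M b))
  | ISub d a b => set d (vsub (M a) (M b))
  | IMul d a b => set d (vmul (M a) (M b))
  | IDiv d a b => set d (vdiv (M a) (M b))
  | IReal d a => set d (vreal (M a))
  | IDist d a b => set d (vdist (M a) (M b))
  | IPoint d a => set d (vnode (fun u => VPoint (epoint u)) (M a))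
  | ILevel d a => set d (vnode (fun u => VInt (elevel u)) (M a))
  | IWeight d a => set d (vnode (fun u => VInt (eweight u)%:Z) (M a))
  | IParent d a => set d (vnode (fun u => oapp VNode VNil (eparent u)) (M a))
  | IChildren d a => set d (vnode (fun u => VList (echildren u)) (M a))
  | IHead d a => set d (vhead (M a))
  | ITail d a => set d (vtail (M a))
  | IJump i => branch true i
  | IJumpLe a b i => branch (vle (M a) (M b)) i
  | IJumpNil a i => branch (vnil (M a)) i
  | IOutput a => State (pc s).+1 M
      (if M a is VPoint p then rcons (out s) p else out s)
  end.

(* The machine halts when the program counter leaves the program. *)
Definition step (P : program) (s : state) : state :=
  if onth P (pc s) is Some c then exec c s else s.

Definition initial (k : nat) (eps : R) : state :=
  State 0
    (fun i => match i with
       | 0 => VNode (eroot X) | 1 => VInt k%:Z | 2 => VReal eps | _ => VNil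
     end) [::].

Definition returns (P : program) (k : nat) (eps : R) (t : nat) (C : {fset U})
    : Prop :=
  let s := iter t (step P) (initial k eps) in
  (size P <= pc s)%N /\ C = [fset p in out s].

End Machine.

(* (k/e) (768/e)^D log Delta, made meaningful where this expression degenerates
   (it tends to 0 as e grows, and vanishes when Delta = 1): e is replaced by
   min(e, 768), which keeps the base 768/e at least 1, and log Delta by
   max(1, log Delta). *)
Definition time_bound {R : realType} (k : nat) (eps D Delta : R) : R :=
  let e := Num.min eps 768 in
  (k%:R / e) * (768 / e) `^ D * Num.max 1 (ln Delta).

(* Main.v *)
(** The program works on the levels of the cover tree. Descending from the first
branching level, it finds the last level [m] with at most [k] nodes; two points of
level [m - 1] share a cluster, so the optimal radius [r] is at least [2^m / 4],
and it is at most [2^(m + 1)]. It then descends [j] more levels, with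
[2^-j <= eps]: the nodes of level [m - j] represent all points up to [2^(m - j + 1)].
On them it selects points greedily, each new center discarding everything within
[tau], for [tau] increasing from 0 in steps comparable to [2^(m - j)]. Selected
points are more than [tau] apart, so a selection exceeding [k] forces [tau <= 2 r]
and the first successful [tau] is at most [2 r + O(eps r)].

Each center discards its neighbours by a search from the root that prunes every
subtree too far away. By packing, a search visits [(2^D)^O(1)] nodes on each of the
O(log Delta) levels above [m], and geometrically many below, which is dominated by
[(2^D)^(j + 6) <= (768 / eps)^D]. When [eps >= 1], [j = 0] and the first selection,
with [tau = 0], already succeeds without any search, so that no factor exponential
in [D] is paid. The absolute scale of the levels is never computed from their
indices: it is read off one distance between two children of the first branching
node, and halved from level to level.

The machine code comes from a small structured language with registers and arrays,
whose weakest preconditions carry a clock bounding the number of machine steps. *)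

Require Import Defs.
From mathcomp Require Import all_boot all_order all_algebra finmap zify ring lra.
From mathcomp Require Import boolp classical_sets functions reals.
From mathcomp Require Import topology normedtype sequences exp.

Set Implicit Arguments.
Unset Strict Implicit.
Unset Printing Implicit Defensive.

Import Order.TTheory GRing.Theory Num.Theory.
Local Open Scope fset_scope.
Local Open Scope ring_scope.

(** * A structured language over the machine *)

(** For [eps >= 768] the time bound has no factor exponential in [D], and this shapes the descent:
    level [m - 1] may have [2 ^ O(D)] times [k] nodes, so its construction is abandoned after
    [k + 1] of them. Packing speaks of single levels, whereas the explicit tree has coalesced chains
    whose ends are only partly determined. Hence the levels are unfolded again into arrays, one row
    per node and level, and [expand] recovers the children under either convention. The aspect ratio
    enters only through the number of levels between the first branching level [L] and [m]: some two
    points are more than [2 ^ (L - 1)] apart, and since level [m] misses a point of [S], some two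
    are at most [2 ^ m] apart. Origin of the factor [2 + 24 eps]: [2 ^ m <= 4 r] and [2 ^ -j <= eps]
    turn the covering error [2 * 2 ^ (m - j)] into [8 eps r], and one threshold step, at most
    [4 * 2 ^ (m - j)] because the scale is known up to a factor 4, into [16 eps r]. *)

Inductive test := TLe (a b : nat) | TNil (a : nat).

(* [Ld d c r] reads cell [r] of array [c] into register [d]; [St c r a] writes
   register [a] into cell [r] of array [c]. [If t c1 c2] runs [c1] when [t]
   holds; [While ts c] iterates [c] until one of the tests [ts] holds. *)
Inductive cmd :=
| Skip
| Ins (i : instr)
| Ld (d c r : nat)
| St (c r a : nat)
| Seq (c1 c2 : cmd)
| If (t : test) (c1 c2 : cmd)
| While (ts : seq test) (c : cmd).

(* Registers occupy addresses below 60, addresses 60 and 61 are scratch, and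
   cell [i] of array [c < 8] is at address [64 + 8 * i + c]. *)
Definition cell (c i : nat) : nat := (64 + 8 * i + c)%N.

(** Integers cannot be multiplied on the machine: the factor 8 is three doublings, which is why the
    arrays are interleaved with a power of two as stride. *)
Definition address (c r : nat) : program :=
  [:: IAdd 60 r r; IAdd 60 60 60; IAdd 60 60 60; IConst 61 (64 + c)%N%:Z;
      IAdd 60 60 61].

Definition jump_if (t : test) (i : nat) : instr :=
  match t with TLe a b => IJumpLe a b i | TNil a => IJumpNil a i end.

Fixpoint len (c : cmd) : nat :=
  match c with
  | Skip => 0
  | Ins _ => 1
  | Ld _ _ _ | St _ _ _ => 6
  | Seq a b => len a + len b
  | If _ a b => len a + len b + 2
  | While ts a => size ts + len a + 1
  end.

(** Jumps are absolute, so the address [p] of the first instruction is a parameter. A jump is taken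
    when its test holds, hence the first branch of [If] is laid out after the second. *)
Fixpoint compile (p : nat) (c : cmd) : program :=
  match c with
  | Skip => [::]
  | Ins i => [:: i]
  | Ld d c r => address c r ++ [:: ILoad d 60]
  | St c r a => address c r ++ [:: IStore 60 a]
  | Seq a b => compile p a ++ compile (p + len a) b
  | If t a b =>
      jump_if t (p + len b + 2) :: compile (p + 1) b ++
      IJump (p + len a + len b + 2) :: compile (p + len b + 2) a
  | While ts a =>
      [seq jump_if t (p + size ts + len a + 1) | t <- ts] ++
      compile (p + size ts) a ++ [:: IJump p]
  end.

Definition is_reg (r : nat) : bool := (r < 60)%N.

(** Raw loads, stores and jumps are excluded: array access and control flow go through [cmd] only,
    so a single instruction can neither touch an array nor leave the straight-line order. *)
Definition wf_instr (i : instr) : bool :=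
  match i with
  | IConst d _ => is_reg d
  | IMove d a | IReal d a | IPoint d a | ILevel d a | IWeight d a | IParent d a
  | IChildren d a | IHead d a | ITail d a => is_reg d && is_reg a
  | IAdd d a b | ISub d a b | IMul d a b | IDiv d a b | IDist d a b =>
      [&& is_reg d, is_reg a & is_reg b]
  | IOutput a => is_reg a
  | _ => false
  end.

Definition wf_test (t : test) : bool :=
  match t with TLe a b => is_reg a && is_reg b | TNil a => is_reg a end.

Fixpoint wf (c : cmd) : bool :=
  match c with
  | Skip => true
  | Ins i => wf_instr i
  | Ld d c r => [&& is_reg d, (c < 8)%N & is_reg r]
  | St c r a => [&& (c < 8)%N, is_reg r & is_reg a]
  | Seq a b => wf a && wf b
  | If t a b => [&& wf_test t, wf a & wf b]
  | While ts a => all wf_test ts && wf a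
  end.

Definition dest (i : instr) : seq nat :=
  match i with
  | IConst d _ | IMove d _ | IReal d _ | IPoint d _ | ILevel d _ | IWeight d _
  | IParent d _ | IChildren d _ | IHead d _ | ITail d _ | ILoad d _
  | IAdd d _ _ | ISub d _ _ | IMul d _ _ | IDiv d _ _ | IDist d _ _ => [:: d]
  | _ => [::]
  end.

Fixpoint modr (c : cmd) : seq nat :=
  match c with
  | Skip | St _ _ _ => [::]
  | Ins i => dest i
  | Ld d _ _ => [:: d]
  | Seq a b | If _ a b => modr a ++ modr b
  | While _ a => modr a
  end.

Fixpoint moda (c : cmd) : seq nat :=
  match c with
  | Skip | Ins _ | Ld _ _ _ => [::]
  | St c _ _ => [:: c]
  | Seq a b | If _ a b => moda a ++ moda b
  | While _ a => moda a
  end.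

Fixpoint silent (c : cmd) : bool :=
  match c with
  | Ins (IOutput _) => false
  | Seq a b | If _ a b => silent a && silent b
  | While _ a => silent a
  | _ => true
  end.

Lemma size_compile c p : size (compile p c) = len c.
Proof.
elim: c p => //= [a iha b ihb|t a iha b ihb|ts a iha] p.
- by rewrite size_cat iha ihb.
- by rewrite size_cat /= iha ihb; lia.
- by rewrite !size_cat size_map iha /=; lia.
Qed.

Section WeakestPrecondition.
Context {R : realType} {U : metricType R} (X : etree U).

(** Registers and arrays are separate functions, so that aliasing is impossible by construction;
    [represents] relates this view to the flat memory and leaves the scratch cells unconstrained. *)
Record hstate := HState {
  reg : nat -> value X;
  arr : nat -> nat -> value X;
  hout : seq U;
  clk : nat
}.

Implicit Types (s : hstate) (Q : hstate -> Prop).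

Definition tick n s := HState (reg s) (arr s) (hout s) (clk s + n).

Definition set_reg s d v := HState (write (reg s) d v) (arr s) (hout s) (clk s).

Definition set_arr s c i v :=
  HState (reg s)
    (fun c' j => if eqn c' c && eqn j i then v else arr s c' j)
    (hout s) (clk s).

(** [exec] is reused with the register file in place of the whole memory, which is faithful for the
    instructions that [wf_instr] admits. *)
Definition run_instr (i : instr) s : hstate :=
  let s' := exec i (State 0 (reg s) (hout s)) in
  HState (Defs.mem s') (arr s) (out s') (clk s + 1).

Definition holds s (t : test) : bool :=
  match t with TLe a b => vle (reg s a) (reg s b) | TNil a => vnil (reg s a) end.

(** [n] is fuel, and running out of it is [False], so termination is part of the meaning. Every
    round is charged for all exit tests and the backward jump, even the last one, which stops
    earlier. *)
Fixpoint wp_loop n (ts : seq test) (body : (hstate -> Prop) -> hstate -> Prop)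
    Q s : Prop :=
  let s' := tick (size ts + 1) s in
  if has (holds s) ts then Q s'
  else if n is n'.+1 then body (wp_loop n' ts body Q) s' else False.

(* The clock of [Q]'s argument bounds the number of machine steps taken. *)
Fixpoint wp (c : cmd) Q s : Prop :=
  match c with
  | Skip => Q s
  | Ins i => Q (run_instr i s)
  | Ld d c r => exists i : nat,
      reg s r = VInt X (Posz i) /\ Q (tick 6 (set_reg s d (arr s c i)))
  | St c r a => exists i : nat,
      reg s r = VInt X (Posz i) /\ Q (tick 6 (set_arr s c i (reg s a)))
  | Seq a b => wp a (wp b Q) s
  | If t a b => if holds s t then wp a Q (tick 2 s) else wp b Q (tick 2 s)
  | While ts a => exists n, wp_loop n ts (wp a) Q s
  end.

Definition unchanged (c : cmd) s s' : Prop :=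
  [/\ forall r, r \notin modr c -> reg s' r = reg s r,
      forall a, a \notin moda c -> arr s' a = arr s a &
      silent c -> hout s' = hout s].

Lemma wp_mono c Q Q' s : (forall s', Q s' -> Q' s') -> wp c Q s -> wp c Q' s.
Proof.
elim: c Q Q' s => [|i|d c r|c r a|a iha b ihb|t a iha b ihb|ts a iha] Q Q' s QQ' //=.
- exact: QQ'.
- exact: QQ'.
- by case=> i [? ?]; exists i; split=> //; apply: QQ'.
- by case=> i [? ?]; exists i; split=> //; apply: QQ'.
- by apply: iha => s'; apply: ihb.
- by case: ifP => _; [apply: iha | apply: ihb].
- case=> n H; exists n; elim: n s H => [|n ihn] s /=; case: ifP => _ //; try exact: QQ'.
  by apply: iha => s'; apply: ihn.
Qed.

Lemma wp_loop_mono n ts c Q Q' s : (forall s', Q s' -> Q' s') ->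
  wp_loop n ts (wp c) Q s -> wp_loop n ts (wp c) Q' s.
Proof.
move=> QQ'; elim: n s => [|n ihn] s /=; case: ifP => _ //; try exact: QQ'.
by apply: wp_mono => s'; apply: ihn.
Qed.

Lemma unchanged_trans c s1 s2 s3 :
  unchanged c s1 s2 -> unchanged c s2 s3 -> unchanged c s1 s3.
Proof.
move=> [a1 b1 c1] [a2 b2 c2]; split.
- by move=> r rc; rewrite a2 // a1.
- by move=> r rc; rewrite b2 // b1.
- by move=> h; rewrite c2 // c1.
Qed.

Lemma wp_frame c Q s : wf c ->
  wp c Q s -> wp c (fun s' => Q s' /\ unchanged c s s') s.
Proof.
elim: c Q s => [|i|d c r|c r a|a iha b ihb|t a iha b ihb|ts a iha] Q s //=.
- by case: i => // *; (split; [by [] | split=> //=]) => r; rewrite inE /write => /negPf->.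
- move=> _ [i [? ?]]; exists i; (split=> //; split=> //); split=> //= r'.
  by rewrite inE /write => /negPf ->.
- move=> _ [i [? ?]]; exists i; (split=> //; split=> //); split=> //= r'.
  by rewrite inE => /negPf rc; apply/funext => j; rewrite /= -[eqn r' c]/(r' == c) rc.
- case/andP => wa wb /(iha _ _ wa); apply: wp_mono => s' [/(ihb _ _ wb) h [u1 u2 u3]].
  apply: wp_mono h => s2 [q [v1 v2 v3]]; split=> //; split=> /=.
  + by move=> r; rewrite mem_cat negb_or => /andP[? ?]; rewrite v1 // u1.
  + by move=> r; rewrite mem_cat negb_or => /andP[? ?]; rewrite v2 // u2.
  + by case/andP => ? ?; rewrite v3 // u3.
- case/and3P => _ wa wb.
  case: ifP => _ => [/(iha _ _ wa)|/(ihb _ _ wb)]; apply: wp_mono => s' [q [u1 u2 u3]];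
    split=> //; split=> /=; by [move=> r; rewrite mem_cat negb_or => /andP[? ?];
      first [rewrite u1 | rewrite u2] | case/andP => ? ?; rewrite u3].
- case/andP => _ wa [n H]; exists n; elim: n s H => [|n ihn] s /=; case: ifP => _ //.
  move/(iha _ _ wa); apply: wp_mono => s' [/ihn h u]; apply: wp_loop_mono h => s2 [q u2].
  split=> //; apply: unchanged_trans u2.
  by case: u => u1 u3 u4; split.
Qed.

Lemma wp_weaken c Q Q' s : wf c ->
  wp c Q s -> (forall s', Q s' -> unchanged c s s' -> Q' s') -> wp c Q' s.
Proof. by move=> wc /(wp_frame wc) h QQ'; apply: wp_mono h => s' [? ?]; apply: QQ'. Qed.

(** The index of the invariant is a variant: it decreases along the body, so its initial value is
    enough fuel. *)
Lemma wp_while (Inv : nat -> hstate -> Prop) ts c Q n s :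
  (forall n s, Inv n s -> has (holds s) ts -> Q (tick (size ts + 1) s)) ->
  (forall n s, Inv n s -> ~~ has (holds s) ts ->
    wp c (fun s' => exists2 n', (n' < n)%N & Inv n' s') (tick (size ts + 1) s)) ->
  Inv n s -> wp (While ts c) Q s.
Proof.
move=> Hexit Hstep Hinv; exists n.
have: exists2 m, (m <= n)%N & Inv m s by exists n.
elim: n s {Hinv} => [|n ihn] s [m mn Hm] /=.
  case: ifPn => [|h]; first exact: Hexit Hm.
  move: (Hstep _ _ Hm h); move: mn; rewrite leqn0 => /eqP-> {}h.
  (* No index lies below 0, so the body would have to establish [False], which no command can. *)
  have F : wp c (fun=> False) (tick (size ts + 1) s) by apply: wp_mono h => s' [].
  elim: c {Hstep h} (tick _ s) F => //= [d a r|a r d|a iha b ihb|t a iha b ihb|ts' a iha] s'.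
  - by case=> ? [].
  - by case=> ? [].
  - by move=> h; apply: iha; apply: wp_mono h => s2; apply: ihb.
  - by case: ifP => _; [apply: iha | apply: ihb].
  - case=> n'; elim: n' s' => [|n' ihn'] s' /=; case: ifP => _ //.
    by move=> h; apply: iha; apply: wp_mono h => s2; apply: ihn'.
case: ifPn => [|h]; first exact: Hexit Hm.
apply: wp_mono (Hstep _ _ Hm h) => s' [m' m'm Im'].
by apply: ihn; exists m' => //; rewrite -ltnS (leq_trans m'm).
Qed.

(** * Soundness of the preconditions for compiled code *)

Definition represents (m : state X) s : Prop :=
  [/\ forall r, is_reg r -> Defs.mem m r = reg s r,
      forall c i, (c < 8)%N -> Defs.mem m (cell c i) = arr s c i &
      out m = hout s].

Definition code_at (P : program) p (C : program) : Prop :=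
  forall i, (i < size C)%N -> onth P (p + i) = onth C i.

Lemma code_at_cat P p C1 C2 :
  code_at P p (C1 ++ C2) -> code_at P p C1 /\ code_at P (p + size C1) C2.
Proof.
move=> h; split=> i ilt.
  by rewrite h ?size_cat ?ltn_addr // onth_cat ilt.
by rewrite -addnA h ?size_cat ?ltn_add2l // onth_cat ltnNge leq_addr /= addKn.
Qed.

Lemma code_at_cons P p i C :
  code_at P p (i :: C) -> onth P p = Some i /\ code_at P (p + 1) C.
Proof.
rewrite -cat1s => /code_at_cat[h1 h2]; split=> //.
by rewrite -[p]addn0 h1.
Qed.

Lemma step_at P i (m : state X) : onth P (pc m) = Some i -> step P m = exec i m.
Proof. by rewrite /step => ->. Qed.

Lemma run_instr_sound P i s (m : state X) : wf_instr i -> onth P (pc m) = Some i ->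
  represents m s ->
  pc (step P m) = (pc m).+1 /\ represents (step P m) (run_instr i s).
Proof.
move=> wi hi [h1 h2 h3]; rewrite (step_at hi).
have W d v : is_reg d -> forall c j, write (Defs.mem m) d v (cell c j) = Defs.mem m (cell c j).
  by rewrite /is_reg /write /cell => rd c j; case: eqP => //; lia.
have V d v w r : v = w -> is_reg r -> write (Defs.mem m) d v r = write (reg s) d w r.
  by move=> -> rr; rewrite /write h1.
have A2 (a b : bool) : a && b -> a /\ b by case/andP.
have A3 (a b c : bool) : [&& a, b & c] -> [/\ a, b & c] by case/and3P.
case: i wi {hi} => //= *;
  repeat match goal with
  | H : is_true [&& _, _ & _] |- _ => case: (A3 _ _ _ H) => {H} ? ? ?
  | H : is_true (_ && _) |- _ => case: (A2 _ _ H) => {H} ? ? end;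
  (split=> //; split=> //=; rewrite ?h3 //);
  by [move=> *; rewrite W // h2 | move=> *; apply: V => //; rewrite !h1 | rewrite h1].
Qed.

Lemma address_sound P p c r s m i : is_reg r -> (c < 8)%N ->
  code_at P p (address c r) -> pc m = p -> represents m s ->
  reg s r = VInt X (Posz i) ->
  exists m', [/\ iter 5 (step P) m = m', pc m' = (p + 5)%N, represents m' s &
    Defs.mem m' 60 = VInt X (Posz (cell c i))].
Proof.
move=> rr c8 /code_at_cons[a1 /code_at_cons[a2 /code_at_cons[a3
  /code_at_cons[a4 /code_at_cons[a5 _]]]]] pm [h1 h2 h3] ri.
rewrite !addn1 in a2 a3 a4 a5.
have E q j (M : nat -> value X) o : onth P q = Some j -> step P (State q M o) = exec j (State q M o).
  by rewrite /step /= => ->.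
case: m pm h1 h2 h3 => q M o /= -> h1 h2 h3.
exists (iter 5 (step P) (State p M o)); split=> //=;
  rewrite (E _ _ _ _ a1) /= (E _ _ _ _ a2) /= (E _ _ _ _ a3) /= (E _ _ _ _ a4) /= (E _ _ _ _ a5) /=.
- by lia.
- split=> //= r'.
    rewrite /is_reg => r'60; rewrite /write.
    by do !(case: eqP => ?; first by lia); rewrite h1.
- by rewrite /write /= h1 // ri /= /cell; congr VInt; lia.
Qed.

Lemma jumps_sound P p ts e s m : all wf_test ts ->
  code_at P p [seq jump_if t e | t <- ts] -> pc m = p -> represents m s ->
  exists t m', [/\ iter t (step P) m = m', represents m' s,
    pc m' = if has (holds s) ts then e else (p + size ts)%N & (t <= size ts)%N].
Proof.
elim: ts p m => [|t ts ih] p m /=.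
  by move=> _ _ <- rep; exists 0%N, m; split=> //=; rewrite addn0.
case/andP => wt wts /code_at_cons[c1 c2] pm [h1 h2 h3].
have E : step P m = State (if holds s t then e else (pc m).+1) (Defs.mem m) (out m).
  rewrite /step pm c1; case: t wt {c1} => [a b|a] /= => [/andP[ra rb]|ra].
    by rewrite !h1 // pm.
  by rewrite !h1 // pm.
case: (boolP (holds s t)) E => ht E /=.
  by exists 1%N, (step P m); rewrite E; split.
have [||t' [m' [h4 h5 h6 h7]]] := ih (p + 1)%N (step P m) wts c2.
- by rewrite E /= pm addn1.
- by rewrite E.
by exists t'.+1, m'; split=> //; [rewrite iterSr | rewrite h6; case: ifP => // _; lia].
Qed.

(** Induction on the command, with an inner induction on the fuel for loops. The clock is only an
    upper bound on [t], since [If] and [While] are charged for their longest path through tests and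
    jumps. *)
Lemma wp_sound P c p Q s m : wf c -> code_at P p (compile p c) -> pc m = p ->
  represents m s -> wp c Q s ->
  exists t s' m', [/\ iter t (step P) m = m', represents m' s',
    pc m' = (p + len c)%N, Q s' & (clk s + t <= clk s')%N].
Proof.
elim: c p Q s m => [|i|d c r|c r a|a iha b ihb|t a iha b ihb|ts a iha] p Q s m /=.
- by move=> _ _ pm rep q; exists 0%N, s, m; rewrite !addn0.
- move=> wi /code_at_cons[hi _] pm rep q; exists 1%N, (run_instr i s), (step P m).
  have hi' : onth P (pc m) = Some i by rewrite pm.
  have [h1 h2] := run_instr_sound wi hi' rep.
  by split=> //; rewrite h1 pm addn1.
- case/and3P => rd c8 rr /(@code_at_cat P p (address c r) [:: ILoad d 60])[ca /code_at_cons[hi _]] pm rep [i [ri q]].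
  have [m' [h1 h2 h3 h4]] := address_sound rr c8 ca pm rep ri.
  exists 6%N, (tick 6 (set_reg s d (arr s c i))), (step P m').
  have E := @step_at P (ILoad d 60) m'; rewrite h2 in E; rewrite E //=.
  split=> //; first by rewrite -[LHS]/(step P (iter 5 (step P) m)) h1 E.
    case: h3 => g1 g2 g3; split=> //= [r' r'r|c' j c'8].
      by rewrite /write h4 /= g2 //; case: eqP => // _; apply: g1.
    by rewrite /write /cell; case: eqP => [|_]; [move: rd; rewrite /is_reg; lia | apply: g2].
  by rewrite h2 -addnS.
- case/and3P => c8 rr ra /(@code_at_cat P p (address c r) [:: IStore 60 a])[ca /code_at_cons[hi _]] pm rep [i [ri q]].
  have [m' [h1 h2 h3 h4]] := address_sound rr c8 ca pm rep ri.
  exists 6%N, (tick 6 (set_arr s c i (reg s a))), (step P m').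
  have E := @step_at P (IStore 60 a) m'; rewrite h2 in E; rewrite E //= h4 /=.
  split=> //; first by rewrite -[LHS]/(step P (iter 5 (step P) m)) h1 E //= h4.
    case: h3 => g1 g2 g3; split=> //= [r' r'r|c' j c'8].
      by rewrite /write /cell; case: eqP => [|_]; [move: r'r; rewrite /is_reg; lia | apply: g1].
    rewrite /write g1 // g2 // -[eqn c' c]/(c' == c) -[eqn j i]/(j == i).
    rewrite (_ : (cell c' j == cell c i) = (c' == c) && (j == i)) //.
    by apply/eqP/andP => [|[/eqP-> /eqP->]] //; rewrite /cell => e; split; apply/eqP; lia.
  by rewrite h2 -addnS.
- case/andP => wa wb /code_at_cat[ca cb] pm rep q; rewrite size_compile in cb.
  have [t1 [s1 [m1 [e1 r1 p1 q1 k1]]]] := iha _ _ _ _ wa ca pm rep q.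
  have [t2 [s2 [m2 [e2 r2 p2 q2 k2]]]] := ihb _ _ _ _ wb cb p1 r1 q1.
  exists (t2 + t1)%N, s2, m2; split=> //; first by rewrite iterD e1 e2.
    by rewrite p2 addnA.
  by lia.
- case/and3P => wt wa wb ca pm rep.
  have {ca}[c1 /code_at_cat[cb]] := code_at_cons ca; rewrite size_compile => /code_at_cons[c2 ca].
  have [||t0 [m0 [e0 r0 p0 k0]]] := @jumps_sound P p [:: t] (p + len b + 2) s m _ _ pm rep.
  + by rewrite /= wt.
  + by case=> [|//] _ /=; rewrite addn0 c1.
  move: p0 k0; rewrite /= orbF; case: ifP => ht p0 k0 q.
    have ca' : code_at P (p + len b + 2) (compile (p + len b + 2) a).
      by move: ca; rewrite addn1 addn1 addSn -addn2.
    have [t1 [s1 [m1 [e1 r1 p1 q1 k1]]]] := iha _ _ _ m0 wa ca' p0 (r0 : represents m0 (tick 2 s)) q.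
    exists (t1 + t0)%N, s1, m1; split=> //; first by rewrite iterD e0 e1.
      by rewrite p1; lia.
    by move: k1 => /=; lia.
  have [t1 [s1 [m1 [e1 r1 p1 q1 k1]]]] := ihb _ _ _ m0 wb cb p0 (r0 : represents m0 (tick 2 s)) q.
  have E := @step_at P (IJump (p + len a + len b + 2)) m1; rewrite p1 in E.
  exists (1 + t1 + t0)%N, s1, (step P m1); split=> //.
  + by rewrite iterD e0 iterD e1.
  + by rewrite E //; case: r1.
  + by rewrite E //= !addnA.
  + by move: k1 => /=; lia.
- case/andP => wts wa ca pm rep [n].
  have {ca}[c1 /code_at_cat[cb]] := code_at_cat ca; rewrite size_map size_compile => /code_at_cons[c2 _].
  elim: n s m pm rep => [|n ihn] s m pm rep /=;
    have [t0 [m0 [e0 r0 p0 k0]]] := jumps_sound wts c1 pm rep;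
    move: p0; case: ifP => // ht p0 q.
  + by exists t0, (tick (size ts + 1) s), m0; split=> //=; [rewrite p0 !addnA | lia].
  + by exists t0, (tick (size ts + 1) s), m0; split=> //=; [rewrite p0 !addnA | lia].
  rewrite size_map in cb.
  have [t1 [s1 [m1 [e1 r1 p1 q1 k1]]]] :=
    iha _ _ _ m0 wa cb p0 (r0 : represents m0 (tick (size ts + 1) s)) q.
  have E := @step_at P (IJump p) m1; rewrite p1 in E.
  have [|||t2 [s2 [m2 [e2 r2 p2 q2 k2]]]] := ihn s1 (step P m1).
  + by rewrite E.
  + by rewrite E //; case: r1.
  + exact: q1.
  exists (t2 + (1 + t1 + t0))%N, s2, m2; split=> //.
  + by rewrite iterD (iterD _ t0) e0 iterD e1 e2.
  + by move: k1 => /=; lia.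
Qed.

End WeakestPrecondition.

(** * Packing and k-center radii in a doubling metric *)

Lemma pigeonhole (A B : eqType) (s : seq A) (c : seq B) (rel : A -> B -> Prop) :
  uniq s -> (size c < size s)%N ->
  (forall p, p \in s -> exists2 x, x \in c & rel p x) ->
  exists p q x, [/\ p \in s, q \in s, p != q, rel p x & rel q x].
Proof.
move=> us cs h.
have /choice[f hf] : forall p, exists x, p \in s -> x \in c /\ rel p x.
  move=> p; have [/h[x xc px]|_] := boolP (p \in s); first by exists x.
  by case: c cs h => [|x c' _ _]; [case: s us => // a s _ _ /(_ a (mem_head _ _))[] | exists x].
case: (boolP (uniq (map f s))) => [uf|].
  have : (size (map f s) <= size c)%N.
    by apply: uniq_leq_size => // y /mapP[p ps ->]; case: (hf p ps).
  by rewrite size_map leqNgt cs.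
elim: s us {cs h} hf => //= a s ih /andP[as_ us] hf; rewrite negb_and negbK.
have hs p : p \in s -> f p \in c /\ rel p (f p) by move=> ps; apply: hf; rewrite inE ps orbT.
case/orP => [/mapP[b bs fab]|/(ih us hs)[p [q [x [ps qs pq px qx]]]]].
  exists a, b, (f a); split; rewrite ?inE ?eqxx ?bs ?orbT //.
  - by apply: contraNneq as_ => ->.
  - by case: (hf a (mem_head _ _)).
  - by rewrite fab; case: (hs b bs).
by exists p, q, x; split; rewrite ?inE ?ps ?qs ?orbT.
Qed.

Section MetricFacts.
Context {R : realType} {U : metricType R}.
Implicit Types (p q x : U) (s c : seq U) (S C : {fset U}) (D r d : R).

Lemma doubling_cover D p r (i : nat) : doubling U D ->
  exists c, (size c)%:R <= (2 `^ D) ^+ i :> R /\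
    forall q, mdist p q <= r -> exists2 x, x \in c & mdist q x <= r / 2 ^+ i.
Proof.
move=> dD; elim: i => [|i [c [sc hc]]].
  exists [:: p]; rewrite expr0; split=> // q pq; exists p; rewrite ?inE //.
  by rewrite expr0 divr1 metric_sym.
have /choice[F hF] := fun x => dD x (r / 2 ^+ i).
exists (flatten [seq enum_fset (F x) | x <- c]); split.
  rewrite exprSr; apply: (@le_trans _ _ ((size c)%:R * 2 `^ D)); last by rewrite ler_wpM2r ?powR_ge0.
  elim: c {sc hc} => [|x c ih] /=; first by rewrite mul0r.
  rewrite size_cat natrD -natr1 mulrDl mul1r addrC lerD //.
  by case: (hF x).
move=> q /hc[x xc qx]; case: (hF x) => _ /(_ q)[|y /= yF xy].
  by rewrite /cball /= metric_sym.
exists y; first by apply/flattenP; exists (enum_fset (F x)) => //; apply/mapP; exists x.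
by rewrite metric_sym (le_trans xy) // exprSr invfM mulrA.
Qed.

(** Balls of radius [r / 2 ^+ i], which is at most [d / 2], contain at most one of the separated
    points each, and [doubling_cover] counts such balls. *)
Lemma packing D s p r d (i : nat) : doubling U D -> uniq s ->
  (forall x y, x \in s -> y \in s -> x != y -> d < mdist x y) ->
  (forall x, x \in s -> mdist p x <= r) -> 2 * r <= d * 2 ^+ i ->
  (size s)%:R <= (2 `^ D) ^+ i :> R.
Proof.
move=> dD us sep near rd; have [c [sc hc]] := doubling_cover p r i dD.
apply: le_trans sc; rewrite ler_nat leqNgt; apply/negP => cs.
have [|x [y [z [xs ys xy xz yz]]]] := pigeonhole (rel := fun x z => mdist x z <= r / 2 ^+ i) us cs.
  by move=> x xs; apply: hc; apply: near.
have := sep _ _ xs ys xy; apply/negP; rewrite -leNgt (le_trans (metric_triangle x z y)) //.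
have h : r / 2 ^+ i + r / 2 ^+ i <= d by rewrite -mulrDl ler_pdivrMr ?exprn_gt0 //; lra.
by rewrite (le_trans _ h) // lerD // metric_sym.
Qed.

(* If balls could be covered by a single ball of half the radius, two points at
   distance d would have a common point at distance d/4 from both. *)
Lemma doubling_ge2 D p q : doubling U D -> p != q -> 2 <= 2 `^ D :> R.
Proof.
move=> dD pq; rewrite leNgt; apply/negP => D2.
have one x r : exists y, forall z, mdist x z <= r -> mdist y z <= r / 2.
  have [C [sC hC]] := dD x r.
  have C1 : (#|` C| <= 1)%N by rewrite -ltnS -(ltr_nat R) (le_lt_trans sC).
  (* For negative [r] the ball is empty and [C] may be empty too; any point then serves
     vacuously. *)
  have [rx|rx] := ltP r 0.
    by exists x => z xz; have := @mdist_ge0 _ U x z; lra.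
  have [|y /= yC _] := hC x; first by rewrite /cball /= mdistxx.
  exists y => z /hC[y' /= y'C]; rewrite /cball /=.
  have [->//|yy'] := eqVneq y y'.
  have : (size [:: y; y'] <= #|` C|)%N.
    apply: uniq_leq_size; first by rewrite /= inE yy'.
    by move=> t; rewrite !inE => /orP[] /eqP->.
  by move=> h; move: (leq_trans h C1).
have pp : mdist p p <= mdist p q by rewrite mdistxx mdist_ge0.
have [y hy] := one p (mdist p q); have [z hz] := one y (mdist p q / 2).
have h1 := hz _ (hy _ pp); have h2 := hz _ (hy _ (lexx _)).
have := metric_triangle p z q; rewrite (metric_sym p z).
have : 0 < mdist p q by rewrite mdist_gt0.
lra.
Qed.

Lemma le_sum_mem (A : eqType) (s : seq A) (F : A -> R) (x : A) :
  (forall y, 0 <= F y) -> x \in s -> F x <= \sum_(y <- s) F y.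
Proof.
move=> F0 xs; rewrite (big_rem x) //= lerDl.
by apply: sumr_ge0.
Qed.

Lemma inf_mdist_ge0 C p : 0 <= inf [set mdist p q | q in [set` C]]%classic.
Proof.
have [[q qC]|n0] := pselect ([set mdist p q | q in [set` C]] !=set0)%classic.
  by apply: lb_le_inf; [exists q | move=> _ [x _ <-]; apply: mdist_ge0].
by rewrite inf_out // => -[].
Qed.

Lemma inf_mdist_le C p q : q \in C ->
  inf [set mdist p q | q in [set` C]]%classic <= mdist p q.
Proof.
move=> qC; apply: ge_inf; last by exists q.
by exists 0 => _ [x _ <-]; apply: mdist_ge0.
Qed.

Lemma center_radius_le C S r : S != fset0 ->
  (forall p, p \in S -> exists2 q, q \in C & mdist p q <= r) ->
  center_radius C S <= r.
Proof.
case/fset0Pn => p0 p0S h; apply: ge_sup.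
  by exists (inf [set mdist p0 q | q in [set` C]]%classic), p0.
by move=> _ [p /= /h[q qC pq] <-]; apply: le_trans pq; apply: inf_mdist_le.
Qed.

Lemma inf_mdist_le_radius C S p : C != fset0 -> p \in S ->
  inf [set mdist p q | q in [set` C]]%classic <= center_radius C S.
Proof.
case/fset0Pn => c cC pS; apply: ub_le_sup; last by exists p.
(* The sum of all distances to one center bounds each of the infima, so the supremum is that of a
   bounded set. *)
exists (\sum_(x <- S) mdist x c) => _ [x /= xS <-].
rewrite (le_trans (inf_mdist_le x cC)) //.
by apply: (le_sum_mem (F := fun x => mdist x c)) => // y; apply: mdist_ge0.
Qed.

Lemma center_radius_ge0 C S : C != fset0 -> S != fset0 -> 0 <= center_radius C S.
Proof.
move=> C0 /fset0Pn[p pS]; apply: le_trans (inf_mdist_le_radius C0 pS).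
exact: inf_mdist_ge0.
Qed.

Lemma center_radius_lt C S p r : C != fset0 -> p \in S -> center_radius C S < r ->
  exists2 q, q \in C & mdist p q < r.
Proof.
move=> C0 pS /(le_lt_trans (inf_mdist_le_radius C0 pS)) h.
have [|_ [q qC <-] qr] := inf_lt _ h; last by exists q.
by case/fset0Pn: C0 => c cC; exists (mdist p c), c.
Qed.

Lemma kcenter_opt_le k C S : C `<=` S -> C != fset0 -> (#|` C| <= k)%N ->
  kcenter_opt k S <= center_radius C S.
Proof.
move=> CS C0 Ck; apply: ge_inf; last by exists C.
exists 0 => _ [C' [/= C'S C'0 _] <-]; apply: center_radius_ge0 => //.
by case/fset0Pn: C'0 => c /(fsubsetP C'S) cS; apply/fset0Pn; exists c.
Qed.

(** If [k] centers had radius below [d / 2], one of them would serve two of the points, which would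
    then be closer than [d]. This is the only source of lower bounds on the optimum. *)
Lemma kcenter_opt_ge k s S d : (0 < k)%N -> uniq s -> {subset s <= S} ->
  (k < size s)%N -> (forall x y, x \in s -> y \in s -> x != y -> d < mdist x y) ->
  d <= 2 * kcenter_opt k S.
Proof.
move=> k0 us sS ks sep.
suff : d / 2 <= kcenter_opt k S by lra.
apply: lb_le_inf.
  case: s us sS ks sep => // x s _ sS _ _.
  exists (center_radius [fset x] S), [fset x] => //; split.
  - by rewrite fsub1set; apply: sS; rewrite inE eqxx.
  - by apply/fset0Pn; exists x; rewrite inE.
  - by rewrite cardfs1.
move=> _ [C [/= CS C0 Ck] <-]; rewrite leNgt; apply/negP => h.
have [||x [y [z [xs ys xy xz yz]]]] :=
    @pigeonhole _ _ s (enum_fset C) (fun x z => mdist x z < d / 2) us.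
- exact: leq_ltn_trans Ck ks.
- by move=> p /sS pS; apply: center_radius_lt h.
have := sep _ _ xs ys xy; have := metric_triangle x z y; rewrite (metric_sym z y); lra.
Qed.

(** The uniform lower bound [d] keeps the infimum of the distances positive; otherwise the quotient
    could be a division by 0, whose value is 0. *)
Lemma aspect_ratio_ge S d p q p' q' : 0 < d ->
  (forall x y, x \in S -> y \in S -> x != y -> d <= mdist x y) ->
  p \in S -> q \in S -> p != q -> p' \in S -> q' \in S -> p' != q' ->
  mdist p q <= aspect_ratio S * mdist p' q'.
Proof.
move=> d0 sep pS qS pq p'S q'S pq'.
have le_sup : mdist p q <= sup (pair_dists S).
  apply: ub_le_sup; last by exists p, q.
  exists (\sum_(x <- S) \sum_(y <- S) mdist x y) => _ [x [y [xS yS _ ->]]].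
  apply: le_trans (le_sum_mem (F := fun x => \sum_(y <- S) mdist x y) _ xS).
    by apply: (le_sum_mem (F := fun y => mdist x y)) => // z; apply: mdist_ge0.
  by move=> z; apply: sumr_ge0 => t _; apply: mdist_ge0.
have inf_le : inf (pair_dists S) <= mdist p' q'.
  apply: ge_inf; last by exists p', q'.
  by exists 0 => _ [x [y [_ _ _ ->]]]; apply: mdist_ge0.
have inf_gt0 : 0 < inf (pair_dists S).
  apply: lt_le_trans d0 _; apply: lb_le_inf; first by exists (mdist p q), p, q.
  by move=> _ [x [y [xS yS xy ->]]]; apply: sep.
rewrite /aspect_ratio -mulrA (le_trans le_sup) // ler_peMr ?(le_trans _ le_sup) ?mdist_ge0 //.
by rewrite mulrC ler_pdivlMr // mul1r.
Qed.

End MetricFacts.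

(** * Cover trees and their explicit representation *)

Section CoverTreeFacts.
Context {R : realType} {U : metricType R} (T : tree U) (S : {fset U}).
Hypothesis ctT : cover_tree T S.
Implicit Types (l : int) (p q : U).

Lemma pow2_gt0 l : 0 < (2 : R) ^ l.
Proof. exact: exprz_gt0. Qed.

Lemma pow2D l l' : (2 : R) ^ (l + l') = 2 ^ l * 2 ^ l'.
Proof. by rewrite expfzDr // pnatr_eq0. Qed.

Lemma pow2S l : (2 : R) ^ (l + 1) = 2 * 2 ^ l.
Proof. by rewrite pow2D expr1z mulrC. Qed.

Lemma level_le_top l p : p \in level T l -> l <= top_level T.
Proof. by move=> pl; rewrite leNgt; apply/negP => /(ct_above ctT) h; rewrite h inE in pl. Qed.

Lemma level_mono l l' p : l' <= l -> p \in level T l -> p \in level T l'.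
Proof.
move=> ll'; rewrite (_ : l = l' + `|l - l'|%N%:Z); last by lia.
elim: `|_|%N => [|n ih]; first by rewrite addr0.
move=> /(fsubsetP (ct_nesting ctT _)); rewrite (_ : l' + n.+1%:Z - 1 = l' + n%:Z); last by lia.
exact: ih.
Qed.

(** Covering puts the parent within [2 ^ (l + 1)] of [p], and two distinct nodes of level [l + 1]
    are farther apart than that. *)
Lemma parent_self l p : p \in level T (l + 1) -> parent T l p = p.
Proof.
move=> pl; have lt : l < top_level T by have := level_le_top pl; lia.
have pl' : p \in level T l by apply: level_mono pl; lia.
apply/eqP; apply: contraT => npp.
have := ct_covering ctT lt pl'; rewrite leNgt (ct_separation ctT) //.
  exact: (ct_parent ctT).
by rewrite eq_sym.
Qed.

(** The covering radii met while climbing form a geometric sum. Keeping the subtracted term makes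
    the induction close. *)
Lemma level_cover l L q : l <= L -> L <= top_level T -> q \in level T l ->
  exists2 p, p \in level T L & mdist q p <= 2 ^ (L + 1) - 2 ^ (l + 1).
Proof.
move=> lL; rewrite (_ : L = l + `|L - l|%N%:Z); last by lia.
elim: `|_|%N => [|n ih] nt ql.
  by exists q; rewrite addr0 // subrr mdistxx.
have [|p pl qp] := ih _ ql; first by lia.
have lt : l + n%:Z < top_level T by lia.
exists (parent T (l + n%:Z) p).
  by rewrite (_ : l + n.+1%:Z = l + n%:Z + 1); [apply: (ct_parent ctT) | lia].
have := ct_covering ctT lt pl; have := metric_triangle q p (parent T (l + n%:Z) p).
rewrite (_ : l + n.+1%:Z + 1 = l + n%:Z + 1 + 1); last by lia.
by rewrite (pow2S (l + n%:Z + 1)); lra.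
Qed.

Lemma level_cover_S L p : L <= top_level T -> p \in S ->
  exists2 q, q \in level T L & mdist p q <= 2 ^ (L + 1).
Proof.
move=> Lt /(ct_onto ctT)[l pl]; have [Ll|lL] := leP L l.
  by exists p; [apply: level_mono pl | rewrite mdistxx ltW ?pow2_gt0].
have [q ql pq] := level_cover (ltW lL) Lt pl; exists q => //.
by apply: le_trans pq _; rewrite gerBl ltW ?pow2_gt0.
Qed.

Lemma bottom_level : exists2 l, l <= top_level T & S `<=` level T l.
Proof.
suff [l [lt h]] : exists l, l <= top_level T /\ {subset enum_fset S <= level T l}.
  by exists l => //; apply/fsubsetP => p pS; apply: h.
have sS : {subset enum_fset S <= S} by [].
elim: (enum_fset S) sS => [|p s ih] sS; first by exists (top_level T).
have [|l [lt h]] := ih; first by move=> q qs; apply: sS; rewrite inE qs orbT.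
have [l' pl'] := ct_onto ctT (sS _ (mem_head _ _)).
exists (Num.min l l'); split; first by rewrite ge_min lt.
move=> q; rewrite inE => /orP[/eqP->|/h ql].
  by apply: level_mono pl'; rewrite ge_min lexx orbT.
by apply: level_mono ql; rewrite ge_min lexx.
Qed.

Lemma min_dist_bound : exists2 d : R, 0 < d &
  forall x y, x \in S -> y \in S -> x != y -> d <= mdist x y.
Proof.
have [l _ /fsubsetP Sl] := bottom_level; exists (2 ^ l); first exact: pow2_gt0.
by move=> x y /Sl xl /Sl yl xy; apply: ltW; apply: (ct_separation ctT).
Qed.

(* A point missing from level l is at distance at most 2^l from its parent at
   the highest level that contains it. *)
Lemma close_pair l : l <= top_level T -> ~~ (S `<=` level T l) ->
  exists x y, [/\ x \in S, y \in S, x != y & mdist x y <= 2 ^ l].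
Proof.
move=> lt /fsubsetPn[p pS pl]; have [l' pl'] := ct_onto ctT pS.
have l'l : l' < l by rewrite ltNge; apply: contra pl => ?; apply: level_mono pl'.
have ex : exists n : nat, p \in level T (l - n%:Z).
  by exists `|l - l'|%N; rewrite (_ : l - _ = l') //; lia.
case: (ex_minnP ex) => -[|n]; first by rewrite subr0 (negPf pl).
move=> pn min.
have lt' : l - n.+1%:Z < top_level T by lia.
exists p, (parent T (l - n.+1%:Z) p); split=> //.
- by apply: (fsubsetP (ct_sub ctT _)); apply: (ct_parent ctT).
- have := ct_parent ctT lt' pn; apply: contraTneq => <-.
  rewrite (_ : l - n.+1%:Z + 1 = l - n%:Z); last by lia.
  by apply/negP => /min; rewrite ltnn.
- apply: le_trans (ct_covering ctT lt' pn) _.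
  by rewrite ler_weXz2l ?ler1n //; lia.
Qed.

Lemma root_in_level l p : p \in level T (top_level T) -> l <= top_level T -> p \in level T l.
Proof. by move=> pt lt; apply: level_mono pt. Qed.

Section Explicit.
Context (X : etree U) (coal : int -> U -> enode X).
Hypothesis coX : coalescing T S coal.
Implicit Types (v w : enode X).

(* If [v] stands for the node (l + 1, p), these stand for the children of
   (l + 1, p) at level [l]. *)
Definition expand l v : seq (enode X) :=
  if echildren v is w :: _ then
    if l <= elevel w then echildren v else [:: v]
  else [:: v].

(** The stored level is that of the top of the chain of [w], so the step to the parent just above it
    leaves the explicit node, and [co_parent] then names the explicit parent. *)
Lemma child_level v w : w \in echildren v ->
  [/\ elevel w < top_level T, parent T (elevel w) (epoint w) = epoint v,
      epoint v \in level T (elevel w + 1) &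
      coal (elevel w + 1) (epoint v) = v].
Proof.
rewrite (co_children coX) => /eqP wv.
have [wl wc] := co_top coX w.
have lt : elevel w < top_level T.
  rewrite lt_neqAle (level_le_top wl) andbT; apply/eqP => e.
  by move: wv; rewrite -wc e (co_root coX) ?(co_parent_root coX) // -e.
have pl := ct_parent ctT lt wl.
have ne : coal (elevel w) (epoint w) <> coal (elevel w + 1) (parent T (elevel w) (epoint w)).
  rewrite wc => e; have := co_highest coX pl; rewrite -e; lia.
have := co_parent coX lt wl ne; rewrite wc wv => -[e].
by rewrite e (co_point coX pl); split.
Qed.

(** If the chain of [q] reached above level [l], then [q] would be its own parent there, and
    convexity of chains would put both nodes into one explicit node. *)
Lemma child_of l q : l < top_level T -> q \in level T l ->
  coal l q <> coal (l + 1) (parent T l q) ->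
  coal l q \in echildren (coal (l + 1) (parent T l q)) /\ elevel (coal l q) = l.
Proof.
move=> lt ql ne; have h := co_parent coX lt ql ne; split.
  by rewrite (co_children coX) h.
apply/eqP; rewrite eq_le (co_highest coX) // andbT leNgt; apply/negP => hl.
have [vl vc] := co_top coX (coal l q); rewrite (co_point coX ql) in vl vc.
have ql1 : q \in level T (l + 1) by apply: level_mono vl; lia.
rewrite (parent_self ql1) in ne; apply: ne.
rewrite -[in LHS]vc; apply/esym; apply: (co_convex coX (l1 := l)) => //; try lia.
Qed.

(** A child hanging at level [l] breaks the chain of [p] there: if it has the same point, its chain
    already ends at [l]; if not, [p] has a child other than itself and [co_apart] applies. *)
Lemma coal_neq l p w : p \in level T (l + 1) ->
  w \in echildren (coal (l + 1) p) -> elevel w = l -> coal l p <> coal (l + 1) p.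
Proof.
move=> pl wc wl; have [lt pw _ _] := child_level wc.
rewrite (co_point coX pl) wl in pw lt.
have pl' : p \in level T l by apply: level_mono pl; lia.
have [wt wce] := co_top coX w; rewrite wl in wt wce.
have [e|ne] := eqVneq (epoint w) p.
  move: wce; rewrite e => -> e'; have := co_highest coX pl; rewrite -e' wl; lia.
have := co_apart coX lt pl'; rewrite (parent_self pl); apply.
rewrite /only_self_child => h; move/eqP: ne; apply.
by apply: h; rewrite (_ : l + 1 - 1 = l) //; lia.
Qed.

(** A chain is convex and breaks wherever a child hangs, so it cannot break at two levels. This is
    why [expand] needs to inspect the first child only. *)
Lemma child_levels l p w w' : p \in level T (l + 1) ->
  w \in echildren (coal (l + 1) p) -> elevel w = l ->
  w' \in echildren (coal (l + 1) p) -> elevel w' = l.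
Proof.
move=> pl wc wl w'c; have [_ _] := child_level w'c.
rewrite (co_point coX pl) => pl' ce.
have n1 := coal_neq pl wc wl.
have n2 : coal (elevel w') p <> coal (elevel w' + 1) p.
  by apply: (coal_neq (w := w')) => //; rewrite ce.
have [h|h|//] := ltgtP (elevel w') l.
- by case: n1; apply: (co_convex coX (l1 := elevel w' + 1)) => //; lia.
- by case: n2; apply: (co_convex coX (l1 := l + 1)) => //; lia.
Qed.

(** Either the chain of [v] breaks just below level [l + 1], and all explicit children sit at level
    [l], or it continues, and the only child of the node is its own copy, still represented by
    [v]. *)
Lemma expandP l p : p \in level T (l + 1) ->
  let v := coal (l + 1) p in
  [/\ uniq (expand l v),
      forall w, w \in expand l v -> [/\ epoint w \in level T l,
        coal l (epoint w) = w & parent T l (epoint w) = p] &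
      forall q, q \in level T l -> parent T l q = p -> coal l q \in expand l v].
Proof.
move=> pl v; have lt : l < top_level T by have := level_le_top pl; lia.
have pl' : p \in level T l by apply: level_mono pl; lia.
have pp := parent_self pl.
case: (boolP (has (fun w => elevel w == l) (echildren v))) => [/hasP[w wv /eqP wl]|].
  have lev w' : w' \in echildren v -> elevel w' = l by apply: child_levels wl.
  have -> : expand l v = echildren v.
    rewrite /expand; case E: (echildren v) => [|w' s]; first by rewrite E in wv.
    by rewrite lev ?lexx // E mem_head.
  split; first exact: (co_uniq coX).
  - move=> w' w'v; have [_ pw _ _] := child_level w'v; have [] := co_top coX w'.
    by rewrite (lev _ w'v) in pw * => ? ?; split=> //; rewrite pw (co_point coX).
  - move=> q ql pq; rewrite /v -pq; apply: (proj1 (child_of lt ql _)); rewrite pq.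
    have [->|qp] := eqVneq q p; first exact: coal_neq wl.
    have := co_apart coX lt ql; rewrite pq; apply=> h.
    by move/eqP: qp; apply; apply: h; rewrite (_ : l + 1 - 1 = l) //; lia.
move/hasPn => nl.
have cv q : q \in level T l -> parent T l q = p -> coal l q = v.
  move=> ql pq; have [//|ne] := eqVneq (coal l q) v.
  have [] := child_of lt ql; first by rewrite pq; apply/eqP.
  by rewrite pq => /nl /eqP.
have -> : expand l v = [:: v].
  rewrite /expand; case E: (echildren v) => [//|w s].
  have wv : w \in echildren v by rewrite E mem_head.
  case: ifP => // lw; have {}lw : l < elevel w.
    by rewrite lt_neqAle lw andbT eq_sym; apply: nl.
  have [_ _] := child_level wv; rewrite (co_point coX pl) => pw ce.
  have ne : coal (elevel w) p <> coal (elevel w + 1) p.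
    by apply: (coal_neq (w := w)) => //; rewrite ce.
  by case: ne; apply: (co_convex coX (l1 := l + 1)) => //; lia.
split=> // [w|q ql pq]; rewrite inE; last by rewrite (cv _ ql pq).
by move/eqP->; rewrite (co_point coX pl) (cv _ pl' pp).
Qed.

Definition enum_level l (V : seq (enode X)) : Prop :=
  [/\ uniq V, forall v, v \in V -> epoint v \in level T l /\ coal l (epoint v) = v &
      forall p, p \in level T l -> coal l p \in V].

Lemma enum_level_inj l V : enum_level l V -> {in V &, injective (@epoint _ X)}.
Proof.
by move=> [_ h _] v w /h[_ vc] /h[_ wc] e; rewrite -vc -wc e.
Qed.

Lemma size_enum_level l V : enum_level l V -> size V = #|` level T l|.
Proof.
move=> eV; have [uV h1 h2] := eV.
rewrite -(size_map (@epoint _ X)); apply: perm_size; apply: uniq_perm.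
- by rewrite map_inj_in_uniq //; apply: enum_level_inj eV.
- exact: fset_uniq.
move=> p; apply/mapP/idP => [[v /h1[vl _] -> //]|pl].
by exists (coal l p); [apply: h2 | rewrite (co_point coX)].
Qed.

Lemma enum_level_expand l V : l < top_level T -> enum_level (l + 1) V ->
  enum_level l (flatten (map (expand l) V)).
Proof.
move=> lt eV; have [uV h1 h2] := eV.
have E v : v \in V -> [/\ uniq (expand l v),
      forall w, w \in expand l v -> [/\ epoint w \in level T l,
        coal l (epoint w) = w & parent T l (epoint w) = epoint v] &
      forall q, q \in level T l -> parent T l q = epoint v -> coal l q \in expand l v].
  by move=> /h1[vl vc]; have := expandP vl; rewrite vc.
split.
- suff: forall s, uniq s -> {subset s <= V} -> uniq (flatten (map (expand l) s)) by apply.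
  elim=> //= v s ih /andP[vs us] sub.
  have vV : v \in V by apply: sub; rewrite mem_head.
  have sV : {subset s <= V} by move=> w ws; apply: sub; rewrite inE ws orbT.
  have [uv hv _] := E v vV; rewrite cat_uniq uv ih // andbT /=; apply/hasPn => w.
  case/flatten_mapP => v' v's /=; have v'V := sV _ v's.
  have [_ hv' _] := E v' v'V => /hv'[_ _ e].
  apply/negP => /hv[_ _ e']; move: vs; rewrite (_ : v = v') ?v's //.
  by apply: (enum_level_inj eV) => //; rewrite -e -e'.
- move=> w /flatten_mapP[v vV wv]; have [_ hv _] := E v vV.
  by have [] := hv _ wv.
- move=> q ql; have pl := ct_parent ctT lt ql.
  apply/flatten_mapP; exists (coal (l + 1) (parent T l q)); first exact: h2.
  by have [_ _] := expandP pl; apply.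
Qed.

Definition start_node : enode X :=
  if echildren (eroot X) is [:: w] then w else eroot X.

(* The root chain may stop just above its branching end, in which case the
   first branching explicit node is the only child of the root. *)
Lemma start_nodeP : (1 < #|` S|)%N -> exists L,
  [/\ L <= top_level T, enum_level L [:: start_node] &
   exists h1 h2 s, [/\ echildren start_node = [:: h1, h2 & s],
     elevel h1 = L - 1, epoint h1 \in level T (L - 1),
     epoint h2 \in level T (L - 1) & epoint h1 != epoint h2 /\
     mdist (epoint h1) (epoint h2) <= 2 ^ (L + 1)]].
Proof.
move=> S2; have [p ep] := ct_root ctT.
have pt : p \in level T (top_level T) by rewrite ep inE.
have ex : exists n : nat, level T (top_level T - n%:Z) != [fset p].
  have [l lt Sl] := bottom_level; exists `|top_level T - l|%N.
  rewrite (_ : _ - _ = l); last by lia.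
  by apply: contraTneq (fsubset_leq_card Sl) => ->; rewrite cardfs1 -ltnNge.
case: (ex_minnP ex) => -[|n]; first by rewrite subr0 ep eqxx.
(* [L] is the last level, going down, for which it and all levels above consist of the root point
   alone. *)
have [L LE] : exists L : int, L = top_level T - n%:Z by eexists.
move=> nL min.
have Lt : L <= top_level T by lia.
have single l : L <= l -> l <= top_level T -> level T l = [fset p].
  move=> Ll lt; have [//|ne] := eqVneq (level T l) [fset p].
  have := min `|top_level T - l|%N; rewrite (_ : _ - _ = l); last by lia.
  by move/(_ ne); lia.
(* [co_merge] needs both a node and its child to have only the same-point child, so merging is
   certain only down to level [L + 1]; the branching node at level [L] may or may not belong to the
   root chain. *)
have chain (i : nat) : top_level T - i%:Z >= L + 1 -> coal (top_level T - i%:Z) p = eroot X.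
  elim: i => [|i ih] Li; first by rewrite subr0 (co_root coX).
  rewrite -ih; last by lia.
  have pi : p \in level T (top_level T - i.+1%:Z) by apply: root_in_level => //; lia.
  have pi1 : p \in level T (top_level T - i.+1%:Z + 1) by apply: root_in_level => //; lia.
  rewrite (_ : top_level T - i%:Z = top_level T - i.+1%:Z + 1); last by lia.
  rewrite -{2}(parent_self pi1); apply: (co_merge coX) => //; first by lia.
    by rewrite (parent_self pi1) => x; rewrite single ?inE; [move/eqP | lia | lia].
  by move=> x; rewrite single ?inE; [move/eqP | lia | lia].
have rE : L < top_level T -> coal (L + 1) p = eroot X.
  move=> Lt'; have := chain `|top_level T - (L + 1)%R|%N.
  by rewrite (_ : _ - _ = L + 1); [apply | lia].
have L1 : L < top_level T -> L + 1 <= top_level T by lia.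
have L0 (l : int) : L - 1 < l -> L <= l by lia.
have sL : level T L = [fset p] by apply: single.
have pL : p \in level T L by rewrite sL inE.
have L11 : L - 1 + 1 = L by lia.
have lt1 : L - 1 < top_level T by lia.
have L1t := ltW lt1.
have {nL} nL : level T (L - 1) != [fset p] by rewrite (_ : L - 1 = top_level T - n.+1%:Z) //; lia.
have pL1 : p \in level T (L - 1) by apply: root_in_level.
have [q ql qp] : exists2 q, q \in level T (L - 1) & q != p.
  have : ~~ (level T (L - 1) `<=` [fset p]).
    by apply: contra nL => h; rewrite eqEfsubset h fsub1set pL1.
  by case/fsubsetPn => q ql; rewrite inE => qp; exists q.
have par x : x \in level T (L - 1) -> parent T (L - 1) x = p.
  move/(ct_parent ctT lt1); rewrite L11.
  by rewrite sL inE => /eqP.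
set v0 := coal L p.
have pL0 : p \in level T (L - 1 + 1) by rewrite L11.
have := expandP pL0; rewrite L11 => -[].
rewrite -/v0 => uv0 hv0 hv0'.
have in1 := hv0' _ ql (par _ ql); have in2 := hv0' _ pL1 (par _ pL1).
have ne12 : coal (L - 1) q != coal (L - 1) p.
  by apply: contraNneq qp => e; rewrite -(co_point coX ql) e (co_point coX pL1).
have ev0 : expand (L - 1) v0 = echildren v0.
  have e1 : expand (L - 1) v0 <> [:: v0].
    by move=> e; move: in1 in2 ne12; rewrite e !inE => /eqP-> /eqP->; rewrite eqxx.
  by move: e1; rewrite /expand; case: (echildren v0) => [//|w s]; case: ifP.
have [h1 [h2 [s es]]] : exists h1 h2 s, echildren v0 = [:: h1, h2 & s].
  move: in1 in2 ne12; rewrite ev0; case: (echildren v0) => [//|h1 [|h2 s]]; last by exists h1, h2, s.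
  by rewrite !inE => /eqP-> /eqP->; rewrite eqxx.
have start : start_node = v0.
  move: Lt; rewrite le_eqVlt => /orP[/eqP Lt|Lt].
    rewrite /start_node -(co_root coX pt) -Lt -/v0 es //.
  have lt2 : L < top_level T by [].
  have pL' : p \in level T (L + 1) by apply: root_in_level => //; apply: L1.
  have [] := expandP pL'; rewrite (rE lt2) => ur hr hr'.
  have eV : expand L (eroot X) = [:: v0].
    have vin := hr' _ pL (parent_self pL').
    have all_v0 w : w \in expand L (eroot X) -> w = v0.
      by case/hr; rewrite sL inE => /eqP-> <-.
    case: (expand L (eroot X)) vin ur all_v0 => [//|a [|b t]] vin ur all_v0.
      by rewrite (all_v0 a) // mem_head.
    have ea : a = v0 by apply: all_v0; rewrite mem_head.
    have eb : b = v0 by apply: all_v0; rewrite !inE eqxx orbT.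
    by move: ur; rewrite ea eb /= inE eqxx.
  move: eV; rewrite /start_node /expand.
  case E: (echildren (eroot X)) => [|w t]; first by case.
  case: ifP => _ [e]; last by move: E; rewrite e es => -[_ <-].
  by rewrite e => ->.
exists L; rewrite start; split=> //.
  split=> //.
    by move=> v; rewrite inE => /eqP->; rewrite /v0 (co_point coX pL).
  by move=> x; rewrite sL !inE => /eqP->.
have h1v : h1 \in expand (L - 1) v0 by rewrite ev0 es mem_head.
have h2v : h2 \in expand (L - 1) v0 by rewrite ev0 es !inE eqxx orbT.
have [l1 c1 p1] := hv0 _ h1v; have [l2 c2 p2] := hv0 _ h2v.
exists h1, h2, s; split=> //.
  have h1c : h1 \in echildren v0 by rewrite es mem_head.
  have [_ _] := child_level h1c; rewrite (co_point coX pL) => lh1 ch1.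
  have [le1 ce1] := co_top coX h1.
  have lh := co_highest coX l1; rewrite c1 in lh.
  apply/eqP; rewrite eq_le lh andbT.
  move: ev0; rewrite /expand es; case: ifP => // _ _.
  rewrite leNgt; apply/negP => hl.
  have ne : coal (elevel h1) p <> coal (elevel h1 + 1) p.
    by apply: (coal_neq (w := h1)) => //; rewrite ch1.
  by case: ne; apply: (co_convex coX (l1 := L)) => //; [apply: L0 | rewrite lerDl].
split.
  apply: contraTneq uv0 => e; rewrite ev0 es /= inE.
  by rewrite (_ : h1 = h2) ?eqxx // -c1 -c2 e.
have d1 := ct_covering ctT lt1 l1; have d2 := ct_covering ctT lt1 l2.
rewrite p1 in d1; rewrite p2 in d2.
rewrite pow2S (le_trans (metric_triangle _ p _)) // (metric_sym p).
by move: d1 d2; rewrite L11; lra.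
Qed.

End Explicit.
End CoverTreeFacts.

(** * The program *)

Definition block (cs : seq cmd) : cmd := foldr Seq Skip cs.

Notation rNode := 0%N (only parsing).
Notation rK := 1%N (only parsing).
Notation rEps := 2%N (only parsing).
Notation rOne := 3%N (only parsing).
Notation rZero := 4%N (only parsing).
Notation rTwoR := 5%N (only parsing).
Notation rOneR := 6%N (only parsing).
Notation rZeroR := 7%N (only parsing).
Notation rK1 := 8%N (only parsing).
Notation rL := 9%N (only parsing).
Notation rS := 10%N (only parsing).
Notation rA := 11%N (only parsing).
Notation rB := 12%N (only parsing).
Notation rE := 13%N (only parsing).
Notation rI := 14%N (only parsing).
Notation rLim := 15%N (only parsing).
Notation rV := 16%N (only parsing).
Notation rCh := 17%N (only parsing).
Notation rH := 18%N (only parsing).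
Notation rH2 := 19%N (only parsing).
Notation rRad := 20%N (only parsing).
Notation rX := 21%N (only parsing).
Notation rTau := 22%N (only parsing).
Notation rCnt := 23%N (only parsing).
Notation rP := 24%N (only parsing).
Notation rQ := 25%N (only parsing).
Notation rD := 26%N (only parsing).
Notation rHd := 27%N (only parsing).
Notation rTl := 28%N (only parsing).
Notation rR := 29%N (only parsing).
Notation rF := 30%N (only parsing).
Notation rG := 31%N (only parsing).
Notation rY := 32%N (only parsing).
Notation rM := 33%N (only parsing).

Notation aNode := 0%N (only parsing).
Notation aFst := 1%N (only parsing).
Notation aEnd := 2%N (only parsing).
Notation aRad := 3%N (only parsing).
Notation aMark := 4%N (only parsing).
Notation aQueue := 5%N (only parsing).
Notation aCen := 6%N (only parsing).

Definition push_children : cmd :=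
  While [:: TNil rH; TLe rLim rE] (block
    [:: St aNode rE rH; Ins (IAdd rE rE rOne);
        Ins (ITail rCh rCh); Ins (IHead rH rCh)]).

Definition append_expansion : cmd :=
  If (TLe rL rH2) push_children
    (block [:: St aNode rE rV; Ins (IAdd rE rE rOne)]).

(* Rows [rA, rB) hold the nodes of level rL + 1; those of level rL are appended
   from row rB on, up to rE. The loop stops early once rE reaches rLim. *)
Definition build : cmd := block
  [:: Ins (IMove rE rB); Ins (IMove rI rA); Ins (IAdd rRad rS rS);
   While [:: TLe rB rI; TLe rLim rE] (block
     [:: Ld rV aNode rI; St aFst rI rE; St aRad rI rRad;
         Ins (IChildren rCh rV); Ins (IHead rH rCh); Ins (ILevel rH2 rH);
         append_expansion;
         St aEnd rI rE; Ins (IAdd rI rI rOne)])].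

Definition commit : cmd := block
  [:: Ins (IMove rA rB); Ins (IMove rB rE); Ins (ISub rL rL rOne);
      Ins (IDiv rS rS rTwoR)].

Definition first_children : cmd := block
  [:: Ins (IChildren rCh rNode); Ins (IHead rH rCh); Ins (ITail rCh rCh);
      Ins (IHead rH2 rCh)].

Definition init : cmd := block
  [:: Ins (IConst rOne 1); Ins (IConst rZero 0); Ins (IConst rX 2);
      Ins (IReal rTwoR rX); Ins (IReal rOneR rOne); Ins (IReal rZeroR rZero);
      Ins (IAdd rK1 rK rOne); first_children;
      If (TNil rH2) (block [:: Ins (IMove rNode rH); first_children]) Skip;
      Ins (ILevel rL rH); Ins (IPoint rP rH); Ins (IPoint rQ rH2);
      Ins (IDist rS rP rQ); Ins (IAdd rS rS rS);
      Ins (IConst rA 0); Ins (IConst rB 1); St aNode rZero rNode].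

(** Room for [k + 1] new rows suffices to learn that a level exceeds [k] nodes, and keeps the cost
    of an oversized level at [O(k)]. *)
Definition bounded_build : cmd := block [:: Ins (IAdd rLim rB rK1); build].

Definition find_level : cmd := block
  [:: bounded_build; While [:: TLe rLim rE] (block [:: commit; bounded_build])].

(* rLim is set to a non-integer, so that [build] is never interrupted. *)
Definition refine : cmd := block
  [:: Ins (IHead rLim rOne); Ins (IMove rX rEps);
   While [:: TLe rOneR rX] (block [:: Ins (IAdd rX rX rX); build; commit])].

Definition push_range : cmd :=
  While [:: TLe rG rF] (block
    [:: St aQueue rTl rF; Ins (IAdd rTl rTl rOne); Ins (IAdd rF rF rOne)]).

(** The rows from [rA] on are the leaves of the search and get marked. On the other rows [aRad]
    bounds the distance to every descendant, which justifies pruning beyond [rTau] plus that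
    radius. *)
Definition visit : cmd := block
  [:: Ld rR aQueue rHd; Ins (IAdd rHd rHd rOne); Ld rV aNode rR;
      Ins (IPoint rQ rV); Ins (IDist rD rP rQ);
   If (TLe rA rR)
     (If (TLe rD rTau) (St aMark rR rTau) Skip)
     (block [:: Ld rY aRad rR; Ins (IAdd rY rTau rY);
        If (TLe rD rY)
          (block [:: Ld rF aFst rR; Ld rG aEnd rR; push_range]) Skip])].

Definition range_search : cmd := block
  [:: St aQueue rZero rZero; Ins (IMove rHd rZero); Ins (IMove rTl rOne);
   While [:: TLe rTl rHd] visit].

(* The mark of a row is the last threshold rTau for which the row was reached;
   thresholds increase, so marks never need to be cleared. *)
Definition greedy : cmd := block
  [:: Ins (IMove rCnt rZero); Ins (IMove rI rA);
   While [:: TLe rB rI; TLe rK1 rCnt] (block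
     [:: Ld rM aMark rI;
      If (TLe rTau rM) Skip (block
        [:: Ld rV aNode rI; Ins (IPoint rP rV); St aCen rCnt rP;
            Ins (IAdd rCnt rCnt rOne);
            If (TLe rTau rZeroR) Skip range_search]);
      Ins (IAdd rI rI rOne)])].

Definition search : cmd := block
  [:: Ins (IMove rTau rZeroR); greedy;
   While [:: TLe rCnt rK] (block [:: Ins (IAdd rTau rTau rS); greedy])].

Definition print_centers : cmd := block
  [:: Ins (IMove rI rZero);
   While [:: TLe rCnt rI] (block
     [:: Ld rP aCen rI; Ins (IOutput rP); Ins (IAdd rI rI rOne)])].

Definition kcenter : cmd := block
  [:: init; find_level; refine; search; print_centers].

Section Rules.
Context {R : realType} {U : metricType R} (X : etree U).
Implicit Types (s : hstate X) (Q : hstate X -> Prop).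

Lemma wp_seq a b Q s : wp a (wp b Q) s -> wp (Seq a b) Q s.
Proof. by []. Qed.

Lemma wp_ins i c Q s : wp c Q (run_instr i s) -> wp (Seq (Ins i) c) Q s.
Proof. by []. Qed.

Lemma wp_ld d a r c Q s n : reg s r = VInt X (Posz n) ->
  wp c Q (tick 6 (set_reg s d (arr s a n))) -> wp (Seq (Ld d a r) c) Q s.
Proof. by move=> rn h; exists n. Qed.

Lemma wp_st a r b c Q s n : reg s r = VInt X (Posz n) ->
  wp c Q (tick 6 (set_arr s a n (reg s b))) -> wp (Seq (St a r b) c) Q s.
Proof. by move=> rn h; exists n. Qed.

Lemma wp_if t a b Q s : (holds s t -> wp a Q (tick 2 s)) ->
  (~~ holds s t -> wp b Q (tick 2 s)) -> wp (If t a b) Q s.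
Proof. by move=> h1 h2 /=; case: ifPn. Qed.

Lemma wp_skip Q s : Q s -> wp Skip Q s.
Proof. by []. Qed.

Lemma writeE (M : nat -> value X) d v i :
  write M d v i = if eqn i d then v else M i.
Proof. by []. Qed.

Lemma PoszS (n : nat) : Posz n + 1 = Posz n.+1.
Proof. by rewrite -PoszD addn1. Qed.

End Rules.

Arguments wp : simpl never.
Arguments unchanged : simpl never.
Arguments run_instr : simpl never.

Ltac norm := rewrite /run_instr /tick /set_reg /set_arr /= ?writeE /=.
Ltac ins := apply: wp_ins; norm.

Section Build.
Context {R : realType} {U : metricType R} (X : etree U).
Implicit Types (s : hstate X) (Q : hstate X -> Prop) (V : seq (enode X)).
Local Notation nd := (nth (eroot X)).

(** [rLim] enters through [vle] only, so that one specification covers both an integer limit and the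
    non-integer value that never stops the loop. *)
Lemma push_children_spec s e (l : seq (enode X)) :
  reg s rOne = VInt X 1 -> reg s rE = VInt X (Posz e) ->
  reg s rCh = VList l -> reg s rH = vhead (VList l) ->
  wp push_children (fun s' => exists m : nat,
    [/\ (m <= size l)%N, reg s' rE = VInt X (Posz (e + m)),
        forall j, (j < m)%N -> arr s' aNode (e + j) = VNode (nd l j),
        forall j, (j < e)%N -> arr s' aNode j = arr s aNode j &
        [/\ (0 < m)%N -> ~~ vle (reg s rLim) (VInt X (Posz (e + m).-1)),
        (m < size l)%N -> vle (reg s rLim) (VInt X (Posz (e + m))) &
        (clk s' <= clk s + 3 + 12 * m)%N]]) s.
Proof.
move=> h1 he hl hh.
apply: (@wp_while _ _ _ (fun n s' => exists m : nat,
    [/\ n = (size l - m)%N /\ (m <= size l)%N, reg s' rE = VInt X (Posz (e + m)),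
        reg s' rCh = VList (drop m l) /\ reg s' rH = vhead (VList (drop m l)),
        reg s' rOne = VInt X 1 /\ reg s' rLim = reg s rLim &
        [/\ forall j, (j < m)%N -> arr s' aNode (e + j) = VNode (nd l j),
        forall j, (j < e)%N -> arr s' aNode j = arr s aNode j,
        (0 < m)%N -> ~~ vle (reg s rLim) (VInt X (Posz (e + m).-1)) &
        (clk s' <= clk s + 12 * m)%N]]) _ _ _ (size l)).
- move=> n s' [m [[_ ml] he' [hl' hh'] [_ hlim] [k1 k2 k3 k4]]] /=.
  rewrite orbF hh' he' hlim => H; exists m; split=> //; split=> //.
    by move=> ml'; move: H; rewrite (drop_nth (eroot X)).
  by lia.
- move=> n s' [m [[nE ml] he' [hl' hh'] [h1' hlim] [k1 k2 k3 k4]]] /=.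
  rewrite orbF negb_or hh' he' hlim => /andP[H1 H2].
  have ml' : (m < size l)%N.
    by rewrite ltnNge; apply: contra H1 => h; rewrite drop_oversize.
  apply: wp_st; first exact: he'.
  norm.
  ins; rewrite h1' he' /=. ins; rewrite hl'. ins. apply: wp_skip.
  exists (size l - m.+1)%N; first by lia.
  exists m.+1; norm; rewrite PoszS -addnS hh' (drop_nth (eroot X)) //=; split=> //.
  split.
  + move=> j; rewrite ltnS leq_eqVlt => /predU1P[->|jm].
      by rewrite (_ : eqn _ _ = true) //; apply/eqP.
    by rewrite ifN ?k1 //; apply/negP => /eqP; lia.
  + by move=> j je; rewrite ifN ?k2 //; apply/negP => /eqP; lia.
  + by rewrite addnS.
  + by lia.
- by exists 0%N; rewrite subn0 addn0 drop0 muln0 addn0; split.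
Qed.

Lemma append_expansion_spec s e L (v : enode X) :
  reg s rOne = VInt X 1 -> reg s rE = VInt X (Posz e) -> reg s rL = VInt X L ->
  reg s rV = VNode v -> reg s rCh = VList (echildren v) ->
  reg s rH = vhead (VList (echildren v)) ->
  reg s rH2 = vnode (fun u => VInt X (elevel u)) (vhead (VList (echildren v))) ->
  ~~ vle (reg s rLim) (VInt X (Posz e)) ->
  wp append_expansion (fun s' => exists m : nat,
    [/\ (m <= size (expand L v))%N, reg s' rE = VInt X (Posz (e + m)),
        forall j, (j < m)%N -> arr s' aNode (e + j) = VNode (nd (expand L v) j),
        forall j, (j < e)%N -> arr s' aNode j = arr s aNode j &
        [/\ (0 < m)%N -> ~~ vle (reg s rLim) (VInt X (Posz (e + m).-1)),
        (m < size (expand L v))%N -> vle (reg s rLim) (VInt X (Posz (e + m))) &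
        (clk s' <= clk s + 5 + 12 * m)%N]]) s.
Proof.
move=> h1 he hL hv hch hh hh2 hlim; apply: wp_if; rewrite /= hL hh2.
  case E: (echildren v) => [//|w l] /= Lw.
  have -> : expand L v = echildren v by rewrite /expand E Lw.
  rewrite E in hch hh.
  apply: wp_mono (push_children_spec (s := tick 2 s) h1 he hch hh) => s' [m [k1 k2 k3 k4 [k5 k6 k7]]].
  by exists m; rewrite E; split=> //; split=> //; move: k7 => /=; lia.
move=> H; have -> : expand L v = [:: v].
  by rewrite /expand; move: H; case: (echildren v) => //= w l /negPf->.
apply: wp_st; first exact: he.
norm; ins; apply: wp_skip; exists 1%N; norm; rewrite h1 he /= -PoszD; split=> //.
- by case=> //; rewrite addn0 (_ : eqn e e = true) ?hv //; apply/eqP.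
- by move=> j je; rewrite ifN //; apply/negP => /eqP; lia.
- by split=> //; [rewrite addn1 | lia].
Qed.

Lemma flatten_offset (f : enode X -> seq (enode X)) V i j :
  (i < size V)%N -> (j < size (f (nd V i)))%N ->
  nd (flatten (map f V)) (size (flatten (map f (take i V))) + j) = nd (f (nd V i)) j.
Proof.
elim: V i => [//|v V ih] [|i] /= iV jv.
  by rewrite nth_cat jv.
by rewrite size_cat nth_cat ltnNge -addnA leq_addr /= addKn ih.
Qed.

Lemma flatten_offsetS (f : enode X -> seq (enode X)) V i : (i < size V)%N ->
  size (flatten (map f (take i.+1 V))) =
  (size (flatten (map f (take i V))) + size (f (nd V i)))%N.
Proof.
by move=> iV; rewrite (take_nth (eroot X)) // map_rcons flatten_rcons size_cat.
Qed.

Lemma flatten_offset_le (f : enode X -> seq (enode X)) V i :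
  (size (flatten (map f (take i V))) <= size (flatten (map f V)))%N.
Proof.
by rewrite -{2}(cat_take_drop i V) map_cat flatten_cat size_cat leq_addr.
Qed.

Lemma build_spec s a V L (sc : R) :
  let b := (a + size V)%N in
  let W := flatten (map (expand L) V) in
  let off i := size (flatten (map (expand L) (take i V))) in
  reg s rOne = VInt X 1 -> reg s rL = VInt X L -> reg s rS = VReal X sc ->
  reg s rA = VInt X (Posz a) -> reg s rB = VInt X (Posz b) ->
  (forall i, (i < size V)%N -> arr s aNode (a + i) = VNode (nd V i)) ->
  wp build (fun s' => exists n : nat,
    [/\ (n <= size W)%N, reg s' rE = VInt X (Posz (b + n)),
        forall j, (j < n)%N -> arr s' aNode (b + j) = VNode (nd W j),
        forall j, (j < b)%N -> arr s' aNode j = arr s aNode j &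
    [/\ forall j, (j < a)%N -> [/\ arr s' aFst j = arr s aFst j,
          arr s' aEnd j = arr s aEnd j & arr s' aRad j = arr s aRad j],
        (0 < n)%N -> ~~ vle (reg s rLim) (VInt X (Posz (b + n).-1)),
        ~~ vle (reg s rLim) (VInt X (Posz (b + n))) -> n = size W /\
          forall i, (i < size V)%N -> [/\ arr s' aFst (a + i) = VInt X (Posz (b + off i)),
            arr s' aEnd (a + i) = VInt X (Posz (b + off i.+1)) &
            arr s' aRad (a + i) = VReal X (sc + sc)] &
        (clk s' <= clk s + 6 + 36 * size V + 12 * n)%N]]) s.
Proof.
move=> b W off h1 hL hS hA hB hV.
ins; ins; ins; rewrite hB hA hS /=; apply: wp_seq.
(* After [i] expanded rows, [N] rows have been appended. The two counts agree, [N = off i], unless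
   the limit was hit inside the last expansion, and then the loop exits at once. *)
apply: (@wp_while _ _ _ (fun n s' => exists i N : nat,
  [/\ n = (size V - i)%N /\ (i <= size V)%N,
      reg s' rI = VInt X (Posz (a + i)) /\ reg s' rE = VInt X (Posz (b + N)),
      [/\ reg s' rOne = VInt X 1, reg s' rL = VInt X L, reg s' rRad = VReal X (sc + sc),
          reg s' rB = VInt X (Posz b) & reg s' rLim = reg s rLim],
      [/\ (N <= off i)%N, forall j, (j < N)%N -> arr s' aNode (b + j) = VNode (nd W j) &
          forall j, (j < b)%N -> arr s' aNode j = arr s aNode j] &
  [/\ forall j, (j < a)%N -> [/\ arr s' aFst j = arr s aFst j,
          arr s' aEnd j = arr s aEnd j & arr s' aRad j = arr s aRad j],
      (0 < N)%N -> ~~ vle (reg s rLim) (VInt X (Posz (b + N).-1)),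
      ~~ vle (reg s rLim) (VInt X (Posz (b + N))) -> N = off i /\
        forall i', (i' < i)%N -> [/\ arr s' aFst (a + i') = VInt X (Posz (b + off i')),
            arr s' aEnd (a + i') = VInt X (Posz (b + off i'.+1)) &
            arr s' aRad (a + i') = VReal X (sc + sc)] &
      (clk s' <= clk s + 3 + 36 * i + 12 * N)%N]]) _ _ _ (size V)).
- move=> n s' [i [N [[nE iV] [hi he] [k1 k2 k3 k4 k5] [k6 k7 k8] [k9 k10 k11 k12]]]] /=.
  rewrite orbF hi he k4 k5 => H; apply: wp_skip; exists N; split=> //=.
    exact: leq_trans k6 (flatten_offset_le _ _ _).
  have iVE : ~~ vle (reg s rLim) (VInt X (Posz (b + N))) -> i = size V.
    by move/negPf => h; move: H; rewrite h orbF /= lez_nat /b => ?; lia.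
  split=> //; last by lia.
  move=> h; have {}iVE := iVE h; have [-> k13] := k11 h.
  by rewrite iVE in k13 *; split=> //; rewrite /off take_size.
- move=> n s' [i [N [[nE iV] [hi he] [k1 k2 k3 k4 k5] [k6 k7 k8] [k9 k10 k11 k12]]]] /=.
  rewrite orbF negb_or hi he k4 k5 /= lez_nat => /andP[H1 H2].
  have {H1}iV' : (i < size V)%N by rewrite /b in H1; lia.
  have [NE k13] := k11 H2.
  set v := nd V i.
  apply: wp_ld; first exact: hi.
  norm; rewrite k8 ?ltn_add2l // hV // -/v.
  apply: wp_st; first exact: hi.
  norm; apply: wp_st; first exact: hi.
  norm; ins; ins; ins; apply: wp_seq.
  set s1 := HState _ _ _ _.
  have A := @append_expansion_spec s1 (b + N) L v k1 he k2 erefl erefl erefl erefl.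
  move: A; rewrite -[reg s1 rLim]/(reg s' rLim) k5 => /(_ H2) A.
  apply: (wp_weaken _ A) => // s2 [m [m1 m2 m3 m4 [m5 m6 m7]]] [u1 u2 _].
  have hi2 : reg s2 rI = VInt X (Posz (a + i)) by rewrite u1.
  apply: wp_st; first exact: hi2.
  norm; ins; apply: wp_skip.
  exists (size V - i.+1)%N; first by lia.
  have offS : off i.+1 = (off i + size (expand L v))%N by rewrite /off flatten_offsetS.
  have arS c : c != aNode -> arr s2 c = arr s1 c by move=> h; apply: u2; rewrite /= !inE orbb.
  have neq x y : x <> y -> eqn x y = false by move/eqP/negPf.
  have r1 : reg s2 rOne = VInt X 1 by rewrite u1.
  exists i.+1, (N + m)%N; norm; rewrite hi2 r1 m2 (arS aFst) // (arS aEnd) // (arS aRad) // /s1 /= he k3; split=> //.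
  + by split; congr VInt; lia.
  + by split=> //; rewrite u1.
  + split.
    * by rewrite offS NE leq_add2l.
    * move=> j jNm; have [jN|Nj] := ltnP j N.
        by rewrite m4 ?ltn_add2l //; apply: k7.
      rewrite -(subnKC Nj) addnA m3; last by lia.
      have jm : (j - N < m)%N by lia.
      by rewrite {2}NE flatten_offset //; apply: leq_trans m1.
    * move=> j jb; have jbN : (j < b + N)%N by exact: ltn_addr.
      rewrite (m4 _ jbN); exact: (k8 _ jb).
  + split.
    * move=> j ja; have [-> -> ->] := k9 _ ja; rewrite !(neq j) //; lia.
    * case: m m5 {m1 m2 m3 m4 m6 m7} => [|m] m5; last by move=> _; rewrite addnA m5.
      by rewrite !addn0 in m5 * => N0; apply: k10; lia.
    * move=> h; have mE : m = size (expand L v).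
        by apply/eqP; rewrite eqn_leq m1 leqNgt; apply: contra h => /m6; rewrite addnA.
      rewrite offS mE NE; split=> // i'; rewrite ltnS leq_eqVlt => /predU1P[->|i'i].
        have ee : eqn (a + i) (a + i) = true by apply/eqP.
        by rewrite ee offS addnA.
      have [-> -> ->] := k13 _ i'i; rewrite !(neq (a + i')%N) //; lia.
    * by move: m7; rewrite /s1 /=; lia.
- exists 0%N, 0%N; rewrite !addn0 /off take0 /= subn0; split=> //; split=> //=.
  by lia.
Qed.

End Build.

(** * Rows *)

Section Rows.
Context {R : realType} {U : metricType R} (T : tree U) (S : {fset U}).
Hypothesis ctT : cover_tree T S.
Context (X : etree U) (coal : int -> U -> enode X).
Hypothesis coX : coalescing T S coal.
Implicit Types (s : hstate X) (V : seq (enode X)) (l L : int) (sc : R).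
Local Notation nd := (nth (eroot X)).

(** The mathematical content of the arrays. An explicit node may fill several rows, one for each
    level of its chain, so the level of a row need not be the [elevel] of its node. *)
Record rows := Rows {
  rnode : nat -> enode X;
  rlev : nat -> int;
  rpar : nat -> nat
}.
Implicit Types (g : rows).

Definition rpoint g i : U := epoint (rnode g i).

(* Row 0 is the only node of level L; the last [size V] rows, from row a on,
   are the nodes of level l. *)
Record rows_ok g a V l L : Prop := RowsOk {
  ro_top : l <= L /\ L <= top_level T;
  ro_root : rlev g 0 = L;
  ro_pos : (0 < size V)%N;
  ro_enum : enum_level T coal l V;
  ro_seg : forall i, (i < size V)%N -> rnode g (a + i) = nd V i /\ rlev g (a + i) = l;
  ro_old : forall i, (i < a)%N -> l < rlev g i <= L;
  ro_level : forall i, (i < a + size V)%N -> rpoint g i \in level T (rlev g i);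
  ro_par : forall i, (0 < i < a + size V)%N ->
    [/\ (rpar g i < i)%N, (rpar g i < a)%N, rlev g (rpar g i) = rlev g i + 1 &
        parent T (rlev g i) (rpoint g i) = rpoint g (rpar g i)];
  ro_inj : forall i j, (i < a + size V)%N -> (j < a + size V)%N ->
    rlev g i = rlev g j -> rpoint g i = rpoint g j -> i = j
}.

(** Rows are appended parent by parent, so siblings are contiguous and two indices describe them.
    Row 0 has no parent, whence the condition [0 < y]. The radius is twice a scale, known up to a
    factor 4. *)
Definition rows_mem s g a b : Prop :=
  (forall i, (i < b)%N -> arr s aNode i = VNode (rnode g i)) /\
  (forall i, (i < a)%N -> exists f e rad,
    [/\ arr s aFst i = VInt X (Posz f), arr s aEnd i = VInt X (Posz e),
        arr s aRad i = VReal X rad,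
        2 ^ (rlev g i + 1) <= rad <= 8 * 2 ^ (rlev g i) &
        forall y, (f <= y < e)%N = [&& (0 < y)%N, (y < b)%N & rpar g y == i]]).

(** The machine never learns [2 ^ l] itself; this window of ratio 4 is preserved when level and
    scale go down together. *)
Definition scale l sc : Prop := 2 ^ l < sc <= 4 * 2 ^ l.

Lemma scale_half l sc : scale l sc -> scale (l - 1) (sc / 2).
Proof.
rewrite /scale => /andP[h1 h2].
have e : (2 : R) ^ l = 2 * 2 ^ (l - 1) by rewrite -pow2S subrK.
by rewrite e in h1 h2; apply/andP; split; lra.
Qed.

Lemma offset_exists (f : enode X -> seq (enode X)) V j :
  (j < size (flatten (map f V)))%N -> exists2 i, (i < size V)%N &
  (size (flatten (map f (take i V))) <= j < size (flatten (map f (take i.+1 V))))%N.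
Proof.
elim: V j => [//|v V ih] j /=; rewrite size_cat => jlt.
have [jv|vj] := ltnP j (size (f v)).
  by exists 0%N => //=; rewrite take0 /= cats0.
have [|i iV h] := ih (j - size (f v))%N; first by lia.
by exists i.+1 => //=; rewrite !size_cat; lia.
Qed.

Lemma rows_extend s s' g a V l L sc :
  let b := (a + size V)%N in
  let W := flatten (map (expand (l - 1)) V) in
  let off i := size (flatten (map (expand (l - 1)) (take i V))) in
  rows_ok g a V l L -> rows_mem s g a b -> scale l sc ->
  (forall j, (j < size W)%N -> arr s' aNode (b + j) = VNode (nd W j)) ->
  (forall j, (j < b)%N -> arr s' aNode j = arr s aNode j) ->
  (forall j, (j < a)%N -> [/\ arr s' aFst j = arr s aFst j,
     arr s' aEnd j = arr s aEnd j & arr s' aRad j = arr s aRad j]) ->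
  (forall i, (i < size V)%N -> [/\ arr s' aFst (a + i) = VInt X (Posz (b + off i)),
     arr s' aEnd (a + i) = VInt X (Posz (b + off i.+1)) &
     arr s' aRad (a + i) = VReal X (sc + sc)]) ->
  exists g', rows_ok g' b W (l - 1) L /\ rows_mem s' g' b (b + size W).
Proof.
move=> b W off ok [mn mc] /andP[sc1 sc2] hN hN' hO hF.
have [lL Lt] := ro_top ok.
have l1t : l - 1 < top_level T by lia.
have eV := ro_enum ok; have [uV V1 V2] := eV.
have eW : enum_level T coal (l - 1) W.
  by apply: (enum_level_expand ctT coX l1t); rewrite subrK.
have [uW W1 W2] := eW.
have parW w : w \in W -> coal l (parent T (l - 1) (epoint w)) \in V.
  by case/W1 => wl _; apply: V2; rewrite -[l in level T l](subrK 1); apply: (ct_parent ctT).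
have V1' v : v \in V -> epoint v \in level T (l - 1 + 1) by case/V1; rewrite subrK.
have expV i j : (i < size V)%N -> (off i <= j < off i.+1)%N ->
    parent T (l - 1) (epoint (nd W j)) = epoint (nd V i).
  move=> iV; rewrite /off flatten_offsetS // => /andP[j1 j2].
  have jn : nd W j \in expand (l - 1) (nd V i).
    have jm : (j - off i < size (expand (l - 1) (nd V i)))%N by rewrite ltn_subLR.
    by rewrite -(subnKC j1) /W flatten_offset ?mem_nth.
  have vV : nd V i \in V by rewrite mem_nth.
  have [_ h _] := expandP ctT coX (V1' _ vV); move: h; rewrite subrK.
  by have [_ ->] := V1 _ vV => /(_ _ jn)[_ _ ->].
(* The position in [V] of the explicit node standing for the parent. By [parE], the segments between
   consecutive values of [off] are exactly the fibres of [par]. *)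
pose par j := index (coal l (parent T (l - 1) (epoint (nd W j)))) V.
have parE i j : (i < size V)%N -> (j < size W)%N -> (off i <= j < off i.+1)%N = (par j == i).
  move=> iV jW; apply/idP/eqP => [h|<-].
    have vV : nd V i \in V by rewrite mem_nth.
    by rewrite /par (expV _ _ iV h); have [_ ->] := V1 _ vV; rewrite index_uniq.
  have [i' i'V h] := offset_exists jW.
  have vV : nd V i' \in V by rewrite mem_nth.
  suff -> : par j = i' by [].
  by rewrite /par (expV _ _ i'V h); have [_ ->] := V1 _ vV; rewrite index_uniq.
have par_lt j : (j < size W)%N -> (par j < size V)%N.
  by move=> jW; rewrite index_mem; apply: parW; rewrite mem_nth.
have V0 := ro_pos ok.
have W0 : (0 < size W)%N.
  have [i0 i0V] : exists i, (i < size V)%N by exists 0%N.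
  have vV : nd V i0 \in V by rewrite mem_nth.
  have [vl vc] := V1 _ vV.
  have vl' : epoint (nd V i0) \in level T (l - 1) by apply: (level_mono ctT) vl; lia.
  by have := W2 _ vl'; case: (W).
pose g' := Rows (fun i => if (i < b)%N then rnode g i else nd W (i - b))
  (fun i => if (i < b)%N then rlev g i else l - 1)
  (fun i => if (i < b)%N then rpar g i else a + par (i - b))%N.
have gn i : (i < b)%N -> [/\ rnode g' i = rnode g i, rlev g' i = rlev g i,
    rpar g' i = rpar g i & rpoint g' i = rpoint g i].
  by move=> ib; rewrite /rpoint /= ib.
have go i : [/\ rnode g' (b + i) = nd W i, rlev g' (b + i) = l - 1,
    rpar g' (b + i) = (a + par i)%N & rpoint g' (b + i) = epoint (nd W i)].
  by rewrite /rpoint /= ltnNge leq_addr /= addKn.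
have split_row i : (i < b + size W)%N -> (i < b)%N \/ exists2 j, (j < size W)%N & i = (b + j)%N.
  by move=> ibW; have [?|bi] := ltnP i b; [left | right; exists (i - b)%N; lia].
have lev_ge i : (i < b)%N -> l <= rlev g i <= L.
  move=> ib; have [ia|ai] := ltnP i a; first by have := ro_old ok ia; lia.
  have iV : (i - a < size V)%N by rewrite /b in ib; lia.
  by have [_] := ro_seg ok iV; rewrite subnKC // => ->; lia.
have ab : (0 < b)%N by rewrite /b; lia.
exists g'; split; first split=> //.
- by lia.
- by have [_ -> _ _] := gn _ ab; apply: (ro_root ok).
- by move=> i iW; have [-> -> _ _] := go i.
- by move=> i ib; have [_ -> _ _] := gn _ ib; have := lev_ge _ ib; lia.
- move=> i /split_row[ib|[j jW ->]].
    by have [_ -> _ ->] := gn _ ib; apply: (ro_level ok).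
  have [_ -> _ ->] := go j; have jW' : nd W j \in W by rewrite mem_nth.
  by have [] := W1 _ jW'.
- move=> i /andP[i0] /split_row[ib|[j jW ->]].
    have ib' : (0 < i < a + size V)%N by rewrite i0.
    have [p1 p2 p3 p4] := ro_par ok ib'.
    have pb : (rpar g i < b)%N by exact: ltn_trans ib.
    have [_ e1 e2 e3] := gn _ ib; rewrite e1 e2 e3.
    have [_ f1 f2 f3] := gn _ pb; rewrite f1 f3; split=> //.
  have [_ e1 e2 e3] := go j; rewrite e1 e2 e3.
  have pV := par_lt _ jW; have pb : (a + par j < b)%N by rewrite /b ltn_add2l.
  have [_ f1 f2 f3] := gn _ pb; rewrite f1 f3; split=> //.
  + exact: leq_trans pb (leq_addr _ _).
  + by have [_ ->] := ro_seg ok pV; rewrite subrK.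
  + have jW' : nd W j \in W by rewrite mem_nth.
    rewrite /rpoint; have [-> _] := ro_seg ok pV; rewrite /par nth_index ?parW //.
    have [wl _] := W1 _ jW'; rewrite (co_point coX) //.
    by rewrite -[l in level T l](subrK 1); apply: (ct_parent ctT).
- move=> i j /split_row[ib|[i' i'W ->]] /split_row[jb|[j' j'W ->]].
  + have [_ -> _ ->] := gn _ ib; have [_ -> _ ->] := gn _ jb; exact: (ro_inj ok).
  + have [_ -> _ ->] := gn _ ib; have [_ -> _ ->] := go j'.
    by have := lev_ge _ ib; lia.
  + have [_ -> _ ->] := go i'; have [_ -> _ ->] := gn _ jb.
    by have := lev_ge _ jb; lia.
  + have [_ -> _ ->] := go i'; have [_ -> _ ->] := go j'.
    move=> _ e; congr addn; apply/eqP; rewrite -(nth_uniq (eroot X) i'W j'W uW); apply/eqP.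
    by apply: (enum_level_inj eW) => //; rewrite mem_nth.
split=> [i /split_row[ib|[j jW ->]]|i ib].
- by have [-> _ _ _] := gn _ ib; rewrite hN' // mn.
- by have [-> _ _ _] := go j; rewrite hN.
have [ia|ai] := ltnP i a.
  have [f [e [rad [m1 m2 m3 m4 m5]]]] := mc _ ia; have [n1 n2 n3] := hO _ ia.
  exists f, e, rad; rewrite n1 n2 n3 m1 m2 m3; split=> //; first by have [_ -> _ _] := gn _ ib.
  move=> y; rewrite m5 -/b; have [yb|yb] := ltnP y b.
    by have [_ _ -> _] := gn _ yb; rewrite /= ltn_addr.
  rewrite andbF -(subnKC yb); have [_ _ -> _] := go (y - b)%N.
  by rewrite (_ : _ == i = false) ?andbF //; apply/eqP; lia.
have iV : (i - a < size V)%N by rewrite /b in ib; lia.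
have [n1 n2 n3] := hF _ iV; rewrite subnKC // in n1 n2 n3.
exists (b + off (i - a))%N, (b + off (i - a).+1)%N, (sc + sc); split=> //.
  have [_ -> _ _] := gn _ ib; have [_] := ro_seg ok iV; rewrite subnKC // => ->.
  by rewrite pow2S; apply/andP; split; lra.
move=> y; have [yb|yb] := ltnP y b.
  have [_ _ -> _] := gn _ yb; rewrite [LHS](_ : _ = false); last by lia.
  apply/esym/negP => /and3P[y0 _ /eqP yi].
  have yb' : (0 < y < a + size V)%N by rewrite y0.
  by have [_ h _ _] := ro_par ok yb'; lia.
have [_ _ e _] := go (y - b)%N; rewrite subnKC // in e; rewrite e.
have [yW|Wy] := ltnP (y - b) (size W).
  have -> : (y < b + size W)%N by lia.
  have -> : (0 < y)%N by lia.
  rewrite (_ : (a + par (y - b) == i)%N = (par (y - b) == i - a)%N).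
    by rewrite -parE //; lia.
  by apply/eqP/eqP; lia.
rewrite [(y < b + size W)%N](_ : _ = false) ?andbF; last by lia.
have := flatten_offset_le (expand (l - 1)) V (i - a).+1; rewrite -/W -/(off _); lia.
Qed.

End Rows.

(** * Finding the levels *)

Section Levels.
Context {R : realType} {U : metricType R} (T : tree U) (S : {fset U}).
Hypothesis ctT : cover_tree T S.
Context (X : etree U) (coal : int -> U -> enode X).
Hypothesis coX : coalescing T S coal.
Context (k : nat) (eps : R).
Implicit Types (s : hstate X) (V : seq (enode X)) (l L : int) (sc : R) (g : rows X).
Local Notation nd := (nth (eroot X)).

Record consts s : Prop := Consts {
  c_k : reg s rK = VInt X (Posz k);
  c_eps : reg s rEps = VReal X eps;
  c_one : reg s rOne = VInt X 1;
  c_zero : reg s rZero = VInt X (Posz 0);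
  c_twoR : reg s rTwoR = VReal X 2;
  c_oneR : reg s rOneR = VReal X 1;
  c_zeroR : reg s rZeroR = VReal X 0;
  c_k1 : reg s rK1 = VInt X (Posz k.+1)
}.

Record rep s g a V l L sc : Prop := Rep {
  rp_consts : consts s;
  rp_L : reg s rL = VInt X (l - 1);
  rp_S : reg s rS = VReal X sc;
  rp_A : reg s rA = VInt X (Posz a);
  rp_B : reg s rB = VInt X (Posz (a + size V));
  rp_scale : scale l sc;
  rp_ok : rows_ok T coal g a V l L;
  rp_mem : rows_mem s g a (a + size V)
}.

Definition next V l : seq (enode X) := flatten (map (expand (l - 1)) V).

Lemma rep_same s s' g a V l L sc :
  (forall r, r \in [:: rK; rEps; rOne; rZero; rTwoR; rOneR; rZeroR; rK1; rL; rS; rA; rB] ->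
    reg s' r = reg s r) ->
  (forall c, (c <= 3)%N -> arr s' c = arr s c) ->
  rep s g a V l L sc -> rep s' g a V l L sc.
Proof.
move=> hr ha [[c1 c2 c3 c4 c5 c6 c7 c8] r1 r2 r3 r4 sl ok [m1 m2]].
split=> //; try by rewrite hr.
  by split; rewrite hr.
split=> [i ib|i ia]; first by rewrite ha // m1.
by have [f [e [rad h]]] := m2 _ ia; exists f, e, rad; rewrite !ha.
Qed.

Lemma build_rep s g a V l L sc : rep s g a V l L sc ->
  wp build (fun s' => exists n : nat,
    [/\ rep s' g a V l L sc /\ reg s' rE = VInt X (Posz (a + size V + n)),
        (n <= size (next V l))%N,
        (0 < n)%N -> ~~ vle (reg s rLim) (VInt X (Posz (a + size V + n).-1)),
        ~~ vle (reg s rLim) (VInt X (Posz (a + size V + n))) ->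
          n = size (next V l) /\ exists g',
          rows_ok T coal g' (a + size V) (next V l) (l - 1) L /\
          rows_mem s' g' (a + size V) (a + size V + size (next V l)) &
        (clk s' <= clk s + 6 + 36 * size V + 12 * n)%N]) s.
Proof.
move=> rp; have [cs rL rS rA rB sl ok mm] := rp; have [m1 m2] := mm.
have hV i : (i < size V)%N -> arr s aNode (a + i) = VNode (nd V i).
  by move=> iV; rewrite m1 ?ltn_add2l //; have [-> _] := ro_seg ok iV.
have h := build_spec (c_one cs) rL rS rA rB hV.
apply: (wp_weaken _ h) => // s' [n [n1 n2 n3 n4 [n5 n6 n7 n8]]] [u1 u2 _].
exists n; split=> //.
  split=> //; split; try by rewrite u1.
  - by case: cs => *; split; rewrite u1.
  - by [].
  - by [].
  split=> [i ib|i ia]; first by rewrite n4 // m1.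
  have [f [e [rad h']]] := m2 _ ia; exists f, e, rad.
  by have [-> -> ->] := n5 _ ia.
move=> /n7[nW hF]; split=> //; rewrite nW in n3.
exact: (rows_extend ctT coX ok mm sl n3 n4 n5 hF).
Qed.

Lemma commit_rep s g g' a V l L sc : rep s g a V l L sc ->
  reg s rE = VInt X (Posz (a + size V + size (next V l))) ->
  rows_ok T coal g' (a + size V) (next V l) (l - 1) L ->
  rows_mem s g' (a + size V) (a + size V + size (next V l)) ->
  wp commit (fun s' => rep s' g' (a + size V) (next V l) (l - 1) L (sc / 2) /\
    clk s' = (clk s + 4)%N) s.
Proof.
move=> [cs rL rS rA rB sl ok mm] hE ok' mm'; have [c1 c2 c3 c4 c5 c6 c7 c8] := cs.
ins; ins; ins; ins; apply: wp_skip; split; last by norm; lia.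
split=> //; norm; rewrite ?rL ?rS ?c3 ?c5 //=.
exact: scale_half.
Qed.

Lemma size_rep s g a V l L sc : rep s g a V l L sc -> size V = #|` level T l|.
Proof. by case=> _ _ _ _ _ _ ok _; apply: (size_enum_level coX (ro_enum ok)). Qed.

Lemma size_next s g a V l L sc : rep s g a V l L sc ->
  size (next V l) = #|` level T (l - 1)|.
Proof.
case=> _ _ _ _ _ _ ok _; have [lL Lt] := ro_top ok.
apply: (size_enum_level coX (l := l - 1)).
apply: (enum_level_expand ctT coX); first by lia.
by rewrite subrK; apply: ro_enum ok.
Qed.

Lemma bounded_build_rep s g a V l L sc : rep s g a V l L sc -> (size V <= k)%N ->
  wp bounded_build (fun s' => exists n : nat,
    [/\ rep s' g a V l L sc,
        reg s' rLim = VInt X (Posz (a + size V + k.+1)),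
        reg s' rE = VInt X (Posz (a + size V + n)),
        (k < n)%N -> (k < #|` level T (l - 1)|)%N &
        ((n <= k)%N -> n = size (next V l) /\ exists g',
          rows_ok T coal g' (a + size V) (next V l) (l - 1) L /\
          rows_mem s' g' (a + size V) (a + size V + size (next V l))) /\
        (clk s' <= clk s + 60 * k.+1)%N]) s.
Proof.
move=> rp Vk; have [cs rL rS rA rB sl ok mm] := rp.
ins; rewrite rB (c_k1 cs) /= -PoszD; apply: wp_seq; set s1 := HState _ _ _ _.
have rp1 : rep s1 g a V l L sc.
  by apply: rep_same rp => // r; rewrite !inE => h; rewrite /= writeE ifN //; apply: contraL h => /eqP->.
apply: (wp_weaken _ (build_rep rp1)) => // s2 [n [[n1 n2] n3 n4 n5 n6]] [u1 _ _].
rewrite -[reg s1 rLim]/(VInt X (Posz (a + size V + k.+1))) /= lez_nat in n4 n5.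
apply: wp_skip; exists n; split=> //.
- by rewrite u1.
- by rewrite -(size_next rp); lia.
split; first by move=> nk; apply: n5; lia.
have nk : (n <= k.+1)%N by case: (n) n4 => // n' /(_ isT); lia.
by move: n6 => /=; lia.
Qed.

Lemma level_card_mono l l' : l' <= l -> (#|` level T l| <= #|` level T l'|)%N.
Proof.
by move=> ll; apply: fsubset_leq_card; apply/fsubsetP => x; apply: (level_mono ctT).
Qed.

Lemma refine_rep s g a V l L sc (j : nat) : rep s g a V l L sc ->
  1 <= eps * 2 ^+ j -> (forall i, (i < j)%N -> eps * 2 ^+ i < 1) ->
  wp refine (fun s' => exists g a V sc, rep s' g a V (l - j%:Z) L sc /\
    (clk s' <= clk s + 4 + j * (48 * #|` level T (l - j%:Z)| + 13))%N) s.
Proof.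
move=> rp hj hj'; have [cs _ _ _ _ _ _ _] := rp.
ins; ins; rewrite (c_one cs) (c_eps cs) /=; apply: wp_seq.
apply: (@wp_while _ _ _ (fun m s' => exists i g a V sc,
  [/\ m = (j - i)%N /\ (i <= j)%N, rep s' g a V (l - i%:Z) L sc,
      reg s' rLim = VNil X, reg s' rX = VReal X (eps * 2 ^+ i) &
      (clk s' <= clk s + 2 + i * (48 * #|` level T (l - j%:Z)| + 13))%N]) _ _ _ j).
- move=> m s' [i [g' [a' [V' [sc' [[mE ij] rp' rl rx ck]]]]]] /=.
  rewrite orbF rx (c_oneR (rp_consts rp')) /= => H; apply: wp_skip.
  (* The loop exits at an [i] with [eps * 2 ^+ i >= 1], and [hj'] excludes this before [j]. *)
  have -> : j = i by apply/eqP; rewrite eqn_leq ij andbT leqNgt; apply/negP => /hj'; rewrite ltNge H.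
  exists g', a', V', sc'; split; first exact: rep_same rp'.
  move: ck; rewrite (_ : j = i) //=; last first.
    by apply/eqP; rewrite eqn_leq ij andbT leqNgt; apply/negP => /hj'; rewrite ltNge H.
  by lia.
- move=> m s' [i [g' [a' [V' [sc' [[mE ij] rp' rl rx ck]]]]]] /=.
  rewrite orbF rx (c_oneR (rp_consts rp')) /= => H.
  have ij' : (i < j)%N.
    by rewrite ltnNge; apply: contra H => ji; rewrite (_ : i = j) //; apply/eqP; rewrite eqn_leq ij.
  ins; rewrite rx /=; apply: wp_seq; set s1 := HState _ _ _ _.
  have rp1 : rep s1 g' a' V' (l - i%:Z) L sc'.
    apply: rep_same rp' => // r; rewrite !inE => h.
    by rewrite /= writeE ifN //; apply: contraL h => /eqP->.
  apply: (wp_weaken _ (build_rep rp1)) => // s2 [n [[n1 n2] n3 _ n5 n6]] [u1 _ _].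
  rewrite -[reg s1 rLim]/(reg s' rLim) rl /= in n5.
  have {n5}[nE [g2 [ok2 mm2]]] := n5 isT; rewrite nE in n2.
  apply: wp_seq; apply: (wp_weaken _ (commit_rep n1 n2 ok2 mm2)) => // s3 [rp3 ck3] [v1 _ _].
  have e : l - i%:Z - 1 = l - i.+1%:Z by lia.
  apply: wp_skip; exists (j - i.+1)%N; first by lia.
  exists i.+1, g2, (a' + size V')%N, (next V' (l - i%:Z)), (sc' / 2); rewrite -e; split=> //.
  + by rewrite v1 // u1.
  + by rewrite v1 // u1 //= writeE /= exprSr; congr VReal; ring.
  (* A round costs 36 per old row and 12 per new one; both counts are at most that of the final,
     largest level, whence 48. *)
  + have h1 : (size V' <= #|` level T (l - j%:Z)|)%N.
      by rewrite (size_rep rp'); apply: level_card_mono; lia.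
    have h2 : (n <= #|` level T (l - j%:Z)|)%N.
      by rewrite nE (size_next rp'); apply: level_card_mono; lia.
    rewrite ck3 mulSn; move: ck h1 h2 n6; rewrite /s1 /=.
    by move: (i * _)%N => P; move: #|` level T (l - j%:Z)| => M; lia.
- exists 0%N, g, a, V, sc; rewrite subr0 subn0 mulr1; split=> //.
    apply: rep_same rp => // r; rewrite !inE => h.
    by norm; rewrite !ifN //; apply: contraL h => /eqP->.
  by rewrite /=; lia.
Qed.

Hypothesis kS : (k < #|` S|)%N.

(** Termination comes from the bottom level, which contains all of [S] and hence more than [k]
    points; the variant is the distance to it. *)
Lemma find_level_rep s g a V l L sc : rep s g a V l L sc -> (size V <= k)%N ->
  wp find_level (fun s' => exists g a V l' sc,
    [/\ rep s' g a V l' L sc, (size V <= k)%N, (k < #|` level T (l' - 1)|)%N,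
        l' <= l & (clk s' <= clk s + 80 * k.+1 * (`|l - l'|%N).+1)%N]) s.
Proof.
move=> rp Vk; apply: wp_seq; have h0 := bounded_build_rep rp Vk.
apply: (wp_mono _ h0) => s1 [n [n1 n2 n3 n4 [n5 n6]]].
have [lb lbt /fsubset_leq_card Slb] := bottom_level ctT.
apply: wp_seq.
apply: (@wp_while _ _ _ (fun m s' => exists g a V l' sc n,
  [/\ rep s' g a V l' L sc /\ (size V <= k)%N, m = `|l' - lb|%N /\ l' <= l,
      reg s' rLim = VInt X (Posz (a + size V + k.+1)) /\
      reg s' rE = VInt X (Posz (a + size V + n)),
      (k < n)%N -> (k < #|` level T (l' - 1)|)%N &
      ((n <= k)%N -> n = size (next V l') /\ exists g',
        rows_ok T coal g' (a + size V) (next V l') (l' - 1) L /\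
        rows_mem s' g' (a + size V) (a + size V + size (next V l'))) /\
      (clk s' <= clk s + 60 * k.+1 + 80 * k.+1 * `|l - l'|%N)%N]) _ _ _ `|l - lb|%N).
- move=> m s' [g' [a' [V' [l' [sc' [n' [[rp' Vk'] [mE l'l] [rl re] h1 [h2 h3]]]]]]]] /=.
  rewrite orbF rl re /= lez_nat => H; apply: wp_skip.
  exists g', a', V', l', sc'; split=> //.
  + by apply: rep_same rp'.
  + by apply: h1; lia.
  + by move=> /=; nia.
- move=> m s' [g' [a' [V' [l' [sc' [n' [[rp' Vk'] [mE l'l] [rl re] h1 [h2 h3]]]]]]]] /=.
  rewrite orbF rl re /= lez_nat => H.
  have [|nE [g2 [ok2 mm2]]] := h2; first by lia.
  apply: wp_seq.
  have rp2 : rep (tick 2 s') g' a' V' l' L sc' by apply: rep_same rp'.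
  have hc := @commit_rep (tick 2 s') g' g2 a' V' l' L sc' rp2.
  rewrite nE in re; apply: (wp_mono _ (hc re ok2 mm2)) => s2 [rp3 ck].
  apply: wp_seq; have V2k : (size (next V' l') <= k)%N by rewrite -nE; lia.
  apply: (wp_mono _ (bounded_build_rep rp3 V2k)) => s3 [n2' [q1 q2 q3 q4 [q5 q6]]].
  have lb_lt : lb < l'.
    rewrite ltNge; apply/negP => ll; move: Vk'; rewrite (size_rep rp') leqNgt => /negP; apply.
    apply: (leq_trans kS); apply: (leq_trans Slb); apply: fsubset_leq_card.
    by apply/fsubsetP => x; apply: (level_mono ctT).
  apply: wp_skip; exists `|(l' - 1)%R - lb|%N; first by lia.
  exists g2, (a' + size V')%N, (next V' l'), (l' - 1), (sc' / 2), n2'; split=> //.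
  + by split=> //; lia.
  + split=> //; apply: (leq_trans q6); rewrite ck /=.
    have -> : `|l - (l' - 1)%R|%N = (`|l - l'|%N).+1 by lia.
    by move: h3; rewrite mulnS; lia.
- exists g, a, V, l, sc, n; split=> //.
  by split=> //; move: n6; rewrite subrr absz0; lia.
Qed.

Lemma init_rep s : (0 < k)%N -> reg s rNode = VNode (eroot X) ->
  reg s rK = VInt X (Posz k) -> reg s rEps = VReal X eps ->
  wp init (fun s' => exists g V L sc p q,
    [/\ rep s' g 0 V L L sc, size V = 1%N,
        [/\ p \in S, q \in S, p != q & 2 ^ (L - 1) < mdist p q] &
        (clk s' <= clk s + 40)%N]) s.
Proof.
move=> k0 h0 hk he.
have [L [Lt eL [h1 [h2 [t [ec lev1 p1 p2 [p12 d12]]]]]]] := start_nodeP ctT coX (leq_ltn_trans k0 kS).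
do 7!ins; rewrite hk /= PoszS; apply: wp_seq; set s1 := HState _ _ _ _.
have fc s2 v : reg s2 rNode = VNode v ->
    wp first_children (fun s' => [/\ reg s' rH = vhead (VList (echildren v)),
      reg s' rH2 = vhead (vtail (VList (echildren v))) & clk s' = (clk s2 + 4)%N]) s2.
  move=> hv; ins; rewrite hv; ins; ins; ins; apply: wp_skip.
  by split; rewrite /= ?writeE //= -!addnA.
apply: (wp_weaken _ (fc s1 _ h0)) => // s2 [a1 a2 a3] [u1 _ _].
apply: wp_seq; apply: (@wp_mono _ _ _ _ (fun s' =>
  [/\ reg s' rNode = VNode (start_node X), reg s' rH = VNode h1, reg s' rH2 = VNode h2,
      forall r, r \notin [:: rNode; rCh; rH; rH2] -> reg s' r = reg s2 r &
      (clk s' <= clk s2 + 7)%N])); last first.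
  apply: wp_if; rewrite /= a2.
    move: ec; rewrite /start_node.
    case E: (echildren (eroot X)) => [|w [|w' t']] //= ec _; first by rewrite E in ec.
    apply: (@wp_weaken _ _ _ _ (fun s' =>
        [/\ reg s' rNode = VNode w, reg s' rH = VNode h1,
            reg s' rH2 = VNode h2 & clk s' = (clk s2 + 7)%N])) => //.
      ins; rewrite a1 E /=; set s3 := HState _ _ _ _; apply: wp_seq.
      apply: (wp_weaken _ (fc s3 w erefl)) => // s4 [q1 q2 q3] [v1 _ _]; apply: wp_skip.
      by split; rewrite ?q1 ?q2 ?ec ?v1 //= q3 /s3 /=; lia.
    move=> s4 [q1 q2 q3 q4] [v1 _ _]; split=> //; last by rewrite q4.
    move=> r hr; rewrite v1 //=; move: hr; rewrite !inE !negb_or.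
    by case/and4P => -> -> -> ->.
  move=> H; apply: wp_skip; move: ec H a1 a2; rewrite /start_node.
  case E: (echildren (eroot X)) => [|w [|w' t']] //=; rewrite E => -[-> -> _] _ a1 a2.
  by split=> //=; [rewrite u1 | lia].
move=> s3 [b1 b2 b3 b4 b5].
have r1 : reg s3 rOne = VInt X 1 by rewrite b4 // u1.
have r2 : reg s3 rZero = VInt X (Posz 0) by rewrite b4 // u1.
have r3 : reg s3 rTwoR = VReal X 2 by rewrite b4 // u1.
have r4 : reg s3 rOneR = VReal X 1 by rewrite b4 // u1.
have r5 : reg s3 rZeroR = VReal X 0 by rewrite b4 // u1.
have r6 : reg s3 rK1 = VInt X (Posz k.+1) by rewrite b4 // u1.
have r7 : reg s3 rK = VInt X (Posz k) by rewrite b4 // u1.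
have r8 : reg s3 rEps = VReal X eps by rewrite b4 // u1.
do 7!ins; rewrite b2 b3 /= lev1.
apply: wp_st; first exact: r2.
norm; rewrite b1; apply: wp_skip.
have p1S : epoint h1 \in S by apply: (fsubsetP (ct_sub ctT (L - 1))).
have p2S : epoint h2 \in S by apply: (fsubsetP (ct_sub ctT (L - 1))).
have dlow := ct_separation ctT p1 p2 p12.
exists (Rows (fun=> start_node X) (fun=> L) (fun=> 0%N)), [:: start_node X], L.
exists (mdist (epoint h1) (epoint h2) + mdist (epoint h1) (epoint h2)), (epoint h1), (epoint h2).
split=> //; last by rewrite /=; move: a3 b5; rewrite /s1 /=; lia.
split=> //=.
(* The two siblings are more than [2 ^ (L - 1)] and at most [2 ^ (L + 1)] apart, so their doubled
   distance lies in the window of [scale L]. *)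
- have e : (2 : R) ^ L = 2 * 2 ^ (L - 1) by rewrite -pow2S subrK.
  by move: d12; rewrite /scale pow2S e => d12; apply/andP; split; lra.
- have [uV V1 V2] := eL; have [vl _] := V1 _ (mem_head _ _).
  by split=> //=; by [case | case=> [|i] [|j]].
- by split=> [[|i]|].
Qed.

End Levels.

(** * Range search and greedy selection *)

Section Search.
Context {R : realType} {U : metricType R} (T : tree U) (S : {fset U}).
Hypothesis ctT : cover_tree T S.
Context (X : etree U) (coal : int -> U -> enode X).
Hypothesis coX : coalescing T S coal.
Context (k : nat) (eps : R).
Context (g : rows X) (a : nat) (V : seq (enode X)) (l L : int) (sc : R).
Implicit Types (s : hstate X) (tau : R) (c : U) (qs : seq nat).
Local Notation b := (a + size V)%N.
Local Notation rep s := (rep T coal k eps s g a V l L sc).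
Local Notation pt := (rpoint g).

(** An upper estimate of what a search can queue: the actual pruning radius is replaced by its upper
    bound [8 * 2 ^ l], so that the counting does not depend on the stored scale. *)
Definition visited tau c y : bool :=
  (y < b)%N && ((y == 0%N) ||
    (mdist c (pt (rpar g y)) <= tau + 8 * 2 ^ (rlev g (rpar g y)))).

Lemma push_range_spec s t f e :
  reg s rOne = VInt X 1 -> reg s rTl = VInt X (Posz t) ->
  reg s rF = VInt X (Posz f) -> reg s rG = VInt X (Posz e) ->
  wp push_range (fun s' =>
    [/\ reg s' rTl = VInt X (Posz (t + (e - f))),
        forall i, (i < e - f)%N -> arr s' aQueue (t + i) = VInt X (Posz (f + i)),
        forall i, (i < t)%N -> arr s' aQueue i = arr s aQueue i &
        (clk s' <= clk s + 2 + 10 * (e - f))%N]) s.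
Proof.
move=> h1 ht hf he.
apply: (@wp_while _ _ _ (fun n s' => exists m : nat,
  [/\ n = (e - f - m)%N /\ (m <= e - f)%N,
      reg s' rTl = VInt X (Posz (t + m)) /\ reg s' rF = VInt X (Posz (f + m)),
      reg s' rOne = VInt X 1 /\ reg s' rG = VInt X (Posz e),
      forall i, (i < m)%N -> arr s' aQueue (t + i) = VInt X (Posz (f + i)) &
      (forall i, (i < t)%N -> arr s' aQueue i = arr s aQueue i) /\
      (clk s' <= clk s + 10 * m)%N]) _ _ _ (e - f)%N).
- move=> n s' [m [[_ m1] [m2 m3] [m4 m5] m6 [m7 m8]]] /=.
  rewrite orbF m5 m3 /= lez_nat => H; have <- : m = (e - f)%N by lia.
  by split=> //=; lia.
- move=> n s' [m [[nE m1] [m2 m3] [m4 m5] m6 [m7 m8]]] /=.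
  rewrite orbF m5 m3 /= lez_nat => H.
  apply: wp_st; first exact: m2.
  norm; rewrite m3; ins; ins; apply: wp_skip.
  rewrite m2 m3 m4 /= !PoszS; exists (e - f - m.+1)%N; first by lia.
  exists m.+1; norm; rewrite (addnS t) (addnS f); split=> //.
  + by split=> //; lia.
  + move=> i; rewrite ltnS leq_eqVlt => /predU1P[->|im].
      by rewrite (_ : eqn _ _ = true) //; apply/eqP.
    by rewrite ifN ?m6 //; apply/negP => /eqP; lia.
  + split; last by lia.
    by move=> i it; rewrite ifN ?m7 //; apply/negP => /eqP; lia.
- by exists 0%N; rewrite !addn0 subn0; split.
Qed.

Lemma par_dist i : rows_ok T coal g a V l L -> (0 < i < b)%N ->
  mdist (pt i) (pt (rpar g i)) <= 2 ^ (rlev g i + 1).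
Proof.
move=> ok ib; have [p1 p2 p3 p4] := ro_par ok ib.
have ib' : (i < b)%N by case/andP: ib.
have pb : (rpar g i < b)%N by exact: ltn_trans ib'.
have := ro_level ok pb; rewrite p3 => /(level_le_top ctT) lt.
by rewrite -p4; apply: (ct_covering ctT); [lia | apply: (ro_level ok)].
Qed.

(** From a row to its parent the slack [2 ^ (l + 1)] doubles, and the increase pays for the edge
    between them; so nearness propagates up to the root. *)
Lemma near_visited tau c qs : rows_ok T coal g a V l L -> 0%N \in qs ->
  (forall x, (0 < x < b)%N -> rpar g x \in qs ->
    mdist c (pt (rpar g x)) <= tau + 2 ^ (rlev g (rpar g x) + 1) -> x \in qs) ->
  forall y, (y < b)%N -> mdist c (pt y) <= tau + 2 ^ (rlev g y + 1) -> y \in qs.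
Proof.
move=> ok q0 step; elim/ltn_ind => y ih yb near.
have [->//|y0] := posnP y.
have yb' : (0 < y < b)%N by rewrite y0.
have [p1 p2 p3 p4] := ro_par ok yb'.
have near' : mdist c (pt (rpar g y)) <= tau + 2 ^ (rlev g (rpar g y) + 1).
  have := par_dist ok yb'; have := metric_triangle c (pt y) (pt (rpar g y)).
  by rewrite p3 (pow2S (rlev g y + 1)); lra.
by apply: step => //; apply: ih => //; apply: ltn_trans yb.
Qed.

Lemma range_search_spec s N tau c : rep s -> reg s rP = VPoint X c ->
  reg s rTau = VReal X tau ->
  (forall qs, uniq qs -> all (visited tau c) qs -> (size qs <= N)%N) ->
  wp range_search (fun s' =>
    (forall x, (a <= x < b)%N -> arr s' aMark x =
      if mdist c (pt x) <= tau then VReal X tau else arr s aMark x) /\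
    (clk s' <= clk s + 20 + 60 * N)%N) s.
Proof.
move=> rp hp htau hN; have [cs _ _ hA _ _ ok [m1 m2]] := rp.
have h1 := c_one cs; have hz := c_zero cs.
apply: wp_st; first exact: hz.
norm; ins; ins; rewrite hz h1; apply: wp_seq.
(* [qs] lists every row ever queued and its first [h] entries are the visited ones. Distinct entries
   satisfying [visited] number at most [N], which bounds both the variant and the clock. *)
pose Inv := (fun n s' => exists qs h,
  [/\ n = (N - h)%N /\ (h <= size qs)%N,
      reg s' rHd = VInt X (Posz h) /\ reg s' rTl = VInt X (Posz (size qs)),
      (forall r, r \in [:: rOne; rA; rP; rTau] -> reg s' r = reg s r) /\
      (forall d, (d <= 3)%N -> arr s' d = arr s d),
      (forall i, (i < size qs)%N -> arr s' aQueue i = VInt X (Posz (nth 0%N qs i))) /\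
      (forall x, (a <= x < b)%N -> arr s' aMark x =
        if (x \in take h qs) && (mdist c (pt x) <= tau) then VReal X tau else arr s aMark x) &
  [/\ [/\ uniq qs, all (visited tau c) qs & 0%N \in qs],
      forall y, y \in qs -> y != 0%N -> rpar g y \in take h qs,
      forall x, (0 < x < b)%N -> rpar g x \in take h qs ->
        mdist c (pt (rpar g x)) <= tau + 2 ^ (rlev g (rpar g x) + 1) -> x \in qs &
      (clk s' <= clk s + 8 + 50 * h + 10 * (size qs).-1)%N]]).
apply: (@wp_while _ _ _ Inv _ _ _ N).
- move=> n s' [qs [h [[nE hq] [r1 r2] [fr fa] [q1 q2] [[q3 q4 q5] q6 q7 q8]]]] /=.
  rewrite orbF r1 r2 /= lez_nat => H; apply: wp_skip.
  have hE : h = size qs by lia.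
  have qN := hN _ q3 q4.
  split; last by rewrite /=; lia.
  rewrite hE take_size in q2 q7.
  move=> x xab /=; rewrite q2 //; have [d|//] := boolP (mdist _ _ <= _); last by rewrite andbF.
  rewrite andbT (near_visited ok q5 q7) //; first by case/andP: xab.
  by rewrite (le_trans d) // lerDl ltW ?pow2_gt0.
- move=> n s' [qs [h [[nE hq] [r1 r2] [fr fa] [q1 q2] [[q3 q4 q5] q6 q7 q8]]]] /=.
  rewrite orbF r1 r2 /= lez_nat => H.
  have hq' : (h < size qs)%N by lia.
  have qN := hN _ q3 q4.
  have f1 : reg s' rOne = VInt X 1 by rewrite fr.
  have f2 : reg s' rA = VInt X (Posz a) by rewrite fr.
  have f3 : reg s' rP = VPoint X c by rewrite fr.
  have f4 : reg s' rTau = VReal X tau by rewrite fr.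
  set r := nth 0%N qs h.
  have rq : r \in qs by rewrite mem_nth.
  have rb : (r < b)%N by have /allP/(_ _ rq)/andP[] := q4.
  have tS : take h.+1 qs = rcons (take h qs) r by rewrite (take_nth 0%N).
  have rt : r \notin take h qs.
    by have := take_uniq h.+1 q3; rewrite tS rcons_uniq => /andP[].
  apply: wp_ld; first exact: r1.
  norm; rewrite q1 // -/r; ins; apply: wp_ld; first by [].
  norm; rewrite fa // m1 //; ins; ins; rewrite r1 f1 f3 /= PoszS -/(pt r).
  apply: wp_seq; set s1 := HState _ _ _ _.
  have g1 r' : r' \in [:: rOne; rA; rP; rTau] -> reg s1 r' = reg s r'.
    rewrite !inE => /or4P[] /eqP->.
    - exact: (fr rOne isT).
    - exact: (fr rA isT).
    - exact: (fr rP isT).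
    - exact: (fr rTau isT).
  have g2 : reg s1 rA = VInt X (Posz a) by exact: f2.
  have g3 : reg s1 rR = VInt X (Posz r) by [].
  have g4 : reg s1 rTau = VReal X tau by exact: f4.
  have g5 : reg s1 rD = VReal X (mdist c (pt r)) by [].
  have g6 d : (d <= 3)%N -> arr s1 d = arr s d by exact: fa.
  have g7 : arr s1 aQueue = arr s' aQueue by [].
  have g8 : arr s1 aMark = arr s' aMark by [].
  have g9 : clk s1 = (clk s' + 17)%N by rewrite /s1 /=; lia.
  have g10 : reg s1 rHd = VInt X (Posz h.+1) by [].
  have g11 : reg s1 rTl = VInt X (Posz (size qs)) by exact: r2.
  have g12 : reg s1 rOne = VInt X 1 by exact: f1.
  clearbody s1.
  (* [ns] are the rows queued by the visit of [r]: [fin] describes the machine afterwards, [new] the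
     combinatorial facts about [ns]. The branches that queue nothing share [fin0]. *)
  pose fin ns s2 := [/\ reg s2 rHd = VInt X (Posz h.+1) /\
        reg s2 rTl = VInt X (Posz (size qs + size ns)),
      (forall r, r \in [:: rOne; rA; rP; rTau] -> reg s2 r = reg s r) /\
      (forall d, (d <= 3)%N -> arr s2 d = arr s d),
      (forall i, (i < size (qs ++ ns))%N -> arr s2 aQueue i = VInt X (Posz (nth 0%N (qs ++ ns) i))),
      (forall x, (a <= x < b)%N -> arr s2 aMark x =
        if (x \in take h.+1 qs) && (mdist c (pt x) <= tau) then VReal X tau else arr s aMark x) &
      (clk s2 <= clk s1 + 33 + 10 * size ns)%N].
  pose new ns := [/\ uniq (qs ++ ns), all (visited tau c) ns,
      forall y, y \in ns -> rpar g y = r &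
      forall x, (0 < x < b)%N -> rpar g x = r ->
        mdist c (pt r) <= tau + 2 ^ (rlev g r + 1) -> x \in qs ++ ns].
  have fin0 s2 : (forall r, r \in [:: rHd; rTl; rOne; rA; rP; rTau] -> reg s2 r = reg s1 r) ->
      (forall d, (d <= 3)%N -> arr s2 d = arr s1 d) -> arr s2 aQueue = arr s1 aQueue ->
      (forall x, (a <= x < b)%N -> arr s2 aMark x =
        if (x == r) && (mdist c (pt x) <= tau) then VReal X tau else arr s' aMark x) ->
      (clk s2 <= clk s1 + 33)%N -> fin [::] s2.
    move=> e1 e2 e3 e4 e5; split.
    - by rewrite !e1 // addn0.
    - split=> [r' h'|d h']; last by rewrite e2 // g6.
      by rewrite e1 ?g1 // !in_cons; move: h'; rewrite !in_cons => ->; rewrite !orbT.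
    - by move=> i; rewrite cats0 e3 g7 => iq; exact: q1.
    - move=> x xab; rewrite e4 // q2 // tS mem_rcons inE.
      by case: (x == r) => //=; case: (mdist c (pt x) <= tau); rewrite ?andbF.
    - by rewrite muln0 addn0.
  apply: (@wp_mono _ _ _ _ (fun s2 => exists2 ns, fin ns s2 & new ns)).
    move=> s2 [ns [[e1 e2] [e3 e4] e5 e6 e7] [w1 w2 w3 w4]].
    apply: wp_skip; exists (N - h.+1)%N; first by lia.
    exists (qs ++ ns), h.+1; rewrite takel_cat // size_cat; split=> //.
    + by split=> //; lia.
    + by rewrite size_cat in e5.
    split.
    + by rewrite all_cat q4 w2 mem_cat q5.
    + move=> y; rewrite mem_cat tS mem_rcons inE => /orP[/q6 h2 /h2->|/w3->].
        by rewrite orbT.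
      by rewrite eqxx.
    + move=> x xb; rewrite tS mem_rcons inE => /orP[/eqP xr|xt] near.
        by apply: w4 => //; rewrite -xr.
      by rewrite mem_cat (q7 x xb xt near).
    + by move: e7; rewrite g9; lia.
  apply: wp_if; rewrite /= g2 g3 /= lez_nat => Har.
    have new0 : new [::].
      split=> //; first by rewrite cats0.
      move=> x xb xr; have [_ + _ _] := ro_par ok xb; rewrite xr; lia.
    have xr x : x == r -> (a <= x < b)%N -> mdist c (pt x) <= tau = (mdist c (pt r) <= tau).
      by move/eqP->.
    apply: wp_if; rewrite /= g5 g4 /= => Hd.
      exists r; split=> //; exists [::] => //; apply: fin0 => //=.
      - by case=> [|[|[|[|]]]].
      - move=> x xab; rewrite -[eqn x r]/(x == r); case: (eqVneq x r) => [->|_].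
          by rewrite Hd g4.
        by rewrite g8.
      - by rewrite -!addnA !leq_add2l.
    apply: wp_skip; exists [::] => //; apply: fin0 => //=.
    - by move=> x xab; rewrite g8; case: (eqVneq x r) => [->|//]; rewrite (negPf Hd).
    - by rewrite -!addnA !leq_add2l.
  have ra : (r < a)%N by lia.
  (* The lower bound on [rad] makes pruning sound; the upper bound keeps the queued rows within
     [visited]. *)
  have [f [e [rad [n1 n2 n3 /andP[n4 n4'] n5]]]] := m2 _ ra.
  apply: wp_ld; first exact: g3.
  norm; rewrite g6 // n3; ins; rewrite g4 /=; apply: wp_seq.
  apply: wp_if; rewrite /= !writeE /= g5 => Hd; last first.
    apply: wp_skip; apply: wp_skip; exists [::]; last first.
      split=> //; first by rewrite cats0.
      by move=> x xb xr near; case/negP: Hd; apply: le_trans near _; rewrite lerD2l.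
    apply: fin0 => //=.
    - by move=> r'; rewrite !inE; do 5!(case/orP => [/eqP->//|]); move/eqP->.
    - by move=> x xab; rewrite g8; case: (eqVneq x r) => [xr|//]; move: xab; rewrite xr; lia.
    - by rewrite -!addnA !leq_add2l.
  apply: wp_ld; first exact: g3.
  norm; rewrite g6 // n1; apply: wp_ld; first exact: g3.
  norm; rewrite g6 // n2; apply: wp_seq; set s2 := HState _ _ _ _.
  apply: (wp_weaken _ (@push_range_spec s2 (size qs) f e g12 g11 erefl erefl)) => //.
  move=> s3 [t1 t2 t3 t4] [u1 u2 _]; apply: wp_skip; apply: wp_skip.
  have mem_ns y : (y \in iota f (e - f)) = [&& (0 < y)%N, (y < b)%N & rpar g y == r].
    by rewrite mem_iota -n5; clear; apply/idP/idP; lia.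
  exists (iota f (e - f)); last split.
  - split; rewrite ?size_iota //.
    + by rewrite u1.
    + split=> [r'|d h'].
        rewrite !inE => /or4P[] /eqP->; rewrite u1 //.
        * exact: (g1 rOne isT).
        * exact: (g1 rA isT).
        * exact: (g1 rP isT).
        * exact: (g1 rTau isT).
      rewrite u2; first exact: g6.
      by rewrite /= inE; lia.
    + move=> i; rewrite size_cat size_iota => iq; rewrite nth_cat.
      case: ltnP => iqs; first by rewrite t3 // -[LHS]/(arr s1 aQueue i) g7; exact: q1.
      rewrite -{1}(subnKC iqs) t2; last by lia.
      by rewrite nth_iota //; lia.
    + move=> x xab; rewrite u2 // -[LHS]/(arr s1 aMark x) g8 q2 // tS mem_rcons inE.
      by rewrite (_ : (x == r) = false) //; apply/eqP; lia.
    + by move: t4; rewrite /s2 /=; lia.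
  (* If a child of [r] were already queued, its parent [r] would be among the visited rows, but [r]
     is visited only now. *)
  - rewrite cat_uniq q3 iota_uniq andbT /=; apply/hasPn => y; rewrite mem_ns => /and3P[y0 _ /eqP yr].
    by apply/negP => /q6; rewrite -lt0n yr => /(_ y0); apply/negP.
  - apply/allP => y; rewrite mem_ns => /and3P[y0 yb /eqP yr].
    by rewrite /visited yb yr (le_trans Hd) ?orbT // lerD2l.
  - by move=> y; rewrite mem_ns => /and3P[_ _ /eqP].
  - by move=> x /andP[x0 xb] xr _; rewrite mem_cat mem_ns x0 xb xr eqxx orbT.
- have b0 : (0 < b)%N by have := ro_pos ok; lia.
  exists [:: 0%N], 0%N; rewrite subn0 /=; split=> //.
  + split=> [r|]; first by rewrite !inE => /or4P[] /eqP->.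
    by case=> [|[|[|[|]]]].
  + by split=> // -[|i].
  + split=> //; last by lia.
    * by rewrite /visited b0.
    * by move=> y; rewrite inE => /eqP->.
Qed.

End Search.

(** * Greedy selection and the search for the threshold *)

Section Greedy.
Context {R : realType} {U : metricType R} (T : tree U) (S : {fset U}).
Hypothesis ctT : cover_tree T S.
Context (X : etree U) (coal : int -> U -> enode X).
Hypothesis coX : coalescing T S coal.
Context (k : nat) (eps : R).
Context (g : rows X) (a : nat) (V : seq (enode X)) (l L : int) (sc : R).
Implicit Types (s : hstate X) (tau : R) (cs : seq nat).
Local Notation b := (a + size V)%N.
Local Notation rep s := (rep T coal k eps s g a V l L sc).
Local Notation pt := (rpoint g).

Definition centers s cs : Prop :=
  [/\ reg s rCnt = VInt X (Posz (size cs)),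
      forall i, (i < size cs)%N -> arr s aCen i = VPoint X (pt (nth 0%N cs i)),
      uniq cs & forall c, c \in cs -> (a <= c < b)%N].

Definition separated tau cs : Prop :=
  forall x y, x \in cs -> y \in cs -> x != y -> tau < mdist (pt x) (pt y).

Definition covered tau cs (x : nat) : Prop :=
  exists2 c, c \in cs & mdist (pt x) (pt c) <= tau.

Lemma seg_level x : rows_ok T coal g a V l L -> (a <= x < b)%N -> rlev g x = l.
Proof.
move=> ok xab; have xV : (x - a < size V)%N by lia.
by have [_] := ro_seg ok xV; rewrite subnKC //; case/andP: xab.
Qed.

Lemma seg_inj x y : rows_ok T coal g a V l L -> (a <= x < b)%N -> (a <= y < b)%N ->
  pt x = pt y -> x = y.
Proof.
move=> ok xb yb; apply: (ro_inj ok); [by case/andP: xb | by case/andP: yb |].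
by rewrite !seg_level.
Qed.

Lemma covered_sub tau cs x y : covered tau cs x -> covered tau (rcons cs y) x.
Proof. by case=> c cc d; exists c => //; rewrite mem_rcons inE cc orbT. Qed.

Lemma vle_mono (t t' : R) (v : value X) : t <= t' -> vle (VReal X t') v -> vle (VReal X t) v.
Proof. by case: v => //= r tt' h; apply: le_trans h. Qed.

Lemma greedy_spec s N tau : rep s -> reg s rTau = VReal X tau -> 0 <= tau ->
  (forall x, (a <= x < b)%N -> ~~ vle (VReal X tau) (arr s aMark x)) ->
  (0 < tau -> forall (c : U) qs, uniq qs -> all (visited g a V tau c) qs -> (size qs <= N)%N) ->
  wp greedy (fun s' => exists cs,
    [/\ centers s' cs, separated tau cs, (size cs <= k.+1)%N,
        (size cs <= k)%N -> forall x, (a <= x < b)%N -> covered tau cs x &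
        (forall tau', tau < tau' -> forall x, (a <= x < b)%N ->
          ~~ vle (VReal X tau') (arr s' aMark x)) /\
        (clk s' <= clk s + 5 + 40 * size V + (0 < tau)%R * (k.+1 * (20 + 60 * N)))%N]) s.
Proof.
move=> rp htau tau0 unm hN; have [cs0 _ _ hA hB _ ok [m1 _]] := rp.
have hz := c_zero cs0.
ins; ins; rewrite hz hA; apply: wp_seq.
pose Inv n s' := exists i cs,
  [/\ n = (size V - i)%N /\ (i <= size V)%N,
      [/\ reg s' rI = VInt X (Posz (a + i)), reg s' rTau = VReal X tau,
          rep s' & centers s' cs],
      separated tau cs /\ (size cs <= k.+1)%N,
      (forall c, c \in cs -> (c < a + i)%N) /\
      (forall x, (a <= x < a + i)%N -> covered tau cs x) &
  [/\ forall x, (a <= x < b)%N -> vle (VReal X tau) (arr s' aMark x) -> covered tau cs x,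
      0 < tau -> forall c x, c \in cs -> (a <= x < b)%N -> mdist (pt c) (pt x) <= tau ->
        vle (VReal X tau) (arr s' aMark x),
      forall x, (a <= x < b)%N -> arr s' aMark x = VReal X tau \/ arr s' aMark x = arr s aMark x &
      (clk s' <= clk s + 2 + 40 * i + (0 < tau)%R * (size cs * (20 + 60 * N)))%N]].
apply: (@wp_while _ _ _ Inv _ _ _ (size V)).
- move=> n s' [i [cs [[nE iV] [r1 r2 r3 r4] [r5 r6] [r7 r8] [q1 q2 q3 q4]]]] /=.
  have [cs1 _ _ hA' hB' _ _ _] := r3; have [t1 t2 t3 t4] := r4.
  rewrite orbF r1 hB' t1 (c_k1 cs1) /= !lez_nat => H; apply: wp_skip.
  exists cs; split=> //.
    move=> ck x xab; apply: r8; have -> : i = size V by move: H ck iV; clear; lia.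
    by [].
  split.
    move=> tau' tt' x xab /=; have [->|->] := q3 _ xab; first by rewrite /= -ltNge.
    by apply: contra (unm _ xab); apply: vle_mono; apply: ltW.
  move: q4 r6 iV => /=; clear; case: (0 < tau) => /=; nia.
- move=> n s' [i [cs [[nE iV] [r1 r2 r3 r4] [r5 r6] [r7 r8] [q1 q2 q3 q4]]]] /=.
  have [cs1 _ _ hA' hB' _ _ [m1' _]] := r3; have [t1 t2 t3 t4] := r4.
  rewrite orbF r1 hB' t1 (c_k1 cs1) /= !lez_nat => H.
  have iV' : (i < size V)%N by move: H; clear; lia.
  have ck : (size cs <= k)%N by move: H; clear; lia.
  have xab : (a <= a + i < b)%N by rewrite leq_addr ltn_add2l.
  apply: wp_ld; first exact: r1.
  norm; apply: wp_seq; set s1 := HState _ _ _ _.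
  have g1 : reg s1 rI = VInt X (Posz (a + i)) by [].
  have g2 : reg s1 rTau = VReal X tau by [].
  have g3 : rep s1 by apply: rep_same r3 => // r; rewrite !inE => h;
    rewrite /= writeE ifN //; apply: contraL h => /eqP->.
  have g4 : reg s1 rCnt = VInt X (Posz (size cs)) by [].
  have g5 : arr s1 = arr s' by [].
  have g6 : clk s1 = (clk s' + 9)%N by rewrite /s1 /=; clear; lia.
  have g7 : reg s1 rM = arr s' aMark (a + i) by [].
  clearbody s1.
  pose done s2 cs' := [/\ [/\ reg s2 rI = VInt X (Posz (a + i)), reg s2 rTau = VReal X tau,
          rep s2 & centers s2 cs'],
      separated tau cs' /\ (size cs' <= k.+1)%N,
      (forall c, c \in cs' -> (c < a + i.+1)%N) /\
      (forall x, (a <= x < a + i.+1)%N -> covered tau cs' x) &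
  [/\ forall x, (a <= x < b)%N -> vle (VReal X tau) (arr s2 aMark x) -> covered tau cs' x,
      0 < tau -> forall c x, c \in cs' -> (a <= x < b)%N -> mdist (pt c) (pt x) <= tau ->
        vle (VReal X tau) (arr s2 aMark x),
      forall x, (a <= x < b)%N -> arr s2 aMark x = VReal X tau \/ arr s2 aMark x = arr s aMark x &
      (clk s2 <= clk s' + 39 + (0 < tau)%R * ((size cs' - size cs) * (20 + 60 * N)))%N] /\
      (size cs <= size cs')%N].
  apply: (@wp_mono _ _ _ _ (fun s2 => exists cs', done s2 cs')).
    move=> s2 [cs' [[d1 d2 d3 d4] [d5 d6] [d7 d8] [[d9 d10 d11 d12] d13]]].
    have h1 : reg s2 rOne = VInt X 1 by exact: (c_one (rp_consts d3)).
    ins; rewrite d1 h1 /= PoszS; apply: wp_skip.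
    exists (size V - i.+1)%N; first by rewrite nE; move: iV'; clear; lia.
    exists i.+1, cs'; split=> //=.
    - split=> //; first by norm; rewrite addnS.
      by apply: rep_same d3 => // r; rewrite !inE => h;
        rewrite /= writeE ifN //; apply: contraL h => /eqP->.
    - split=> //; move: d12 d13 q4; clear; case: (0 < tau) => /=; nia.
  have r8' cs' : {subset cs <= cs'} -> covered tau cs' (a + i) ->
      forall x, (a <= x < a + i.+1)%N -> covered tau cs' x.
    move=> sub cx x /andP[ax]; rewrite addnS ltnS leq_eqVlt => /predU1P[->//|xi].
    by have [|c cc d] := r8 x; [rewrite ax | exists c => //; apply: sub].
  have r7' c : c \in cs -> (c < a + i.+1)%N by move/r7 => h; rewrite addnS ltnS ltnW.
  apply: wp_if; rewrite /= g2 g7 => Hm.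
    apply: wp_skip; exists cs; split=> //=; try by rewrite g5.
    + by split=> //; [apply: rep_same g3 | split=> //=; rewrite ?g5].
    + by split=> //; apply: r8' => //; apply: q1.
    split=> //; split=> //=; rewrite ?g5 //.
    by rewrite g6 subnn mul0n muln0; clear; lia.
  (* For positive [tau] an unmarked row is far from all centers. For [tau = 0] no search has run,
     and separation is just the distinctness of the points of a level. *)
  have sep_new c : c \in cs -> tau < mdist (pt c) (pt (a + i)).
    move=> cc; have [tp|tn] := ltP 0 tau.
      by rewrite ltNge; apply: contra Hm; apply: q2.
    apply: (le_lt_trans tn); rewrite mdist_gt0; apply/negP => /eqP e.
    have cab : (a <= c < b)%N by apply: t4.
    by have := r7 _ cc; rewrite (seg_inj ok cab xab e) ltnn.
  have sep' : separated tau (rcons cs (a + i)%N).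
    move=> x y; rewrite !mem_rcons !inE => /predU1P[->|xc] /predU1P[->|yc].
    - by rewrite eqxx.
    - by rewrite metric_sym => _; apply: sep_new.
    - by move=> _; apply: sep_new.
    - exact: r5.
  have uniq' : uniq (rcons cs (a + i)%N).
    by rewrite rcons_uniq t3 andbT; apply/negP => /r7; rewrite ltnn.
  have in' c : c \in rcons cs (a + i)%N -> (a <= c < b)%N.
    by rewrite mem_rcons inE => /predU1P[->|/t4].
  have lt' c : c \in rcons cs (a + i)%N -> (c < a + i.+1)%N.
    by rewrite mem_rcons inE => /predU1P[->|/r7' //]; rewrite addnS.
  have sub' : {subset cs <= rcons cs (a + i)%N} by move=> c cc; rewrite mem_rcons inE cc orbT.
  have cov' : covered tau (rcons cs (a + i)%N) (a + i).
    by exists (a + i)%N; rewrite ?mem_rcons ?mem_head // mdistxx.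
  have h1 : reg s1 rOne = VInt X 1 by exact: (c_one (rp_consts g3)).
  have hzr : reg s1 rZeroR = VReal X 0 by exact: (c_zeroR (rp_consts g3)).
  apply: wp_ld; first exact: g1.
  norm; rewrite g5 m1' ?ltn_add2l //; ins; rewrite -/(pt (a + i)).
  apply: wp_st; first exact: g4.
  norm; ins; rewrite g4 h1 /= PoszS; apply: wp_seq; set s2 := HState _ _ _ _.
  have k1 : reg s2 rI = VInt X (Posz (a + i)) by exact: g1.
  have k2 : reg s2 rTau = VReal X tau by exact: g2.
  have k3 : rep s2.
    apply: rep_same g3 => [r|[|[|[|[|//]]]]] //; last first.
    - by rewrite g5.
    - by rewrite g5.
    - by rewrite g5.
    - by rewrite g5.
    rewrite !inE => h; rewrite /= !writeE !ifN //; apply: contraL h => /eqP-> //.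
  have k4 : centers s2 (rcons cs (a + i)%N).
    split=> //; rewrite size_rcons //.
    move=> j; rewrite ltnS leq_eqVlt => /predU1P[->|jc] /=.
      by rewrite (_ : eqn _ _ = true) /=; [rewrite nth_rcons ltnn eqxx | apply/eqP].
    rewrite ifN; last by apply/negP => /eqP; move: jc; clear; lia.
    by rewrite t2 // nth_rcons jc.
  have k5 : arr s2 aMark = arr s' aMark by [].
  have k6 : clk s2 = (clk s' + 25)%N by rewrite /s2 /= g6; clear; lia.
  have k7 : reg s2 rZeroR = VReal X 0 by exact: hzr.
  have k8 : reg s2 rP = VPoint X (pt (a + i)) by [].
  clearbody s2.
  apply: wp_if; rewrite /= k2 k7 /= => Ht.
    do 2 apply: wp_skip; exists (rcons cs (a + i)%N); split.
    + by split=> //; apply: rep_same k3.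
    + by rewrite size_rcons.
    + by split=> //; apply: r8'.
    split; last by rewrite size_rcons.
    split=> /=; rewrite ?k5 //.
    - by move=> x xb /(q1 _ xb); apply: covered_sub.
    - by rewrite ltNge Ht.
    - by rewrite k6 ltNge Ht mul0n addn0; clear; lia.
  have tp : 0 < tau by rewrite ltNge.
  have k3' : rep (tick 2 s2) by apply: rep_same k3.
  have hr := range_search_spec ctT k3' k8 k2 (hN tp (pt (a + i))).
  apply: (wp_weaken _ hr) => // s3 [v1 v2] [u1 u2 _]; do 1 apply: wp_skip.
  have v1' x : (a <= x < b)%N -> arr s3 aMark x =
      if mdist (pt (a + i)) (pt x) <= tau then VReal X tau else arr s' aMark x.
    by move=> xb; rewrite v1 // -k5.
  exists (rcons cs (a + i)%N); split.
  + split; [by rewrite u1 | by rewrite u1 | |].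
      apply: rep_same k3 => [r|d] h; first by rewrite u1 //; move: h; rewrite !inE;
        do 11!(case/orP => [/eqP->//|]); move/eqP->.
      by rewrite u2 //= !inE; move: h; clear; lia.
    case: k4 => z1 z2 z3 z4; split=> //; first by rewrite u1.
    by move=> j jc; rewrite u2 // -z2.
  + by rewrite size_rcons.
  + by split=> //; apply: r8'.
  split; last by rewrite size_rcons.
  split.
  + move=> x xb; rewrite v1' //; case: ifP => [d _|_ /(q1 _ xb)]; last exact: covered_sub.
    by exists (a + i)%N; rewrite ?mem_rcons ?mem_head // metric_sym.
  + move=> _ c x cc xb d; move: cc; rewrite mem_rcons inE v1' // => /predU1P[e|cc].
      by rewrite -e d /=.
    by case: ifP => //= _; apply: (q2 tp c).
  + by move=> x xb; rewrite v1' //; case: ifP => _; [left | apply: q3].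
  + by move: v2; rewrite /= k6 tp size_rcons; clear; lia.
- exists 0%N, [::]; rewrite addn0 subn0; split=> //.
  + split=> //; apply: rep_same rp => // r; rewrite !inE => h.
    by norm; rewrite !ifN //; apply: contraL h => /eqP->.
  + by split=> // x; move=> /andP[h1 h2]; move: h1 h2; clear; lia.
  split=> //=.
  - by move=> x xb h; case/negP: (unm _ xb).
  - by move=> x xb; right.
  - by rewrite mul0n !muln0; clear; lia.
Qed.

Lemma size_centers s cs : centers s cs -> (size cs <= size V)%N.
Proof.
case=> _ _ u h; rewrite -(size_iota a (size V)); apply: uniq_leq_size => // c /h.
by rewrite mem_iota.
Qed.

(** A new round starts only after one that selected more than [k] centers, so [N] need only bound
    searches with thresholds up to [2 * ropt + sc]. The factor [k < size V] records that with at
    most [k] rows the first round is the last. *)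
Lemma search_spec s N G (ropt : R) : rep s -> 0 <= ropt ->
  (forall x, (a <= x < b)%N -> arr s aMark x = VNil X) ->
  (forall (ps : seq U) d, uniq ps -> {subset ps <= S} -> (k < size ps)%N ->
    (forall x y, x \in ps -> y \in ps -> x != y -> d < mdist x y) -> d <= 2 * ropt) ->
  2 * ropt < G%:R * sc ->
  (forall tau c qs, 0 < tau -> tau <= 2 * ropt + sc -> uniq qs ->
    all (visited g a V tau c) qs -> (size qs <= N)%N) ->
  wp search (fun s' => exists cs tau,
    [/\ consts k eps s', centers s' cs, (size cs <= k)%N, 0 <= tau <= 2 * ropt + sc &
        (forall x, (a <= x < b)%N -> covered tau cs x) /\
        (clk s' <= clk s + 10 + 40 * size V +
          (k < size V)%N * (G * (8 + 40 * size V + k.+1 * (20 + 60 * N))))%N]) s.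
Proof.
move=> rp ropt0 unm hopt hG hN.
have [cs0 _ hS _ _ sl ok _] := rp.
have sc0 : 0 < sc by case/andP: sl => h _; apply: lt_trans h; apply: pow2_gt0.
ins; rewrite (c_zeroR cs0); apply: wp_seq; set s1 := HState _ _ _ _.
have rp1 : rep s1 by apply: rep_same rp => // r; rewrite !inE => h;
  rewrite /= writeE ifN //; apply: contraL h => /eqP->.
have rep_greedy s2 s3 : rep s2 -> unchanged greedy s2 s3 -> rep s3.
  move=> rp2 [u1 u2 _]; apply: rep_same rp2 => [r|d] h; last first.
    by rewrite u2 //=; move: h; case: d => [|[|[|[|]]]].
  by rewrite u1 //; move: h; rewrite !inE; do 11!(case/orP => [/eqP->//|]); move/eqP->.
have unm1 x : (a <= x < b)%N -> ~~ vle (VReal X 0) (arr s1 aMark x) by move=> xb; rewrite /= unm.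
have N0 : (0 : R) < 0 -> forall (c : U) qs, uniq qs ->
  all (visited g a V 0 c) qs -> (size qs <= N)%N by rewrite ltxx.
have gr1 := greedy_spec rp1 (erefl : reg s1 rTau = VReal X 0) (lexx 0) unm1 N0.
apply: (wp_weaken _ gr1) => // s2 [cs [p1 p2 p3 p4 [p5 p6]]] un.
have rp2 := rep_greedy _ _ rp1 un.
have t2 : reg s2 rTau = VReal X 0 by case: un => u1 _ _; rewrite u1.
rewrite ltxx mul0n addn0 in p6.
apply: wp_seq.
pose Inv n s' := exists gq cs,
  [/\ n = (G - gq)%N, rep s' /\ reg s' rTau = VReal X (gq%:R * sc),
      [/\ centers s' cs, separated (gq%:R * sc) cs, (size cs <= k.+1)%N &
        (size cs <= k)%N -> forall x, (a <= x < b)%N -> covered (gq%:R * sc) cs x],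
      forall tau', gq%:R * sc < tau' -> forall x, (a <= x < b)%N ->
          ~~ vle (VReal X tau') (arr s' aMark x) &
      [/\ (gq <= G)%N, gq%:R * sc <= 2 * ropt + sc, (0 < gq)%N -> (k < size V)%N &
      (clk s' <= clk s + 8 + 40 * size V + gq * (8 + 40 * size V + k.+1 * (20 + 60 * N)))%N]].
apply: (@wp_while _ _ _ Inv _ _ _ G).
- move=> n s' [gq [cs' [_ [rp' ht'] [d1 d2 d3 d4] d5 [d6 d7 d8 d9]]]] /=.
  rewrite orbF (c_k (rp_consts rp')); have [e1 _ _ _] := d1; rewrite e1 /= lez_nat => H.
  apply: wp_skip; exists cs', (gq%:R * sc); split=> //.
  + by case: (rp_consts rp').
  + by rewrite d7 mulr_ge0 ?ler0n // ltW.
  + split; first exact: d4.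
    move: d6 d8 d9 => /=; clear.
    set P := (8 + _ + _ * _)%N => d6 d8 d9; have [gq0|gq0] := posnP gq.
      by rewrite gq0 mul0n in d9; move: d9; clear; lia.
    have h : (gq * P <= G * P)%N by rewrite leq_mul2r d6 orbT.
    by rewrite d8 // mul1n; lia.
- move=> n s' [gq [cs' [nE [rp' ht'] [d1 d2 d3 d4] d5 [d6 d7 d8 d9]]]] /=.
  rewrite orbF (c_k (rp_consts rp')); have [e1 e2 e3 e4] := d1; rewrite e1 /= lez_nat -ltnNge => H.
  have kV : (k < size V)%N by apply: leq_trans H (size_centers d1).
  have inj_pt : {in cs' &, injective pt} by move=> x y /e4 xb /e4 yb; apply: seg_inj.
  have tle : gq%:R * sc <= 2 * ropt.
    apply: (hopt (map pt cs')).
    - by rewrite map_inj_in_uniq.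
    - move=> p /mapP[c /e4 /andP[_ cb] ->].
      exact: (fsubsetP (ct_sub ctT _) _ (ro_level ok cb)).
    - by rewrite size_map.
    - move=> x y /mapP[x' x'c ->] /mapP[y' y'c ->] ne; apply: d2 => //.
      by apply: contraNneq ne => ->.
  have gG : (gq < G)%N.
    by rewrite -(ltr_nat R) -(ltr_pM2r sc0); apply: le_lt_trans tle hG.
  ins; rewrite ht' (rp_S rp') /= (_ : gq%:R * sc + sc = gq.+1%:R * sc); last by rewrite -natr1 mulrDl mul1r.
  apply: wp_seq; set s3 := HState _ _ _ _.
  have rp3 : rep s3 by apply: rep_same rp' => // r; rewrite !inE => h;
    rewrite /= writeE ifN //; apply: contraL h => /eqP->.
  have tpos : 0 < gq.+1%:R * sc by rewrite mulr_gt0 // ltr0n.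
  have tle' : gq.+1%:R * sc <= 2 * ropt + sc by rewrite -natr1 mulrDl mul1r lerD2r.
  have unm3 x : (a <= x < b)%N -> ~~ vle (VReal X (gq.+1%:R * sc)) (arr s3 aMark x).
    by move=> xb; apply: d5 => //; rewrite ltr_pM2r // ltr_nat.
  have gr3 := greedy_spec rp3 (erefl : reg s3 rTau = VReal X (gq.+1%:R * sc)) (ltW tpos) unm3
    (fun tp c qs => @hN _ c qs tp tle').
  apply: (wp_weaken _ gr3) => // s4 [cs4 [f1 f2 f3 f4 [f5 f6]]] un4.
  apply: wp_skip; exists (G - gq.+1)%N; first by rewrite nE; move: gG; clear; lia.
  exists gq.+1, cs4; split=> //.
  + split; first exact: rep_greedy un4.
    by case: un4 => u1 _ _; rewrite u1.
  + split=> //; move: f6 d9; rewrite tpos /s3 /= (mulSn gq) mul1n; clear.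
    by move: (k.+1 * (20 + _))%N => P; move: (gq * _)%N => P'; lia.
- exists 0%N, cs; rewrite subn0 mul0r; split=> //; split=> //.
  + by rewrite addr_ge0 ?mulr_ge0 // ltW.
  + by move: p6; rewrite /s1 /=; clear; lia.
Qed.

Lemma print_centers_spec s cs : consts k eps s -> centers s cs ->
  wp print_centers (fun s' => hout s' = hout s ++ map pt cs /\
    (clk s' <= clk s + 5 + 10 * size cs)%N) s.
Proof.
move=> cst [r1 r2 _ _]; ins; rewrite (c_zero cst); apply: wp_seq.
apply: (@wp_while _ _ _ (fun n s' => exists i,
  [/\ n = (size cs - i)%N /\ (i <= size cs)%N,
      [/\ reg s' rI = VInt X (Posz i), reg s' rOne = VInt X 1 &
          reg s' rCnt = VInt X (Posz (size cs))],
      arr s' aCen = arr s aCen, hout s' = hout s ++ map pt (take i cs) &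
      (clk s' <= clk s + 1 + 10 * i)%N]) _ _ _ (size cs)).
- move=> n s' [i [[_ ic] [e1 _ e3] _ e4 e5]] /=; rewrite orbF e1 e3 /= lez_nat => H.
  have iE : i = size cs by apply/eqP; rewrite eqn_leq ic H.
  apply: wp_skip => /=; rewrite e4 iE take_size; split=> //.
  by move: e5; rewrite iE; clear; lia.
- move=> n s' [i [[nE ic] [e1 e2 e3] ea e4 e5]] /=; rewrite orbF e1 e3 /= lez_nat -ltnNge => H.
  apply: wp_ld; first exact: e1.
  norm; rewrite ea r2 //; ins; ins; rewrite e1 e2 /= PoszS; apply: wp_skip.
  exists (size cs - i.+1)%N; first by rewrite nE; move: H; clear; lia.
  exists i.+1; split=> //=; last by move: e5; clear; lia.
  by rewrite (take_nth 0%N) // map_rcons -rcons_cat e4.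
- exists 0%N; rewrite subn0 take0 cats0; split=> //=; last by rewrite muln0 addn0.
  by split=> //; case: cst.
Qed.

End Greedy.

(** * Counting visited rows *)

Section Counting.
Context {R : realType} {U : metricType R} (T : tree U) (S : {fset U}).
Hypothesis ctT : cover_tree T S.
Context (X : etree U) (coal : int -> U -> enode X).
Context (D : R).
Hypothesis dD : doubling U D.
Local Notation B := (2 `^ D : R).

Lemma size_cover (A C : eqType) (s : seq A) (c : seq C) (f : C -> pred A) (M : R) :
  uniq s -> (forall x, x \in s -> exists2 y, y \in c & f y x) ->
  (forall y, y \in c -> (size (seq.filter (f y) s))%:R <= M) ->
  (size s)%:R <= (size c)%:R * M.
Proof.
move=> us cov bnd; apply: (@le_trans _ _ (size (flatten [seq seq.filter (f y) s | y <- c]))%:R).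
  rewrite ler_nat; apply: uniq_leq_size => // x xs; have [y yc fyx] := cov x xs.
  by apply/flatten_mapP; exists y => //; rewrite mem_filter fyx.
elim: c bnd {cov} => [|y c ih] bnd /=; first by rewrite mul0r.
rewrite size_cat natrD -natr1 mulrDl mul1r addrC lerD //; last by apply: bnd; rewrite mem_head.
by apply: ih => z zc; apply: bnd; rewrite inE zc orbT.
Qed.

(** Packing around each node of level [l], with radius [2 ^ (l + 1)] and separation [2 ^ (l - j)]:
    the doubled radius exceeds the separation by [2 ^ (j + 2)]. *)
Lemma level_card l (j : nat) : l <= top_level T ->
  #|` level T (l - j%:Z)|%:R <= #|` level T l|%:R * B ^+ (j + 2).
Proof.
move=> lt.
apply: (size_cover (f := fun p q => mdist p q <= 2 ^ (l + 1))); first exact: fset_uniq.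
  move=> q ql; have ll : l - j%:Z <= l by lia.
  have [p pl d] := level_cover ctT ll lt ql.
  exists p => //; rewrite metric_sym (le_trans d) // gerBl ltW ?pow2_gt0 //.
move=> p pl; apply: (packing (p := p) (r := 2 ^ (l + 1)) (d := 2 ^ (l - j%:Z)) dD).
- by rewrite filter_uniq // fset_uniq.
- by move=> x y; rewrite !mem_filter => /andP[_ xl] /andP[_ yl]; apply: (ct_separation ctT).
- by move=> x; rewrite mem_filter => /andP[].
- rewrite -pow2S exprnP -pow2D le_eqVlt; apply/orP; left; apply/eqP; congr (_ ^ _).
  by rewrite PoszD; lia.
Qed.

Hypothesis D2 : 2 <= 2 `^ D :> R.

(** As the base is at least 2, each class is allowed at least twice the size of the one before, so
    the last one accounts for half of the bound. *)
Lemma size_cover_geometric (A : eqType) (s : seq A) (f : A -> nat) (i j : nat) :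
  uniq s -> (forall x, x \in s -> (f x <= j)%N) ->
  (forall t, (size (seq.filter (fun x => f x == t) s))%:R <= B ^+ (t + i)) ->
  (size s)%:R <= 2 * B ^+ (j + i).
Proof.
have B0 n : 0 <= B ^+ n by rewrite exprn_ge0 // powR_ge0.
elim: j s => [|j ih] s us fj bnd.
  have -> : s = seq.filter (fun x => f x == 0%N) s.
    by symmetry; apply/all_filterP/allP => x /fj; rewrite leqn0.
  by apply: le_trans (bnd 0%N) _; have := B0 (0 + i)%N; lra.
rewrite -(count_predC (fun x => f x == j.+1) s) -!size_filter natrD.
have h1 := bnd j.+1.
have h2 : (size (seq.filter (predC (fun x => f x == j.+1)) s))%:R <= 2 * B ^+ (j + i).
  apply: ih; first exact: filter_uniq.
    by move=> x; rewrite mem_filter /= => /andP[ne /fj]; lia.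
  move=> t; apply: le_trans (bnd t); rewrite ler_nat -filter_predI.
  by apply: uniq_leq_size => [|x]; rewrite ?filter_uniq // !mem_filter /= => /andP[/andP[-> _] ->].
have h3 : 2 * B ^+ (j + i) <= B ^+ (j.+1 + i) by rewrite addSn exprS ler_wpM2r.
by lra.
Qed.

Context (g : rows X) (a : nat) (V : seq (enode X)) (l L : int).
Hypothesis ok : rows_ok T coal g a V l L.

(** A visited row of level [v] has its parent within [tau + 8 * 2 ^ (v + 1)] of [c] and lies within
    [2 ^ (v + 1)] of it, whence the 18. Level [L] holds row 0 only, to which this does not apply. *)
Lemma visited_level tau c qs v (i : nat) : uniq qs -> all (visited g a V tau c) qs ->
  2 * (tau + 18 * 2 ^ v) <= 2 ^ v * 2 ^+ i ->
  (size (seq.filter (fun y => rlev g y == v) qs))%:R <= B ^+ i :> R.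
Proof.
move=> uq vq hv.
have B1 n : 1 <= B ^+ n by rewrite exprn_ege1 //; apply: le_trans D2; lra.
have lt0 y : (0 < y < a + size V)%N -> rlev g y < L.
  move=> yb; have [_ pa e _] := ro_par ok yb; have := ro_old ok pa; rewrite e; lia.
have yb y : y \in qs -> (y < a + size V)%N by move/(allP vq)/andP => [].
have [vL|vL] := eqVneq v L.
  apply: le_trans (B1 i); rewrite lern1.
  apply: (@uniq_leq_size _ _ [:: 0%N]); first exact: filter_uniq.
  move=> y; rewrite mem_filter inE vL => /andP[/eqP ly /yb yq].
  rewrite -leqn0 leqNgt; apply/negP => y0.
  have yb' : (0 < y < a + size V)%N by rewrite y0.
  by have := lt0 _ yb'; rewrite ly ltxx.
set s := seq.filter _ qs.
have sP y : y \in s -> [/\ (0 < y < a + size V)%N, rlev g y = v & visited g a V tau c y].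
  rewrite mem_filter => /andP[/eqP ly yq]; split=> //; last exact: (allP vq).
  rewrite yb // andbT lt0n; apply: contra vL => /eqP y0.
  by rewrite -ly y0 (ro_root ok).
rewrite -(size_map (rpoint g)).
apply: (packing (p := c) (r := tau + 18 * 2 ^ v) (d := 2 ^ v) dD) => //.
- rewrite map_inj_in_uniq ?filter_uniq // => x y /sP[/andP[_ xb] lx _] /sP[/andP[_ yb'] ly _].
  by apply: (ro_inj ok) => //; rewrite lx ly.
- move=> x y /mapP[x' /sP[/andP[_ xb] lx _] ->] /mapP[y' /sP[/andP[_ yb'] ly _] ->].
  by apply: (ct_separation ctT); [rewrite -lx | rewrite -ly]; apply: (ro_level ok).
- move=> p /mapP[y /sP[ylt ly vy] ->].
  have [_ _ le_ _] := ro_par ok ylt.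
  move: vy => /andP[_]; rewrite (_ : (y == 0%N) = false) /=; last by apply/negbTE; rewrite -lt0n; case/andP: ylt.
  have := par_dist ctT ok ylt; have := metric_triangle c (rpoint g (rpar g y)) (rpoint g y).
  by rewrite le_ ly pow2S (metric_sym (rpoint g y)); lra.
Qed.

(** The exponent 6 comes from [2 * (8 + 18) = 52 <= 2 ^ 6]. The levels above [m] contribute equal
    terms; the geometric sum from [m] down to [l] gives the additional 2. *)
Lemma visited_count tau c qs m (j : nat) : l = m - j%:Z -> m <= L ->
  uniq qs -> all (visited g a V tau c) qs -> tau <= 8 * 2 ^ m ->
  (size qs)%:R <= (`|L - m|%N + 2)%:R * B ^+ (j + 6) :> R.
Proof.
move=> lm mL uq vq htau.
have B0 n : 0 <= B ^+ n by rewrite exprn_ge0 // powR_ge0.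
have B1 : 1 <= B by apply: le_trans D2; lra.
have lev y : y \in qs -> l <= rlev g y <= L.
  move/(allP vq)/andP => [yb _]; have [ya|ay] := ltnP y a.
    by have := ro_old ok ya; lia.
  have yV : (y - a < size V)%N by lia.
  by have [_] := ro_seg ok yV; rewrite subnKC // => ->; have [] := ro_top ok; lia.
rewrite -(count_predC (fun y => m < rlev g y) qs) -!size_filter !natrD mulrDl lerD //.
  set s := seq.filter _ qs.
  rewrite -(size_iota 0 `|L - m|%N).
  apply: (size_cover (f := fun i y => rlev g y == L - i%:Z)); first exact: filter_uniq.
    move=> y; rewrite mem_filter => /andP[my /lev ly].
    by exists `|L - rlev g y|%N; [rewrite mem_iota; lia | apply/eqP; lia].
  move=> i; rewrite mem_iota => ilt.
  apply: (@le_trans _ _ (B ^+ 6)); last by rewrite ler_weXn2l // leq_addl.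
  apply: (visited_level (tau := tau) (c := c)); first exact: filter_uniq.
    by apply/allP => y; rewrite mem_filter => /andP[_ /(allP vq)].
  have h : (2 : R) ^ m <= 2 ^ (L - i%:Z) by rewrite ler_weXz2l ?ler1n //; lia.
  by have := @pow2_gt0 R m; lra.
apply: (size_cover_geometric (f := fun y => `|m - rlev g y|%N)); first exact: filter_uniq.
  by move=> y; rewrite mem_filter /= -leNgt => /andP[my /lev]; lia.
move=> t; apply: (@le_trans _ _ (size (seq.filter (fun y => rlev g y == m - t%:Z) qs))%:R).
  rewrite ler_nat -filter_predI; apply: uniq_leq_size => [|y]; first exact: filter_uniq.
  rewrite !mem_filter /= -leNgt => /andP[/andP[/eqP e my] ->]; rewrite andbT; apply/eqP; lia.
apply: (visited_level (tau := tau) (c := c)) => //.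
have e : (2 : R) ^ m = 2 ^ (m - t%:Z) * 2 ^+ t by rewrite exprnP -pow2D subrK.
have p0 := @pow2_gt0 R (m - t%:Z).
have t1 : (1 : R) <= 2 ^+ t by rewrite exprn_ege1 // ler1n.
rewrite exprD mulrA -e; have : (2 : R) ^ (m - t%:Z) <= 2 ^ m by rewrite e ler_peMr // ltW.
by have := @pow2_gt0 R m; lra.
Qed.

End Counting.

(** * The theorem *)

Section TimeBound.
Context {R : realType}.
Implicit Types (k n t M N P eps D Delta : R).

(** The case [j = 0], free of any power of [2 ^ D]. Here and in [fine_work] the real [n] is the
    number of levels down to [m] plus 2. *)
Lemma coarse_work k n M : 1 <= k -> 2 <= n -> M <= k ->
  59 + 80 * (k + 1) * (n - 1) + 40 * M + 10 * k <= 1200 * (k * n).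
Proof.
move=> k1 n2 Mk; have h : 0 <= (k - 1) * (n - 2) by rewrite mulr_ge0 ?subr_ge0.
lra.
Qed.

(** [t] stands for [2 ^ j], [P] for the power [j + 6] of [2 ^ D], [M] for the rows of the last level
    and [N] for those of one search. Every product that occurs is dominated by [k * n * t * P], and
    1200 exceeds the sum of the coefficients. *)
Lemma fine_work k n (j : R) t M N P : 1 <= k -> 2 <= n -> 0 <= j <= t -> 1 <= t -> 1 <= P ->
  0 <= M <= k * P -> 0 <= N <= n * P ->
  59 + 80 * (k + 1) * (n - 1) + j * (48 * M + 13) + 40 * M +
  4 * t * (8 + 40 * M + (k + 1) * (20 + 60 * N)) + 10 * k <= 1200 * (k * n * t * P).
Proof.
move=> k1 n2 /andP[j0 jt] t1 P1 /andP[M0 MkP] /andP[N0 NnP].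
have n1 : 1 <= n by lra.
have ge1 (x y : R) : 1 <= x -> 1 <= y -> 1 <= x * y.
  by move=> x1 y1; rewrite -[1]mulr1 ler_pM.
have ler_mul1 (x y : R) : 1 <= y -> 0 <= x -> x <= x * y by move=> y1 x0; rewrite ler_peMr.
have tP := ge1 _ _ t1 P1; have kn := ge1 _ _ k1 n1.
set Q := k * n * t * P.
have Q1 : k * n <= Q by rewrite /Q -mulrA ler_mul1 // mulr_ge0; lra.
have Q2 : t * M <= Q.
  apply: (@le_trans _ _ (t * (k * P))); first by rewrite ler_wpM2l //; lra.
  rewrite /Q (_ : k * n * t * P = t * (k * P) * n); last by ring.
  by rewrite ler_mul1 // !mulr_ge0; lra.
have Q3 : t * k <= Q.
  rewrite /Q (_ : k * n * t * P = t * k * (n * P)); last by ring.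
  by rewrite ler_mul1 ?ge1 // mulr_ge0; lra.
have Q4 : t * k * N <= Q.
  apply: (@le_trans _ _ (t * k * (n * P))); last by rewrite /Q le_eqVlt; apply/orP; left; apply/eqP; ring.
  by rewrite ler_wpM2l // mulr_ge0; lra.
have Q5 : j * M <= t * M by rewrite ler_wpM2r.
have Q6 : t <= t * k by rewrite ler_mul1 //; lra.
have Q7 : k <= k * n by rewrite ler_mul1 //; lra.
have Q8 : M <= t * M by rewrite mulrC ler_mul1.
have Q9 : t * N <= t * k * N by rewrite ler_wpM2r // ler_mul1 //; lra.
have Q10 : n <= k * n by rewrite mulrC ler_mul1 //; lra.
have Q11 : 0 <= t * N by rewrite mulr_ge0 //; lra.
lra.
Qed.

(** Logarithms give [n <= 1 + ln Delta / ln 2]; the constant [1 + 2] is absorbed by the maximum with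
    1. *)
Lemma log_rounds Delta (n : nat) : 2 ^+ n <= 2 * Delta ->
  (n + 2)%:R <= (3 + (ln 2)^-1) * Num.max 1 (ln Delta).
Proof.
move=> h; have l2 : 0 < ln (2 : R) by rewrite ln_gt0 // ltr1n.
have p2 : 0 < (2 : R) ^+ n by rewrite exprn_gt0.
have D0 : 0 < Delta by lra.
have h' : n%:R * ln 2 <= ln 2 + ln Delta.
  by rewrite mulr_natl -lnXn // -lnM ?posrE // ler_ln ?posrE // mulr_gt0.
have nle : n%:R <= 1 + ln Delta * (ln 2)^-1.
  by rewrite -(@ler_pM2r _ (ln 2)) // mulrDl mul1r mulfVK ?gt_eqF.
set m := Num.max _ _.
have m1 : 1 <= m by rewrite /m le_max lexx.
have m2 : ln Delta * (ln 2)^-1 <= m * (ln 2)^-1.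
  by rewrite ler_pM2r ?invr_gt0 // /m le_max lexx orbT.
by rewrite natrD mulrDl; have := mulrC m (ln 2)^-1; lra.
Qed.

Lemma powR2_expr D (i : nat) : (2 `^ D) ^+ i = (2 ^+ i) `^ D.
Proof. by rewrite -powR_mulrn ?powR_ge0 // -powRrM mulrC powRrM powR_mulrn. Qed.

(** For [j > 0], minimality of [j] gives [2 ^ j < 2 / eps], so [2 ^ (j + 6) < 128 / eps], well
    within [768 / eps]. For [j = 0] the cap [e <= 768] makes both the base and the power at least
    1. *)
Lemma time_bound_ge (k : nat) eps D Delta (n j : nat) : 0 < eps -> 0 <= D ->
  (forall i, (i < j)%N -> eps * 2 ^+ i < 1) -> 2 ^+ n <= 2 * Delta ->
  k%:R * (n + 2)%:R * 2 ^+ j * (if j == 0%N then 1 else (2 `^ D) ^+ (j + 6)) <=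
  768 * (3 + (ln 2)^-1) * time_bound k eps D Delta.
Proof.
move=> e0 D0 hj /log_rounds hn; rewrite /time_bound.
set C := 3 + _ in hn *; set m := Num.max 1 _ in hn *; set e := Num.min _ _.
have ep : 0 < e by rewrite /e lt_min e0 ltr0n.
have C0 : 0 <= C.
  by rewrite /C addr_ge0 ?invr_ge0 ?ln_ge0 ?ler1n.
have m0 : 0 <= m by rewrite /m le_max ler01.
have k0 : 0 <= k%:R :> R by rewrite ler0n.
suff h : 2 ^+ j * (if j == 0%N then 1 else (2 `^ D) ^+ (j + 6)) <=
    768 * (e^-1 * (768 / e) `^ D).
  have -> : 768 * C * (k%:R / e * (768 / e) `^ D * m) =
      k%:R * (C * m) * (768 * (e^-1 * (768 / e) `^ D)) by ring.
  rewrite -mulrA ler_pM //; first by rewrite mulr_ge0.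
  - by rewrite mulr_ge0 ?exprn_ge0 //; case: ifP => // _; rewrite exprn_ge0 ?powR_ge0.
  - by rewrite ler_wpM2l.
have e768 : e <= 768 by rewrite /e ge_min lexx orbT.
case: (posnP j) hj => [-> _|j0 hj].
  rewrite expr0 mulr1.
  have h1 : 1 <= 768 / e by rewrite ler_pdivlMr // mul1r.
  have h2 : 1 <= (768 / e) `^ D.
    have := @ge0_ler_powR _ D D0 1 (768 / e); rewrite powR1; apply=> //.
      by rewrite nnegrE ler01.
    by rewrite nnegrE; apply: le_trans h1; apply: ler01.
  rewrite mulrA; apply: (le_trans h1); rewrite ler_peMr //; exact: le_trans h1.
have hlt : eps * 2 ^+ j < 2.
  have := hj j.-1; rewrite ltn_predL j0 => /(_ isT).
  by rewrite -{2}(prednK j0) exprS; lra.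
have ee : e = eps.
  have j1 : 1 <= (2 : R) ^+ j by rewrite exprn_ege1 // ler1n.
  have : eps <= eps * 2 ^+ j by rewrite ler_peMr // ltW.
  by rewrite /e => h; rewrite min_l //; lra.
rewrite ee.
have h1 : 2 ^+ j <= 2 * eps^-1 by rewrite ler_pdivlMr // mulrC ltW.
have h2 : (2 `^ D) ^+ (j + 6) <= (768 / eps) `^ D.
  have ip : 0 < eps^-1 by rewrite invr_gt0.
  rewrite powR2_expr ge0_ler_powR // ?nnegrE ?exprn_ge0 //; first by rewrite mulr_ge0 // ltW.
  have e6 : (2 : R) ^+ 6 = 64 by ring.
  by rewrite exprD e6; lra.
rewrite mulrA ler_pM ?exprn_ge0 ?powR_ge0 //; apply: (le_trans h1).
by rewrite ler_pM2r ?invr_gt0 // ler_nat.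
Qed.

Lemma work_time_bound (k n j M N w : nat) eps D Delta :
  (0 < k)%N -> 0 < eps -> 0 <= D -> 2 <= 2 `^ D ->
  (forall i, (i < j)%N -> eps * 2 ^+ i < 1) -> 2 ^+ n <= 2 * Delta ->
  (j = 0%N -> M <= k)%N -> M%:R <= k%:R * (2 `^ D) ^+ (j + 2) ->
  N%:R <= (n + 2)%:R * (2 `^ D) ^+ (j + 6) ->
  (w <= 59 + 80 * k.+1 * n.+1 + j * (48 * M + 13) + 40 * M +
   (k < M)%N * (2 ^ (j + 2) * (8 + 40 * M + k.+1 * (20 + 60 * N))) + 10 * k)%N ->
  w%:R <= 1200 * 768 * (3 + (ln 2)^-1) * time_bound k eps D Delta.
Proof.
move=> k0 e0 D0 D2 hj hD Mk MP NP hw.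
have k1 : 1 <= k%:R :> R by rewrite ler1n.
have n2 : 2 <= (n + 2)%:R :> R by rewrite ler_nat leq_addl.
have nE : (n.+1)%:R = (n + 2)%:R - 1 :> R by rewrite -natr1 natrD; lra.
have kE : (k.+1)%:R = k%:R + 1 :> R by rewrite -natr1.
have B1 : 1 <= 2 `^ D by lra.
have tb := time_bound_ge k e0 D0 hj hD.
apply: (@le_trans _ _ (1200 * (k%:R * (n + 2)%:R * 2 ^+ j *
    (if j == 0%N then 1 else (2 `^ D) ^+ (j + 6))))); last first.
  move: tb; set TB := time_bound _ _ _ _ => tb.
  have -> : 1200 * 768 * (3 + (ln 2)^-1) * TB = 1200 * (768 * (3 + (ln 2)^-1) * TB) by rewrite !mulrA.
  by rewrite ler_pM2l.
move: hw; rewrite -(ler_nat R) => /le_trans; apply.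
have [x xE] : exists x : R, x = (n + 2)%:R by eexists.
rewrite -xE in n2 nE NP *.
(* For [j = 0] the last level is level [m], with at most [k] rows; the factor [k < M] vanishes, and
   with it the cost of all searches. *)
case: (posnP j) Mk MP NP {tb hj} => [-> /(_ erefl) Mk _ _|jp _ MP NP].
  rewrite expr0 !mulr1 ltnNge Mk !mul0n !addn0 !(natrM, natrD) nE kE.
  by apply: coarse_work; rewrite // ler_nat.
apply: (@le_trans _ _ (59 + 80 * (k%:R + 1) * (x - 1) + j%:R * (48 * M%:R + 13) + 40 * M%:R +
  4 * 2 ^+ j * (8 + 40 * M%:R + (k%:R + 1) * (20 + 60 * N%:R)) + 10 * k%:R)).
  have e4 : (2 ^ (j + 2))%N%:R = 4 * 2 ^+ j :> R by rewrite natrX exprD mulrC; congr (_ * _); ring.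
  have hb : ((k < M)%N * (2 ^ (j + 2) * (8 + 40 * M + k.+1 * (20 + 60 * N))))%N%:R <=
      4 * 2 ^+ j * (8 + 40 * M%:R + (k%:R + 1) * (20 + 60 * N%:R)) :> R.
    rewrite -kE -e4 -!(natrM, natrD) ler_nat; case: (k < M)%N; by rewrite ?mul1n ?mul0n.
  move: (nat_of_bool (k < M)%N * _)%N hb => Z hb.
  by rewrite !(natrM, natrD) nE kE lerD2r lerD2l.
apply: fine_work => //.
- by rewrite ler0n -natrX ler_nat ltnW // ltn_expl.
- by rewrite exprn_ege1 // ler1n.
- by rewrite exprn_ege1.
- rewrite ler0n; apply: (le_trans MP); rewrite ler_wpM2l //.
  by rewrite ler_weXn2l // leq_add2l.
- by rewrite ler0n NP.
Qed.

End TimeBound.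

(** * Approximation guarantee and total cost *)

Section Correctness.
Context {R : realType} {U : metricType R} (T : tree U) (S : {fset U}).
Hypothesis ctT : cover_tree T S.
Context (X : etree U) (coal : int -> U -> enode X).
Hypothesis coX : coalescing T S coal.
Context (k : nat) (eps D : R).
Hypotheses (k0 : (0 < k)%N) (kS : (k < #|` S|)%N) (eps0 : 0 < eps).
Hypotheses (D0 : 0 <= D) (dD : doubling U D).
Implicit Types (s : hstate X) (l : int).
Local Notation ropt := (kcenter_opt k S).

Lemma halvings : exists j : nat, 1 <= eps * 2 ^+ j /\
  forall i, (i < j)%N -> eps * 2 ^+ i < 1.
Proof.
have ex : exists j : nat, 1 <= eps * 2 ^+ j.
  exists (Num.trunc eps^-1).+1; rewrite mulrC -ler_pdivrMr // mul1r.
  apply: (@le_trans _ _ (Num.trunc eps^-1).+1%:R); first by rewrite ltW // truncnS_gt.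
  by rewrite -natrX ler_nat ltnW // ltn_expl.
case: (ex_minnP ex) => j hj min; exists j; split=> // i ij.
by rewrite ltNge; apply/negP => /min; rewrite leqNgt ij.
Qed.

Lemma S_neq0 : S != fset0.
Proof. by rewrite -cardfs_gt0; apply: leq_trans kS. Qed.

Lemma ropt_sep (ps : seq U) d : uniq ps -> {subset ps <= S} -> (k < size ps)%N ->
  (forall x y, x \in ps -> y \in ps -> x != y -> d < mdist x y) -> d <= 2 * ropt.
Proof. exact: kcenter_opt_ge. Qed.

(** The level is itself an admissible set of centers, and covering bounds its radius. *)
Lemma ropt_le l : l <= top_level T -> (0 < #|` level T l| <= k)%N -> ropt <= 2 ^ (l + 1).
Proof.
move=> lt /andP[c0 ck]; apply: (@le_trans _ _ (center_radius (level T l) S)).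
  by apply: kcenter_opt_le => //; [apply: (ct_sub ctT) | rewrite -cardfs_gt0].
by apply: (center_radius_le S_neq0) => p pS; apply: (level_cover_S ctT).
Qed.

Lemma ropt_ge l : (k < #|` level T (l - 1)|)%N -> 2 ^ l <= 4 * ropt.
Proof.
move=> lk; have : 2 ^ (l - 1) <= 2 * ropt.
  apply: (ropt_sep (ps := enum_fset (level T (l - 1)))) => //.
  - exact: fset_uniq.
  - exact: (fsubsetP (ct_sub ctT _)).
  - by move=> x y; apply: (ct_separation ctT).
have -> : (2 : R) ^ l = 2 * 2 ^ (l - 1) by rewrite -pow2S subrK.
lra.
Qed.

Lemma kcenter_correct s : reg s rNode = VNode (eroot X) -> reg s rK = VInt X (Posz k) ->
  reg s rEps = VReal X eps -> (forall x, arr s aMark x = VNil X) -> hout s = [::] ->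
  clk s = 0%N ->
  wp kcenter (fun s' => [/\ hout s' != [::], (size (hout s') <= k)%N,
    {subset hout s' <= S},
    forall p, p \in S -> exists2 q, q \in hout s' & mdist p q <= (2 + 24 * eps) * ropt &
    (clk s')%:R <= 1200 * 768 * (3 + (ln 2)^-1) * time_bound k eps D (aspect_ratio S)]) s.
Proof.
move=> h0 hk he hm ho hc.
have [j [hj1 hj2]] := halvings.
apply: wp_seq; apply: (wp_weaken _ (init_rep ctT coX kS k0 h0 hk he)) => //.
move=> s1 [g1 [V1 [L [sc1 [p [q [rp1 V11 [pS qS pq dpq] ck1]]]]]]] [_ ua1 uo1].
have V1k : (size V1 <= k)%N by rewrite V11.
apply: wp_seq; apply: (wp_weaken _ (find_level_rep ctT coX kS rp1 V1k)) => //.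
move=> s2 [g2 [a2 [V2 [m [sc2 [rp2 V2k mk mL ck2]]]]]] [_ ua2 uo2].
apply: wp_seq; apply: (wp_weaken _ (refine_rep ctT coX rp2 hj1 hj2)) => //.
move=> s3 [g [a [V [sc [rp3 ck3]]]]] [_ ua3 uo3].
have ok := rp_ok rp3; have /andP[sc_lo sc_hi] := rp_scale rp3.
have [_ Lt] := ro_top (rp_ok rp2); have mt : m <= top_level T by exact: le_trans mL Lt.
have lt : m - j%:Z <= top_level T by rewrite (le_trans _ mt) // lerBlDr lerDl.
have cm : (0 < #|` level T m| <= k)%N.
  by rewrite -(size_rep coX rp2) V2k (ro_pos (rp_ok rp2)).
have r_up := ropt_le mt cm; have r_lo := ropt_ge mk.
have em : (2 : R) ^ m = 2 ^ (m - j%:Z) * 2 ^+ j by rewrite exprnP -pow2D subrK.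
have pm := @pow2_gt0 R m; have pmj := @pow2_gt0 R (m - j%:Z).
have j1 : 1 <= (2 : R) ^+ j by rewrite exprn_ege1 // ler1n.
have mjm : (2 : R) ^ (m - j%:Z) <= 2 ^ m by rewrite em ler_peMr // ltW.
rewrite (pow2S m) in r_up.
have ropt0 : 0 <= ropt by move: r_lo pm; lra.
have D2 : 2 <= 2 `^ D :> R by exact: doubling_ge2 dD pq.
have [n nE] : exists n, n = `|L - m|%N by eexists.
have nL : m + n%:Z = L by move: mL; rewrite nE; clear; lia.
have B1 : 1 <= 2 `^ D :> R by apply: le_trans D2; rewrite ler1n.
pose N := Num.trunc ((n + 2)%:R * (2 `^ D) ^+ (j + 6) : R).
have NB0 : 0 <= (n + 2)%:R * (2 `^ D) ^+ (j + 6) :> R by rewrite mulr_ge0 // exprn_ge0 // powR_ge0.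
(* The choice [G = 2 ^ (j + 2)] works because [G * sc > 4 * 2 ^ m >= 2 * ropt]. *)
have hG : 2 * ropt < (2 ^ (j + 2))%N%:R * sc.
  have e4 : (2 : R) ^+ 2 = 4 by ring.
  rewrite natrX exprD e4.
  have : 2 ^+ j * 2 ^ (m - j%:Z) < 2 ^+ j * sc by rewrite ltr_pM2l // (lt_le_trans _ j1).
  by rewrite mulrC -em; move: r_up; lra.
(* Thresholds stay below [4 * 2 ^ m + 4 * 2 ^ (m - j) <= 8 * 2 ^ m], as [visited_count] demands. *)
have hN tau c qs : 0 < tau -> tau <= 2 * ropt + sc -> uniq qs ->
    all (visited g a V tau c) qs -> (size qs <= N)%N.
  move=> _ ht uq vq; rewrite truncn_ge_nat //.
  rewrite nE; apply: (visited_count ctT dD D2 ok _ mL uq vq) => //.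
  by move: ht r_up sc_hi mjm pm; lra.
have hm3 x : (a <= x < a + size V)%N -> arr s3 aMark x = VNil X.
  by move=> _; rewrite ua3 // ua2 // ua1.
apply: wp_seq; apply: (wp_weaken _ (search_spec ctT rp3 ropt0 hm3 ropt_sep hG hN)) => //.
move=> s4 [cs [tau [cst cen csk /andP[tau0 tau1] [cov ck4]]]] [_ _ uo4].
apply: wp_seq; apply: (wp_mono _ (print_centers_spec cst cen)) => s5 [out5 ck5].
apply: wp_skip.
have o5 : hout s5 = map (rpoint g) cs by rewrite out5 uo4 // uo3 // uo2 // uo1 // ho.
have [_ _ _ cin] := cen.
have V0 := ro_pos ok.
have cov_p x : x \in S -> exists2 y, y \in hout s5 & mdist x y <= (2 + 24 * eps) * ropt.
  move=> xS; have [y yl d1] := level_cover_S ctT lt xS.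
  have [_ _ onto] := ro_enum ok; have := onto _ yl.
  move/(nthP (eroot X)) => [i iV ei].
  have iab : (a <= a + i < a + size V)%N by rewrite leq_addr ltn_add2l.
  have [c cc d2] := cov _ iab.
  have ey : rpoint g (a + i) = y.
    by rewrite /rpoint; have [-> _] := ro_seg ok iV; rewrite ei (co_point coX).
  exists (rpoint g c); first by rewrite o5 map_f.
  rewrite ey in d2; rewrite pow2S in d1.
  have h1 : 2 ^ (m - j%:Z) <= eps * 2 ^ m.
    by rewrite em mulrCA ler_peMr // ltW.
  have h2 : eps * 2 ^ m <= eps * (4 * ropt) by rewrite ler_pM2l.
  (* The 24 arises here: [d1] contributes at most [8 * eps * ropt], and the excess [sc] of [tau]
     over [2 * ropt] at most [16 * eps * ropt]. *)
  by have := metric_triangle x y (rpoint g c); move: d1 d2 h1 h2 tau1 sc_hi; lra.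
split=> //.
- have [x xS] : exists x, x \in S by apply/fset0Pn/S_neq0.
  by have [y] := cov_p _ xS; case: (hout s5).
- by rewrite o5 size_map.
- move=> y; rewrite o5 => /mapP[c /cin /andP[_ cb] ->].
  exact: (fsubsetP (ct_sub ctT _) _ (ro_level ok cb)).
(* The siblings found by [init] are more than [2 ^ (L - 1)] apart, and [close_pair] at level [m]
   gives a pair within [2 ^ m]; with [n = L - m] their ratio exceeds half of [2 ^+ n]. *)
have hD : 2 ^+ n <= 2 * aspect_ratio S.
  have [d d0 sep] := min_dist_bound ctT.
  have nS : ~~ (S `<=` level T m).
    apply/negP => /fsubset_leq_card h; move: kS; rewrite ltnNge => /negP; apply.
    by apply: leq_trans h _; case/andP: cm.
  have [x [y [xS yS xy dxy]]] := close_pair ctT mt nS.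
  have h1 := aspect_ratio_ge d0 sep pS qS pq xS yS xy.
  have A0 : 0 < aspect_ratio S.
    rewrite ltNge; apply/negP => A0; have : 0 < mdist p q by rewrite mdist_gt0.
    have : aspect_ratio S * mdist x y <= 0 by rewrite mulr_le0_ge0 // mdist_ge0.
    by move: h1; lra.
  have h2 : aspect_ratio S * mdist x y <= aspect_ratio S * 2 ^ m by rewrite ler_pM2l.
  rewrite -(@ler_pM2r _ (2 ^ m)) // mulrC exprnP -pow2D nL.
  have -> : (2 : R) ^ L = 2 * 2 ^ (L - 1) by rewrite -pow2S subrK.
  by rewrite -mulrA ler_pM2l //; move: dpq h1 h2; lra.
have sV : size V = #|` level T (m - j%:Z)| by exact: (size_rep coX rp3).
apply: (@work_time_bound _ k n j #|` level T (m - j%:Z)| N) => //.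
- by move=> ->; rewrite subr0; case/andP: cm.
- apply: (le_trans (level_card ctT dD j mt)).
  rewrite ler_wpM2r ?exprn_ge0 ?powR_ge0 // ler_nat; case/andP: cm => //.
- by rewrite truncn_le.
- move: ck1 ck2 ck3 ck4 ck5 csk; rewrite sV hc -nE; clear.
  move: #|` _| => M; move: (j * _)%N (80 * _ * _)%N (nat_of_bool (k < M)%N * _)%N => x1 x2 x3; lia.
Qed.

End Correctness.

Theorem theorem3 (R : realType) :
  exists (P : program) (a b : R), [/\ 0 < a, 0 < b &
    forall (U : metricType R) (D : R) (S : {fset U}) (X : etree U)
      (k : nat) (eps : R),
      doubling_dimension U D ->
      augmented_cover_tree X S ->
      (0 < k)%N -> (k < #|` S|)%N -> 0 < eps ->
      exists (C : {fset U}) (t : nat),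
        [/\ returns X P k eps t C,
            C `<=` S /\ C != fset0,
            (#|` C| <= k)%N,
            center_radius C S <= (2 + a * eps) * kcenter_opt k S &
            t%:R <= b * time_bound k eps D (aspect_ratio S)]].
Proof.
exists (compile 0 kcenter), 24, (1200 * 768 * (3 + (ln 2)^-1)).
have l2 : 0 < ln (2 : R) by rewrite ln_gt0 // ltr1n.
split=> //; first by apply: mulr_gt0; [rewrite mulr_gt0 | rewrite addr_gt0 // invr_gt0].
move=> U D S X k eps [D0 dD _] [T [ctT [coal coX]]] k0 kS eps0.
(* Array cells start at address 64, beyond the inputs, so every array is initially [VNil]; a mark
   [VNil] compares with no threshold and counts as absent. *)
pose s0 := HState (Defs.mem (initial X k eps)) (fun _ _ => VNil X) [::] 0.
have h := @kcenter_correct _ _ _ _ ctT _ _ coX _ _ _ k0 kS eps0 D0 dD s0 erefl erefl erefl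
  (fun=> erefl) erefl erefl.
have [||||t [s' [m [e1 [_ _ e2] e3 [q1 q2 q3 q4 q5] e4]]]] :=
  @wp_sound _ _ X (compile 0 kcenter) kcenter 0 _ s0 (initial X k eps) _ _ _ _ h.
- by [].
- by move=> i; rewrite add0n.
- by [].
- by split.
exists [fset p in hout s'], t; split.
- by rewrite /returns e1 e3 size_compile e2.
- split; first by apply/fsubsetP => p; rewrite inE => /q3.
  by case E: (hout s') q1 => [//|p ps] _; apply/fset0Pn; exists p; rewrite !inE eqxx.
- apply: leq_trans q2; rewrite card_fseq; exact: size_undup.
- apply: center_radius_le; first by rewrite -cardfs_gt0; apply: leq_trans kS.
  by move=> p /q4[q qo d]; exists q => //; rewrite inE.
- by apply: le_trans q5; rewrite ler_nat.
Qed.
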